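(* Let $n\ge 2$, let $K=K(t,x,u,u_1,\dots,u_n)$ be smooth with $\partial K/\partial u_n$ nowhere zero, and let $\Delta=u_t-K$. For a differential operator $\mathcal E=\sum_i r_i(t,x,u,u_1,\dots)D_x^i$ put $\epsilon=-\frac12\sum_i r_i\theta^i$ and $$\omega_{\mathcal E} = dx \wedge \theta^0 \wedge \epsilon -dt \wedge \sum _{j=1}^{n} \sum_{a=1}^{j} (-X)^{a-1}\Big(\frac{\partial K}{\partial u_{j}}\, \epsilon\Big)\wedge \theta^{j-a}.$$ Then $\Phi(\mathcal E)=[\omega_{\mathcal E}]$ defines an isomorphism between the vector space consisting of $0$ and all symplectic operators $\mathcal E=\sum_i r_i(t,x,u,u_1,\dots)D_x^i$ for which $u_t=K$ is Hamiltonian, and the cohomology space $H^{1,2}(\mathcal R^\infty)$.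
   Context: Write $u_0=u$, $u_1=u_x$, $u_i=\partial_x^i u$; smooth functions depend on finitely many coordinates. $\mathcal R^\infty$ is the infinitely prolonged equation manifold of $u_t=K$, with coordinates $(t,x,u,u_1,u_2,\dots)$. On it $X=\partial_x+\sum_i u_{i+1}\partial_{u_i}$, $T=\partial_t+\sum_i X^i(K)\partial_{u_i}$, $\theta^i=du_i-X^i(K)\,dt-u_{i+1}\,dx$. $\Omega^{r,s}(\mathcal R^\infty)$ is the space of forms that are finite sums of a function times $r$ of the forms $dt,dx$ wedged with $s$ of the $\theta^i$. $X$ and $T$ act on forms by Lie derivative (so they annihilate $dt,dx$ and $X(\theta^i)=\theta^{i+1}$). $d_H\omega=dx\wedge X(\omega)+dt\wedge T(\omega)$ and $H^{r,s}(\mathcal R^\infty)=\ker(d_H|_{\Omega^{r,s}})/d_H(\Omega^{r-1,s})$. Symplectic operators: let $E=\mathbb R\times J^\infty(\mathbb R,\mathbb R)$, also with coordinates $(t,x,u,u_1,u_2,\dots)$, $D_x=\partial_x+\sum_i u_{i+1}\partial_{u_i}$, $\theta^i_E=du_i-u_{i+1}dx$. $\Omega^{r,s}_{t_{sb}}(E)$ ($r=0,1$) is the space of forms that are finite sums of a function on $E$ times $dx$ ($r$ times) wedged with $s$ of the $\theta^i_E$. $D_x$ acts on these forms as a derivation with $D_x(dx)=0$, $D_x(\theta^i_E)=\theta^{i+1}_E$; $d^E_V$ is the anti-derivation with $d^E_Vf=\sum_i(\partial f/\partial u_i)\theta^i_E$, $d_V^E(dx)=0$, $d^E_V\theta^i_E=0$.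 For $\Sigma\in\Omega^{1,s}_{t_{sb}}(E)$, $s\ge1$, $I_E(\Sigma)=\frac1s\theta^0_E\wedge\sum_i(-D_x)^i(\partial_{u_i}\lrcorner\,\Sigma)$, and $\delta^E_V=I_E\circ d^E_V$. A differential operator $\mathcal S=\sum s_iD_x^i$ is symplectic if it is skew-adjoint ($\mathcal S^*=-\mathcal S$ where $\mathcal S^*(f)=\sum(-D_x)^i(s_if)$), and $\Sigma=dx\wedge\theta^0_E\wedge\sum_i s_i\theta^i_E$ satisfies $\Sigma\ne0$ and $\delta^E_V\Sigma=0$. The equation $u_t=K$ is Hamiltonian for $\mathcal S$ if, with $T=\partial_t+\sum_i D_x^i(K)\partial_{u_i}$ on $E$, one has $I_E\circ\pi^{1,2}\circ\mathcal L_T\Sigma=0$, where $\mathcal L_T$ is the Lie derivative and $\pi^{1,2}$ is the projection obtained by writing a form in the coframe $dt,dx,\theta^i_E$ and keeping only the $dx\wedge\theta^i_E\wedge\theta^j_E$ terms. *)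

(* Defs.v *)
From HB Require Import structures.
From mathcomp Require Import all_boot all_order all_algebra.
From mathcomp Require Import all_classical all_reals all_analysis.
Set Implicit Arguments.
Unset Strict Implicit.
Unset Printing Implicit Defensive.
Import Order.TTheory GRing.Theory Num.Theory.
Import numFieldNormedType.Exports.
Local Open Scope classical_set_scope.
Local Open Scope ring_scope.

(* Both R^oo and E are the space of all points (t, x, u, u_1, u_2, ...). *)
Variant coord := ct | cx | cu of nat.

Definition coord_code (c : coord) : bool + nat :=
  match c with ct => inl false | cx => inl true | cu i => inr i end.
Definition coord_decode (s : bool + nat) : coord :=
  match s with inl false => ct | inl true => cx | inr i => cu i end.
Lemma coord_codeK : cancel coord_code coord_decode.
Proof. by case. Qed.
HB.instance Definition _ := Countable.copy coord (can_type coord_codeK).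

Definition is_u (c : coord) : bool := if c is cu _ then true else false.

Section Jet.
Variable R : realType.

Definition jet := {ptws coord -> R}.
Definition fn := jet -> R^o.

(* ---- smooth functions of finitely many coordinates ---- *)

Definition upd (p : jet) (c : coord) (h : R) : jet :=
  fun c' => if c' == c then h else p c'.

Definition partial (c : coord) (f : fn) : fn :=
  fun p => derive1 (fun h : R => f (upd p c h)) (p c).

Definition has_partial (c : coord) (f : fn) : Prop :=
  forall p : jet, derivable (fun h : R => f (upd p c h)) (p c) 1.

Definition depends_upto (n : nat) (f : fn) : Prop :=
  forall p q : jet, p ct = q ct -> p cx = q cx ->
    (forall i, (i <= n)%N -> p (cu i) = q (cu i)) -> f p = f q.

(* For a function of finitely many coordinates, continuity for the product
   topology is continuity in these coordinates, so the second clause is the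
   usual C^oo condition: iterated partial derivatives of every order exist and
   are continuous. *)
Definition smooth (f : fn) : Prop :=
  (exists n, depends_upto n f) /\
  (forall cs : seq coord, let g := foldr partial f cs in
    continuous (g : {ptws coord -> R} -> R) /\ forall c, has_partial c g).

Definition coordfn (c : coord) : fn := fun p => p c.

(* ---- vector fields: V stands for \sum_c V c * d/dc ---- *)

Definition vfield := coord -> fn.

(* Sums \sum_(i \in setT) are sums of finitely supported families; on smooth
   functions, and on forms with finitely many terms, they are all finite. *)
Definition vact (V : vfield) (f : fn) : fn :=
  \sum_(c \in [set: coord]) V c * partial c f.

(* X on R^oo and D_x on E have the same coordinate expression, and so does T
   on both. *)
Definition Xf : vfield := fun c =>
  match c with ct => 0 | cx => 1 | cu i => coordfn (cu i.+1) end.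

Definition Tf (K : fn) : vfield := fun c =>
  match c with ct => 1 | cx => 0 | cu i => iter i (vact Xf) K end.

(* ---- differential forms ---- *)

(* Forms are written in the coframe dt, dx, theta^0, theta^1, ... (labels ct,
   cx, cu i), where theta^i = du_i - F_i dt - u_(i+1) dx for a family F that
   is F_i = X^i(K) on R^oo and F_i = 0 on E. The value of w at [:: c1; ...; ck]
   is the value of w on the dual frame vectors e_c1, ..., e_ck; forms of
   different degrees may be added. The frame vector dual to theta^i is
   d/du_i. *)
Definition form := seq coord -> fn.

Definition fmul (f : fn) (w : form) : form := fun s => f * w s.

Definition one_form0 : form := fun s => (s == [::])%:R.

Definition gen (c : coord) : form := fun s => (s == [:: c])%:R.

Definition contract (c : coord) (w : form) : form := fun s => w (c :: s).

Definition degsign (w : form) : form := fun s => (-1) ^+ size s * w s.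

(* Contraction being an antiderivation,
     e_c _| (v /\ w) = (e_c _| v) /\ w + (-1)^(deg v) v /\ (e_c _| w),
   computes the exterior product; gen c /\ gen c' is 1 at [:: c; c']. *)
Fixpoint wedge_at (s : seq coord) (v w : form) : fn :=
  if s is c :: s' then
    wedge_at s' (contract c v) w + wedge_at s' (degsign v) (contract c w)
  else v [::] * w [::].

Definition wedge (v w : form) : form := fun s => wedge_at s v w.

Definition monomial (cs : seq coord) : form :=
  foldr (fun c w => wedge (gen c) w) one_form0 cs.

Definition Omega (r s : nat) : set form :=
  [set w | exists N (f : 'I_N -> fn) (l : 'I_N -> seq coord),
     (forall k, [/\ smooth (f k),
                    count (predC is_u) (l k) = r & count is_u (l k) = s]) /\
     w = \sum_(k < N) fmul (f k) (monomial (l k))].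

(* The derivation of the exterior algebra acting on functions by V and on the
   coframe by e^c |-> lam c. *)
Definition derivation (V : vfield) (lam : coord -> form) (w : form) : form :=
  (fun s => vact V (w s)) +
  \sum_(c \in [set: coord]) wedge (lam c) (contract c w).

(* ---- exterior and Lie derivatives in the coframe attached to F ---- *)

Definition dcoord (F : nat -> fn) (c : coord) : form :=
  match c with
  | ct => gen ct
  | cx => gen cx
  | cu i => gen (cu i) + fmul (F i) (gen ct) + fmul (coordfn (cu i.+1)) (gen cx)
  end.

Definition dfun (F : nat -> fn) (f : fn) : form :=
  \sum_(c \in [set: coord]) fmul (partial c f) (dcoord F c).

(* L_V(dc) = d(V c), and the Leibniz rule for du_i - F_i dt - u_(i+1) dx. *)
Definition lie_coframe (F : nat -> fn) (V : vfield) (c : coord) : form :=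
  match c with
  | ct => dfun F (V ct)
  | cx => dfun F (V cx)
  | cu i => dfun F (V (cu i))
      - (fmul (vact V (F i)) (gen ct) + fmul (F i) (dfun F (V ct)))
      - (fmul (V (cu i.+1)) (gen cx)
         + fmul (coordfn (cu i.+1)) (dfun F (V cx)))
  end.

Definition lie (F : nat -> fn) (V : vfield) : form -> form :=
  derivation V (lie_coframe F V).

(* ---- the equation manifold R^oo of u_t = K ---- *)

Definition coframeK (K : fn) (i : nat) : fn := iter i (vact Xf) K.

Definition lieX (K : fn) : form -> form := lie (coframeK K) Xf.
Definition lieT (K : fn) : form -> form := lie (coframeK K) (Tf K).

Definition dH (K : fn) (w : form) : form :=
  wedge (gen cx) (lieX K w) + wedge (gen ct) (lieT K w).

Definition cocycles (K : fn) (r s : nat) : set form :=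
  [set w | Omega r s w /\ dH K w = 0].

Definition coboundaries (K : fn) (r s : nat) : set form :=
  dH K @` Omega r.-1 s.

(* ---- variational operators on E, where F = 0 ---- *)

(* dt does not occur in the forms D_x is applied to; its image is irrelevant. *)
Definition Dx : form -> form :=
  derivation Xf (fun c => if c is cu i then gen (cu i.+1) else 0).

Definition dV (w : form) : form :=
  \sum_(i \in [set: nat])
    wedge (gen (cu i)) (fun s => partial (cu i) (w s)).

(* I_E on forms of vertical degree s. *)
Definition IE (s : nat) (w : form) : form :=
  (s%:R^-1 : R) *: wedge (gen (cu 0))
    (\sum_(i \in [set: nat])
       iter i (fun v => - Dx v) (contract (cu i) w)).

(* delta_V on forms of vertical degree s, so that I_E is taken on s + 1. *)
Definition deltaV (s : nat) (w : form) : form := IE s.+1 (dV w).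

Definition pi12 (w : form) : form := fun s =>
  if [&& count_mem ct s == 0, count_mem cx s == 1 & count is_u s == 2]%N
  then w s else 0.

(* ---- differential operators \sum_i r_i D_x^i, given by (r_i) ---- *)

Definition diffop (r : nat -> fn) : Prop :=
  (forall i, smooth (r i)) /\ exists m, forall i, (m <= i)%N -> r i = 0.

Definition op_apply (r : nat -> fn) (f : fn) : fn :=
  \sum_(i \in [set: nat]) r i * iter i (vact Xf) f.

Definition op_adjoint (r : nat -> fn) (f : fn) : fn :=
  \sum_(i \in [set: nat]) iter i (fun g => - vact Xf g) (r i * f).

Definition skew_adjoint (r : nat -> fn) : Prop :=
  forall f, smooth f -> op_adjoint r f = - op_apply r f.

Definition op_theta (r : nat -> fn) : form :=
  \sum_(i \in [set: nat]) fmul (r i) (gen (cu i)).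

Definition op_Sigma (r : nat -> fn) : form :=
  wedge (gen cx) (wedge (gen (cu 0)) (op_theta r)).

Definition symplectic (r : nat -> fn) : Prop :=
  [/\ diffop r, skew_adjoint r, op_Sigma r <> 0 & deltaV 2 (op_Sigma r) = 0].

Definition hamiltonian (K : fn) (r : nat -> fn) : Prop :=
  IE 2 (pi12 (lie (fun=> 0) (Tf K) (op_Sigma r))) = 0.

Definition hamiltonian_operators (K : fn) : set (nat -> fn) :=
  [set r | r = 0 \/ symplectic r /\ hamiltonian K r].

(* ---- the representative omega_E ---- *)

Definition epsilon (r : nat -> fn) : form := - (2^-1 : R) *: op_theta r.

Definition omega (n : nat) (K : fn) (r : nat -> fn) : form :=
  wedge (gen cx) (wedge (gen (cu 0)) (epsilon r))
  - wedge (gen ct)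
      (\sum_(1 <= j < n.+1) \sum_(1 <= a < j.+1)
         wedge (iter a.-1 (fun w => - lieX K w)
                  (fmul (partial (cu j) K) (epsilon r)))
               (gen (cu (j - a)))).

(* ---- quotients of subspaces, as sets of cosets ---- *)

Definition linear_subspace (W : lmodType R) (S : set W) : Prop :=
  S 0 /\ forall (a : R) v w, S v -> S w -> S (a *: v + w).

Definition coset_mod (W : lmodType R) (B : set W) (w : W) : set W :=
  [set w + b | b in B].

Definition quotient_mod (W : lmodType R) (Z B : set W) : set (set W) :=
  coset_mod B @` Z.

(* Phi is a linear bijection of V onto Z / B, the linear operations of Z / B
   being those induced from representatives. *)
Definition linear_isomorphism (U W : lmodType R)
    (V : set U) (Z B : set W) (Phi : U -> set W) : Prop :=
  [/\ linear_subspace V, [/\ linear_subspace Z, linear_subspace B & B `<=` Z],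
      set_bij V (quotient_mod Z B) Phi &
      forall (a : R) u v, V u -> V v -> forall w w', Phi u w -> Phi v w' ->
        Phi (a *: u + v) = coset_mod B (a *: w + w')].

End Jet.

(* Main.v *)
Require Import Defs.
From HB Require Import structures.
From mathcomp Require Import all_boot all_order all_algebra.
From mathcomp Require Import all_classical all_reals all_analysis.
From mathcomp Require Import ring lra zify.
Import Order.TTheory GRing.Theory Num.Theory.
Import numFieldNormedType.Exports.
Local Open Scope classical_set_scope.
Local Open Scope ring_scope.
Set Implicit Arguments.
Unset Strict Implicit.
Unset Printing Implicit Defensive.

(** Write a form of bidegree (1,2) as dx /\ A + dt /\ B, where A and B are
   2-forms in the theta^i. It is a cocycle if and only if X B = T A, and it is
   the coboundary of C if and only if A = X C and B = T C.

   The Euler operator E(A) = \sum_i (-X)^i (d/du_i _| A) kills every X C, by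
   telescoping ([eulerop_X]). Moving all X-derivatives away from one factor
   turns Euler's identity \sum_i theta^i /\ (d/du_i _| A) = 2 A into 2 A =
   theta^0 /\ E(A) + X C ([euler_identity], [normal_form]). Hence every class
   has a representative with A = theta^0 /\ e; here the 1-form e = \sum_i e_i
   theta^i is the operator \sum_i e_i X^i in disguise, and applying E to the
   normal form shows that it is skew-adjoint ([eulerop_wtheta0]). A
   skew-adjoint e is recovered as E(theta^0 /\ e) / 2, so that it is
   determined by the class.

   On 2-forms X is injective, its symbol being xi + eta ([X_inj]). Hence A
   determines B, and it remains to find out for which e there is a B. The
   identity E(T A) = T E(A) + L E(A), with L the formal adjoint of the
   linearization of K ([eulerop_T], [linadj]), shows that (T + L) e = 0 is
   necessary. For the B of the theorem a telescoping sum gives X B = T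
   (theta^0 /\ e) - theta^0 /\ (T + L) e ([X_dtpart]), which settles
   sufficiency. For skew-adjoint e, [eulerop_T] applied to theta^0 /\ e also
   shows that u_t = K is Hamiltonian for e if and only if theta^0 /\ (T + L) e
   = 0 ([hamiltonianP]).

   A symplectic operator satisfies in addition delta_V Sigma = 0, and this is
   where n >= 2 enters. As d_V commutes with X and T ([vdiff_X], [vdiff_T]), a
   solution of X B = T A yields X (d_V B) = T (d_V A), so the 2-form q = E(d_V
   A) solves (T + L) q = 0. The leading symbol of this equation is K_n (xi^n +
   eta^n + (-1)^n (xi + eta)^n) with K_n = dK/du_n; it is nonzero for n >= 2,
   whence q = 0 ([symbol_inj], [cocycle_closed]).

   The computation with X, T and d/du_i takes place over an arbitrary
   commutative ring with derivations subject to the commutation rules of these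
   three. Smooth functions form such a ring once second partial derivatives
   are known to commute ([partialC]), and a form is represented there by the
   array of its values on the vectors d/du_i ([vert]). *)

Local Notation coord := Defs.coord.
Local Notation form := Defs.form.
Local Notation contract := Defs.contract.

(** * Calculus of vertical forms over a differential ring *)

Section Arrays.
Variable A : comNzRingType.

(** Values of vertical forms: a list [:: i1; ..; ik] stands for the evaluation
   on d/du_i1, .., d/du_ik. Alternation is imposed separately, as [alt], so
   that the contraction [ctr] is mere partial application and an operator on
   arrays can be defined by its rule of commutation with [ctr]. *)
Definition arr := seq nat -> A.
Implicit Types (a b : arr) (s : seq nat) (f g : A).

Lemma arrD a b s : (a + b) s = a s + b s. Proof. by []. Qed.
Lemma arrN a s : (- a) s = - a s. Proof. by []. Qed.
Lemma arrB a b s : (a - b) s = a s - b s. Proof. by []. Qed.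
Lemma arr0 s : (0 : arr) s = 0. Proof. by []. Qed.
Lemma arr_sum I (r : seq I) (P : pred I) (F : I -> arr) s :
  (\sum_(i <- r | P i) F i) s = \sum_(i <- r | P i) F i s.
Proof. by elim/big_rec2: _ => // i _ y _ <-. Qed.
Definition arrE := (arrB, arrD, arrN, arr0, arr_sum).

Definition ctr (i : nat) a : arr := fun s => a (i :: s).
Definition sc f a : arr := fun s => f * a s.

Lemma ctr_zmod i : zmod_morphism (ctr i).
Proof. by move=> a b. Qed.
HB.instance Definition _ i := GRing.isZmodMorphism.Build arr arr (ctr i) (ctr_zmod i).

Lemma sc_zmod f : zmod_morphism (sc f).
Proof. by move=> a b; apply/funext => s; rewrite /sc -mulrBr. Qed.
HB.instance Definition _ f := GRing.isZmodMorphism.Build arr arr (sc f) (sc_zmod f).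

Lemma ctr_sc i f a : ctr i (sc f a) = sc f (ctr i a). Proof. by []. Qed.
Lemma sc0l a : sc 0 a = 0. Proof. by apply/funext => s; rewrite /sc mul0r. Qed.
Lemma scDl f g a : sc (f + g) a = sc f a + sc g a.
Proof. by apply/funext => s; rewrite /sc arrD mulrDl. Qed.

(** Forms have finitely many terms; N bounds the theta^i that occur. *)
Definition supp N a := forall i s, (N <= i)%N -> i \in s -> a s = 0.

Lemma supp_ctr N a i : supp N a -> supp N (ctr i a).
Proof. by move=> h j s hj js; apply: (h j) => //; rewrite inE js orbT. Qed.

Lemma supp_ctr0 N a i : supp N a -> (N <= i)%N -> ctr i a = 0.
Proof. by move=> h hi; apply/funext => s; apply: (h i) => //; rewrite inE eqxx. Qed.

Lemma supp_le N P a : (N <= P)%N -> supp N a -> supp P a.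
Proof. by move=> NP h i s hi; apply: h; apply: leq_trans hi. Qed.

Lemma suppD N a b : supp N a -> supp N b -> supp N (a + b).
Proof. by move=> ha hb i s hi si; rewrite arrE (ha i) ?(hb i) ?addr0. Qed.

Lemma suppN N a : supp N a -> supp N (- a).
Proof. by move=> ha i s hi si; rewrite arrE (ha i) ?oppr0. Qed.

Lemma supp_sum N (I : Type) (r : seq I) (F : I -> arr) :
  (forall i, supp N (F i)) -> supp N (\sum_(i <- r) F i).
Proof. by move=> h; elim/big_rec: _ => // i x _ hx; apply: suppD. Qed.

Definition alt a := forall s1 i j s2, a (s1 ++ i :: j :: s2) = - a (s1 ++ j :: i :: s2).

Lemma alt_ctr a i : alt a -> alt (ctr i a).
Proof. by move=> h s1 j k s2; apply: (h (i :: s1)). Qed.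

Lemma alt_swap a i j : alt a -> ctr i (ctr j a) = - ctr j (ctr i a).
Proof. by move=> h; apply/funext => s; apply: (h [::]). Qed.

Fixpoint der_at (V : A -> A) (rho : nat -> arr -> arr) s a : A :=
  if s is i :: s' then der_at V rho s' (ctr i a) + rho i a s' else V (a [::]).

(** The derivation L acting on functions by V, whose commutator with the
   contraction is [rho]: ctr i (L a) = L (ctr i a) + rho i a. *)
Definition der V rho a : arr := fun s => der_at V rho s a.

Lemma der_zmod (V : {additive A -> A}) rho :
  (forall i, zmod_morphism (rho i)) -> zmod_morphism (der V rho).
Proof.
move=> hrho a b; apply/funext => s; rewrite /der arrB.
elim: s a b => [|i s IH] a b /=; first by rewrite raddfB.
by rewrite raddfB hrho IH arrB; ring.
Qed.

(** The commutator of X with d/du_i _| is d/du_(i-1) _|, since X theta^i =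
   theta^(i+1). *)
Definition pre i a : arr := if i is j.+1 then ctr j a else 0.
Lemma pre_zmod i : zmod_morphism (pre i).
Proof. by case: i => [|i] a b //=; rewrite subr0. Qed.
HB.instance Definition _ i := GRing.isZmodMorphism.Build arr arr (pre i) (pre_zmod i).

(** The commutator for a derivation with theta^k |-> \sum_i Q k i theta^i. For
   T, Q is the matrix [DXK] because T theta^k = d_V (X^k K); on a form with no
   theta^k for k >= N the sum may stop at N. *)
Definition matrow N (Q : nat -> nat -> A) i a : arr :=
  \sum_(k < N) sc (Q k i) (ctr k a).
Lemma matrow_zmod N Q i : zmod_morphism (matrow N Q i).
Proof.
by move=> a b; rewrite /matrow -sumrB; apply: eq_bigr => k _; rewrite !raddfB.
Qed.
HB.instance Definition _ N Q i :=
  GRing.isZmodMorphism.Build arr arr (matrow N Q i) (matrow_zmod N Q i).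

Variables (X T : {additive A -> A}) (D : nat -> {additive A -> A}).
Hypothesis XM : forall f g, X (f * g) = X f * g + f * X g.
Hypothesis TM : forall f g, T (f * g) = T f * g + f * T g.
Hypothesis DM : forall i f g, D i (f * g) = D i f * g + f * D i g.
Hypothesis DD : forall i j f, D i (D j f) = D j (D i f).
Hypothesis DX : forall i f, D i (X f) = X (D i f) + (if i is j.+1 then D j f else 0).
Hypothesis XT : forall f, X (T f) = T (X f).

Variables (K : A) (n : nat).
Hypothesis DK : forall i, (n < i)%N -> D i K = 0.
Definition DXK k i : A := D i (iter k X K).
Definition Dvanish P f := forall k, (P <= k)%N -> D k f = 0.
Hypothesis DT : forall P i f, Dvanish P f ->
  D i (T f) = T (D i f) + \sum_(k < P) DXK k i * D k f.

Lemma X0 : X 0 = 0. Proof. exact: raddf0. Qed.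
Lemma X_1 : X 1 = 0.
Proof.
have := XM 1 1; rewrite !mul1r mulr1 => h.
by apply: (addrI (X 1)); rewrite addr0 -h.
Qed.
Lemma T_1 : T 1 = 0.
Proof.
have := TM 1 1; rewrite !mul1r mulr1 => h.
by apply: (addrI (T 1)); rewrite addr0 -h.
Qed.

Definition arrX := der X pre.
HB.instance Definition _ := GRing.isZmodMorphism.Build arr arr arrX (der_zmod X pre_zmod).
Definition arrT P := der T (matrow P DXK).
HB.instance Definition _ P :=
  GRing.isZmodMorphism.Build arr arr (arrT P) (der_zmod T (matrow_zmod P DXK)).

Definition oppX a := - arrX a.
Lemma oppX_zmod : zmod_morphism oppX.
Proof. by move=> a b; rewrite /oppX raddfB opprD. Qed.
HB.instance Definition _ := GRing.isZmodMorphism.Build arr arr oppX oppX_zmod.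

Lemma iterNX_zmod k : zmod_morphism (iter k oppX).
Proof. by elim: k => [|k IH] a b //=; rewrite IH raddfB. Qed.
HB.instance Definition _ k :=
  GRing.isZmodMorphism.Build arr arr (iter k oppX) (iterNX_zmod k).

Lemma ctrX i a : ctr i (arrX a) = arrX (ctr i a) + pre i a.
Proof. by []. Qed.
Lemma ctrT P i a : ctr i (arrT P a) = arrT P (ctr i a) + matrow P DXK i a.
Proof. by []. Qed.

Lemma X_sc f a : arrX (sc f a) = sc (X f) a + sc f (arrX a).
Proof.
apply/funext => s; elim: s a => [|i s IH] a; first exact: XM.
rewrite arrE -[LHS]/(ctr i _ s) -[X in _ = X + _]/(sc (X f) (ctr i a) s).
rewrite -[X in _ = _ + X]/(sc f (ctr i (arrX a)) s) !ctrX ctr_sc raddfD !arrE IH arrE -!addrA.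
by do 2 congr (_ + _); case: i => [|j] //=; rewrite /sc mulr0.
Qed.

Lemma supp_pre N a i : supp N a -> supp N (pre i a).
Proof. by case: i => [|i] h //=; apply: supp_ctr. Qed.

Lemma supp_X N a : supp N a -> supp N.+1 (arrX a).
Proof.
move=> h i s; elim: s a h => [//|j s IH] a h hi.
rewrite inE -[arrX a _]/(ctr j (arrX a) s) ctrX arrE.
have [e _|_ /= si] := eqVneq i j.
  have {IH} hj : (N < j)%N by rewrite -e.
  have -> : ctr j a = 0 by apply: (supp_ctr0 h); apply: ltnW hj.
  rewrite raddf0 arrE add0r; case: j hj {e} => [//|k] hk /=.
  by rewrite (supp_ctr0 h).
rewrite IH //; last exact: supp_ctr.
rewrite add0r; apply: (@supp_pre _ _ j h i) => //; exact: ltnW.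
Qed.

Lemma supp_oppX N a : supp N a -> supp N.+1 (oppX a).
Proof. by move=> h; apply: suppN; apply: supp_X. Qed.

Lemma supp_iterNX k N a : supp N a -> supp (N + k) (iter k oppX a).
Proof.
by elim: k => [|k IH] h; rewrite ?addn0 //= addnS; apply: supp_oppX; apply: IH.
Qed.

(** D_i (X f) = X (D_i f) + D_(i-1) f, applied to f = X^k K: this recursion is
   what makes X and T commute on the theta^i. *)
Lemma DXKS k i : DXK k.+1 i = X (DXK k i) + (if i is j.+1 then DXK k j else 0).
Proof. by rewrite /DXK iterS DX; case: i. Qed.

Lemma DXK_vanish k i : (n + k < i)%N -> DXK k i = 0.
Proof.
elim: k i => [|k IH] i; first by rewrite addn0; apply: DK.
rewrite addnS DXKS => h; rewrite IH ?X0 ?add0r; last exact: ltnW.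
by case: i h => // i h; rewrite IH.
Qed.

Lemma DXK_top k : DXK k (n + k) = D n K.
Proof.
elim: k => [|k IH]; first by rewrite addn0.
by rewrite addnS DXKS IH DXK_vanish ?X0 ?add0r // ltnS.
Qed.

(** It is enough to compare the commutators with d/du_i _|: they agree by
   [DXKS]. T needs one more row after X, which raises the order by one. *)
Lemma arrXT P a : supp P a -> arrX (arrT P a) = arrT P.+1 (arrX a).
Proof.
move=> h; apply/funext => s; elim: s a h => [|i s IH] a h; first exact: XT.
rewrite -[LHS]/(ctr i (arrX (arrT P a)) s) -[RHS]/(ctr i (arrT P.+1 (arrX a)) s).
rewrite ctrX !ctrT !ctrX raddfD [in RHS]raddfD !arrE /= IH; last exact: supp_ctr.
rewrite -!addrA; congr (_ + _).
have prT : pre i (arrT P a) = arrT P (pre i a)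
    + (if i is j.+1 then matrow P DXK j a else 0).
  by case: (i) => [|j] //=; rewrite raddf0 addr0.
(* the extra row of T meets no theta^P in a *)
have wid : arrT P.+1 (pre i a) = arrT P (pre i a).
  have hp : supp P (pre i a) by apply: supp_pre.
  apply/funext => t; elim: t (pre i a) hp => [//|j t IHt] b hb.
  rewrite -[LHS]/(ctr j (arrT P.+1 b) t) -[RHS]/(ctr j (arrT P b) t) !ctrT !arrE.
  rewrite IHt; last exact: supp_ctr.
  by rewrite /matrow big_ord_recr /= (supp_ctr0 hb (leqnn P)) raddf0 addr0.
rewrite prT wid arrE [in LHS]addrCA; congr (_ + _).
rewrite /matrow -arrE; congr (_ s).
rewrite raddf_sum /= big_ord_recl.
have -> : \sum_(k < P) arrX (sc (DXK k i) (ctr k a)) =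
  \sum_(k < P) sc (X (DXK k i)) (ctr k a) + \sum_(k < P) sc (DXK k i) (arrX (ctr k a)).
  by rewrite -big_split; apply: eq_bigr => k _; rewrite X_sc.
have -> : (if i is j.+1 then \sum_(k < P) sc (DXK k j) (ctr k a) else 0) =
   \sum_(k < P) sc (if i is j.+1 then DXK k j else 0) (ctr k a).
  by case: (i) => // ; rewrite big1 // => k _; rewrite sc0l.
rewrite addrAC -big_split /=.
rewrite (eq_bigr (fun k : 'I_P => sc (DXK k.+1 i) (ctr k a))); last first.
  by move=> k _; rewrite DXKS scDl.
have e1 : \sum_(k < P) sc (DXK (bump 0 k) i) (ctr (bump 0 k) (arrX a)) =
   \sum_(k < P) sc (DXK k.+1 i) (arrX (ctr k.+1 a)) + \sum_(k < P) sc (DXK k.+1 i) (ctr k a).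
  by rewrite -big_split; apply: eq_bigr => k _; rewrite /= ctrX raddfD.
rewrite e1 addrA [LHS]addrC; congr (_ + _).
rewrite ctrX /= addr0.
have := @big_ord_recl _ 0 +%R P (fun k => sc (DXK k i) (arrX (ctr k a))).
by move=> /= <-; rewrite big_ord_recr /= (supp_ctr0 h (leqnn P)) !raddf0 addr0.
Qed.

Lemma arrT_widen P P' a : (P <= P')%N -> supp P a -> arrT P' a = arrT P a.
Proof.
move=> hP h; apply/funext => t; elim: t a h => [//|j t IHt] b hb.
rewrite -[LHS]/(ctr j (arrT P' b) t) -[RHS]/(ctr j (arrT P b) t) !ctrT !arrE.
rewrite IHt; last exact: supp_ctr.
congr (_ + _); congr (_ t); rewrite /matrow.
rewrite (big_ord_widen P' (fun k => sc (DXK k j) (ctr k b)) hP) [RHS]big_mkcond /=.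
apply: eq_bigr => k _; case: ifP => // /negbT; rewrite -leqNgt => hk.
by rewrite (supp_ctr0 hb hk) raddf0.
Qed.

Lemma arrT_sc P f a : arrT P (sc f a) = sc (T f) a + sc f (arrT P a).
Proof.
apply/funext => s; elim: s a => [|i s IH] a; first exact: TM.
rewrite arrE -[LHS]/(ctr i _ s) -[X in _ = X + _]/(sc (T f) (ctr i a) s).
rewrite -[X in _ = _ + X]/(sc f (ctr i (arrT P a)) s) !ctrT ctr_sc raddfD !arrE /= IH arrE -!addrA.
do 2 congr (_ + _); rewrite -[RHS]/(sc f (matrow P DXK i a) s); congr (_ s).
rewrite /matrow raddf_sum; apply: eq_bigr => k _.
by apply/funext => t; rewrite /= /sc /ctr mulrCA.
Qed.

Lemma arrT_X P a : supp P a -> forall Q, (P < Q)%N ->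
  arrT Q (arrX a) = arrX (arrT Q a).
Proof.
move=> h Q hQ; rewrite arrXT; last exact: supp_le (ltnW hQ) h.
by rewrite (@arrT_widen Q Q.+1) //; apply: supp_le (supp_X h).
Qed.

Lemma arrT_iterNX P N k a : supp N a -> (N + k <= P)%N ->
  arrT P (iter k oppX a) = iter k oppX (arrT P a).
Proof.
move=> h; elim: k => [//|k IH]; rewrite addnS => hk /=.
rewrite /oppX raddfN /= (@arrT_X (N + k)) ?IH //; first exact: ltnW.
exact: supp_iterNX.
Qed.

(** The adjoint of \sum_i lam_i X^i: for lam = D^~ f, the adjoint
   linearization of f. *)
Definition pairing m (lam : nat -> A) a := \sum_(i < m) iter i oppX (sc (lam i) a).

(** The coefficients of X \o (\sum_i lam_i X^i). *)
Definition Xrow (lam : nat -> A) i := X (lam i) + (if i is j.+1 then lam j else 0).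

Lemma pairing_zmod m lam : zmod_morphism (pairing m lam).
Proof. by move=> a b; rewrite /pairing -sumrB; apply: eq_bigr => i _; rewrite !raddfB. Qed.
HB.instance Definition _ m lam :=
  GRing.isZmodMorphism.Build arr arr (pairing m lam) (pairing_zmod m lam).

(** The adjoint of X \o L is L^* \o (- X). *)
Lemma pairing_Xrow m lam a : (forall i, (m <= i)%N -> lam i = 0) ->
  pairing m.+1 (Xrow lam) a = pairing m lam (oppX a).
Proof.
move=> h.
have e k : iter k oppX (sc (Xrow lam k) a) =
   iter k oppX (sc (lam k) (oppX a)) - iter k.+1 oppX (sc (lam k) a)
   + (if k is j.+1 then iter k oppX (sc (lam j) a) else 0).
  rewrite iterSr -raddfB /= -/oppX.
  have -> : sc (lam k) (oppX a) - oppX (sc (lam k) a) = sc (X (lam k)) a.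
    by rewrite /oppX X_sc raddfN opprK addrCA addNr addr0.
  by case: k => [|k]; rewrite /Xrow ?addr0 // scDl raddfD.
rewrite /pairing (eq_bigr _ (fun (k : 'I_m.+1) _ => e k)) big_split sumrB /=.
rewrite big_ord_recr /= h // sc0l raddf0 addr0 -addrA -[RHS]addr0; congr (_ + _).
rewrite addrC big_ord_recl /= add0r; apply/eqP; rewrite subr_eq0; apply/eqP.
by rewrite big_ord_recr /= h // sc0l !raddf0 addr0.
Qed.

Lemma pairing_widen m m' lam a : (m <= m')%N -> (forall i, (m <= i)%N -> lam i = 0) ->
  pairing m' lam a = pairing m lam a.
Proof.
move=> hm h; rewrite /pairing (big_ord_widen m' (fun k => iter k oppX (sc (lam k) a)) hm).
rewrite [RHS]big_mkcond /=; apply: eq_bigr => k _; case: ifP => // /negbT.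
by rewrite -leqNgt => hk; rewrite h // sc0l raddf0.
Qed.

(** The adjoint of the linearization \sum_i (dK/du_i) X^i of K. *)
Definition linadj a := pairing n.+1 (D^~ K) a.
HB.instance Definition _ := GRing.isZmodMorphism.Build arr arr linadj (pairing_zmod n.+1 (D^~ K)).

Lemma pairing_DXK k m a : (n + k < m)%N -> pairing m (DXK k) a = linadj (iter k oppX a).
Proof.
move=> hm; rewrite (pairing_widen _ hm); last by move=> i; apply: DXK_vanish.
elim: k a {hm} => [|k IH] a; first by rewrite addn0.
rewrite iterSr -IH addnS -pairing_Xrow; last by move=> i; apply: DXK_vanish.
by congr (pairing _ _ _); apply/funext => i; rewrite DXKS.
Qed.

(** The interior Euler operator E without its factor theta^0. *)
Definition eulerop N a := \sum_(i < N) iter i oppX (ctr i a).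
Lemma eulerop_zmod N : zmod_morphism (eulerop N).
Proof. by move=> a b; rewrite /eulerop -sumrB; apply: eq_bigr => i _; rewrite !raddfB. Qed.
HB.instance Definition _ N := GRing.isZmodMorphism.Build arr arr (eulerop N) (eulerop_zmod N).

Lemma eulerop_widen N N' a : supp N a -> (N <= N')%N -> eulerop N' a = eulerop N a.
Proof.
move=> h hN; rewrite /eulerop (big_ord_widen N' (fun k => iter k oppX (ctr k a)) hN).
rewrite [RHS]big_mkcond /=; apply: eq_bigr => k _; case: ifP => // /negbT.
by rewrite -leqNgt => hk; rewrite (supp_ctr0 h) // raddf0.
Qed.

(** By [ctrX] the i-th term is - (-X)^(i+1) (d/du_i _| a) plus (-X)^i
   (d/du_(i-1) _| a), and these cancel in pairs. *)
Lemma eulerop_X N a : supp N a -> eulerop N.+1 (arrX a) = 0.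
Proof.
move=> h; rewrite /eulerop.
have e k : iter k oppX (ctr k (arrX a)) = - iter k.+1 oppX (ctr k a)
   + (if k is j.+1 then iter k oppX (ctr j a) else 0).
  rewrite ctrX raddfD; congr (_ + _); last by case: k => //=.
  by rewrite iterSr /oppX -raddfN /= opprK.
rewrite (eq_bigr _ (fun (k : 'I_N.+1) _ => e k)) big_split sumrN /=.
rewrite big_ord_recr /= (supp_ctr0 h) // !raddf0 addr0.
by rewrite big_ord_recl /= add0r addNr.
Qed.

(** E commutes with T up to the adjoint linearization of K: the commutator of
   T with d/du_i _| contributes \sum_k D_i (X^k K) (d/du_k _| a), and for each
   k the sum over i is the adjoint of the linearization of X^k K, that is
   [linadj] \o (-X)^k. *)
Lemma eulerop_T N P N' a : supp N a -> (N + N <= P)%N -> (n + N < N')%N ->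
  eulerop N' (arrT P a) = arrT P (eulerop N a) + linadj (eulerop N a).
Proof.
move=> h hP hN'; rewrite {1}/eulerop.
have e k : iter k oppX (ctr k (arrT P a)) =
  iter k oppX (arrT P (ctr k a)) + iter k oppX (matrow P DXK k a).
  by rewrite ctrT raddfD.
rewrite (eq_bigr _ (fun (k : 'I_N') _ => e k)) big_split /=; congr (_ + _).
  have NN' : (N <= N')%N by lia.
  rewrite /eulerop raddf_sum (eq_bigr (fun i : 'I_N => iter i oppX (arrT P (ctr i a)))); last first.
    move=> i _ /=; apply: (arrT_iterNX (N := N)); first exact: supp_ctr.
    by have := ltn_ord i; lia.
  rewrite (big_ord_widen N' (fun k => iter k oppX (arrT P (ctr k a))) NN').
  rewrite [RHS]big_mkcond /=; apply: eq_bigr => k _; case: ifP => // /negbT.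
  by rewrite -leqNgt => hk; rewrite (supp_ctr0 h) // !raddf0.
rewrite /eulerop raddf_sum /=.
transitivity (\sum_(k < P) pairing N' (DXK k) (ctr k a)).
  rewrite /pairing exchange_big /=; apply: eq_bigr => i _.
  by rewrite /matrow raddf_sum.
have NP : (N <= P)%N by lia.
rewrite (big_ord_widen P (fun k => linadj (iter k oppX (ctr k a))) NP).
rewrite [RHS]big_mkcond /=; apply: eq_bigr => k _; case: ifP => [hk|/negbT].
  by rewrite pairing_DXK //; lia.
by rewrite -leqNgt => hk; rewrite (supp_ctr0 h) // !raddf0.
Qed.

Definition delta i : nat -> A := fun j => (j == i)%:R.

(** The product of the 1-form \sum_i lam_i theta^i with a, computed by the
   antiderivation property of contractions. *)
Fixpoint wedge1_at (lam : nat -> A) s a : A :=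
  if s is j :: s' then lam j * a s' - wedge1_at lam s' (ctr j a) else 0.
Definition wedge1 lam a : arr := fun s => wedge1_at lam s a.
Lemma wedge1_zmod lam : zmod_morphism (wedge1 lam).
Proof.
move=> a b; apply/funext => s; rewrite arrB /wedge1.
elim: s a b => [|j s IH] a b /=; first by rewrite subr0.
by rewrite raddfB IH arrB; ring.
Qed.
HB.instance Definition _ lam := GRing.isZmodMorphism.Build arr arr (wedge1 lam) (wedge1_zmod lam).

Lemma ctr_wedge1 j lam a : ctr j (wedge1 lam a) = sc (lam j) a - wedge1 lam (ctr j a).
Proof. by []. Qed.

Lemma wedge1_0l a : wedge1 (fun=> 0) a = 0.
Proof.
apply/funext => s; elim: s a => [//|j s IH] a.
by rewrite -[wedge1 _ _ (j :: s)]/(ctr j (wedge1 _ _) s) ctr_wedge1 arrE IH /sc mul0r subr0.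
Qed.

Lemma wedge1_sc lam f a : wedge1 lam (sc f a) = sc f (wedge1 lam a).
Proof.
apply/funext => s; elim: s a => [|j s IH] a; first by rewrite /sc mulr0.
rewrite -[wedge1 _ _ (j :: s)]/(ctr j (wedge1 _ _) s) -[RHS]/(sc f (ctr j (wedge1 lam a)) s).
by rewrite !ctr_wedge1 /= ctr_sc !arrE IH /sc arrE; ring.
Qed.

Lemma X_wedge1 lam a : arrX (wedge1 lam a) = wedge1 (Xrow lam) a + wedge1 lam (arrX a).
Proof.
apply/funext => s; elim: s a => [|j s IH] a; first by rewrite arrE addr0; exact: raddf0.
rewrite -[LHS]/(ctr j (arrX (wedge1 lam a)) s) arrE -![wedge1 _ _ (j :: s)]/(ctr j (wedge1 _ _) s).
rewrite ctrX !ctr_wedge1 raddfB ctrX raddfD /= X_sc !arrE IH arrE.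
have -> : pre j (wedge1 lam a) = sc (if j is k.+1 then lam k else 0) a - wedge1 lam (pre j a).
  by case: (j) => [|k] //=; rewrite sc0l raddf0 subr0.
by rewrite /Xrow !arrE /sc; case: (j) => [|k] /=; ring.
Qed.

(** The coefficients of T (\sum_i lam_i theta^i). *)
Definition Trow P (lam : nat -> A) j := T (lam j) + \sum_(k < P) DXK k j * lam k.

Lemma T_wedge1 P lam a : arrT P (wedge1 lam a) = wedge1 (Trow P lam) a + wedge1 lam (arrT P a).
Proof.
apply/funext => s; elim: s a => [|j s IH] a; first by rewrite arrE addr0; exact: raddf0.
rewrite -[LHS]/(ctr j (arrT P (wedge1 lam a)) s) arrE -![wedge1 _ _ (j :: s)]/(ctr j (wedge1 _ _) s).
rewrite ctrT !ctr_wedge1 raddfB ctrT raddfD /= arrT_sc !arrE IH arrE.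
have -> : matrow P DXK j (wedge1 lam a) = sc (\sum_(k < P) DXK k j * lam k) a - wedge1 lam (matrow P DXK j a).
  rewrite /matrow raddf_sum /=.
  under [X in _ = _ - X]eq_bigr => k _ do rewrite wedge1_sc.
  apply/funext => t; rewrite arrE /sc !arrE mulr_suml -sumrB; apply: eq_bigr => k _.
  by rewrite ctr_wedge1 arrE /sc; ring.
by rewrite /Trow !arrE /sc; ring.
Qed.

Definition wtheta (i : nat) := wedge1 (delta i).
HB.instance Definition _ i := GRing.isZmodMorphism.Build arr arr (wtheta i) (wedge1_zmod (delta i)).

Lemma X_nat m : X m%:R = 0.
Proof. by rewrite raddfMn /= X_1 mul0rn. Qed.
Lemma T_nat m : T m%:R = 0.
Proof. by rewrite raddfMn /= T_1 mul0rn. Qed.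

Lemma X_wtheta i a : arrX (wtheta i a) = wtheta i.+1 a + wtheta i (arrX a).
Proof.
rewrite /wtheta X_wedge1; congr (wedge1 _ _ + _); apply/funext => -[|j].
  by rewrite /Xrow /delta X_nat addr0.
by rewrite /Xrow /delta X_nat add0r eqSS.
Qed.

Lemma T_wtheta0 P a : (0 < P)%N -> arrT P (wtheta 0 a) = wedge1 (D^~ K) a + wtheta 0 (arrT P a).
Proof.
case: P => // P _; rewrite /wtheta T_wedge1; congr (wedge1 _ _ + _); apply/funext => j.
rewrite /Trow /delta T_nat add0r big_ord_recl mulr1 big1 ?addr0 //.
by move=> k _; rewrite mulr0.
Qed.

Lemma wedge1_expand m lam a : (forall i, (m <= i)%N -> lam i = 0) ->
  wedge1 lam a = \sum_(j < m) sc (lam j) (wtheta j a).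
Proof.
move=> h; apply/funext => s; rewrite arrE; elim: s a => [|j s IH] a.
  by rewrite big1 // => k _; rewrite /sc mulr0.
rewrite -[wedge1 _ _ (j :: s)]/(ctr j (wedge1 _ _) s) ctr_wedge1 arrE IH.
under [RHS]eq_bigr => k _.
  rewrite -[sc _ _ _]/(sc (lam k) (ctr j (wtheta k a)) s) ctr_wedge1 /sc arrE mulrBr; over.
rewrite sumrB; congr (_ - _).
have [jm|mj] := ltnP j m; last first.
  rewrite h // sc0l big1 // => k _; rewrite /sc /delta.
  by rewrite gtn_eqF ?mul0r ?mulr0 //; apply: leq_trans mj.
rewrite (bigD1 (Ordinal jm)) //= big1 ?addr0 /sc /delta ?eqxx ?mul1r //.
by move=> k; rewrite -val_eqE /= eq_sym => /negPf ->; rewrite mul0r mulr0.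
Qed.

(** Integration by parts: X of this form replaces theta^i /\ a by theta^0 /\
   (-X)^i a. *)
Definition htheta i a := \sum_(k < i) wtheta (i - k.+1)%N (iter k oppX a).
Lemma htheta_zmod i : zmod_morphism (htheta i).
Proof. by move=> a b; rewrite /htheta -sumrB; apply: eq_bigr => k _; rewrite !raddfB. Qed.

HB.instance Definition _ i := GRing.isZmodMorphism.Build arr arr (htheta i) (htheta_zmod i).

Lemma X_htheta i a : arrX (htheta i a) = wtheta i a - wtheta 0 (iter i oppX a).
Proof.
rewrite /htheta raddf_sum /=.
rewrite (eq_bigr (fun k : 'I_i => wtheta (i - k)%N (iter k oppX a) - wtheta (i - k.+1)%N (iter k.+1 oppX a))).
  rewrite -(big_mkord xpredT (fun k => wtheta (i - k)%N (iter k oppX a) - wtheta (i - k.+1)%N (iter k.+1 oppX a))).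
  rewrite -[LHS]opprK -sumrN.
  under eq_bigr => k _ do rewrite opprB.
  by rewrite telescope_sumr // subn0 subnn opprB.
move=> k _; rewrite X_wtheta -subSn // subSS; congr (_ + _).
by rewrite iterS /oppX raddfN /= opprK.
Qed.

(** The dt-component of omega, as a sum of the primitives that move the
   X-derivatives from d_V K = \sum_j (dK/du_j) theta^j to e. *)
Definition dtpart e := \sum_(j < n.+1) htheta j (sc (D j K) e).
Lemma dtpart_zmod : zmod_morphism dtpart.
Proof. by move=> a b; rewrite /dtpart -sumrB; apply: eq_bigr => j _; rewrite !raddfB. Qed.
HB.instance Definition _ := GRing.isZmodMorphism.Build arr arr dtpart dtpart_zmod.

(** T (theta^0 /\ e) = d_V K /\ e + theta^0 /\ T e, and [dtpart] turns d_V K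
   /\ e into theta^0 /\ [linadj] e modulo the image of X. *)
Lemma X_dtpart P e : (0 < P)%N ->
  arrX (dtpart e) = arrT P (wtheta 0 e) - wtheta 0 (arrT P e + linadj e).
Proof.
move=> hP; rewrite T_wtheta0 // raddfD opprD addrA addrK /dtpart raddf_sum /=.
rewrite (wedge1_expand (m := n.+1)) => [|i hi]; last exact: DK.
rewrite /linadj /pairing raddf_sum /= -sumrB; apply: eq_bigr => j _.
by rewrite X_htheta /wtheta wedge1_sc.
Qed.

(** When a = \sum_i a_i theta^i stands for the operator \sum_i a_i X^i, these
   are the coefficients of its adjoint: theta^0 /\ (ctr i a) is the 1-form a_i
   theta^0, that is the multiplication operator by a_i, and composition with X
   on the left is X acting on 1-forms. *)
Definition adjarr N a := \sum_(i < N) iter i oppX (wtheta 0 (ctr i a)).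
Lemma adjarr_zmod N : zmod_morphism (adjarr N).
Proof. by move=> a b; rewrite /adjarr -sumrB; apply: eq_bigr => j _; rewrite !raddfB. Qed.
HB.instance Definition _ N := GRing.isZmodMorphism.Build arr arr (adjarr N) (adjarr_zmod N).

(** Only d/du_0 contracts theta^0; the terms in which d/du_i contracts a
   assemble to the adjoint. *)
Lemma eulerop_wtheta0 N a : (0 < N)%N -> eulerop N (wtheta 0 a) = a - adjarr N a.
Proof.
case: N => // N _; rewrite /eulerop /adjarr.
under eq_bigr => i _ do rewrite ctr_wedge1 raddfB.
rewrite sumrB; congr (_ - _).
rewrite big_ord_recl big1 /= ?addr0 => [|i _].
  by apply/funext => s; rewrite /sc /delta mul1r.
by rewrite /delta sc0l !raddf0.
Qed.

Lemma euler_identity N a s : alt a -> supp N a ->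
  (\sum_(i < N) wtheta i (ctr i a)) s = a s *+ size s.
Proof.
rewrite arrE; elim: s a => [|j s IH] a ha hs /=; first by rewrite big1.
rewrite mulrS; under eq_bigr => i _.
  rewrite -[wtheta _ _ _]/(ctr j (wtheta i (ctr i a)) s) ctr_wedge1 alt_swap // raddfN opprK arrE; over.
rewrite big_split /= IH; [|exact: alt_ctr|exact: supp_ctr].
congr (_ + _); have [jm|mj] := ltnP j N; last first.
  rewrite -[RHS]/(ctr j a s) (supp_ctr0 hs mj) big1 // => k _.
  by rewrite /sc /delta gtn_eqF ?mul0r //; apply: leq_trans mj.
rewrite (bigD1 (Ordinal jm)) //= big1 ?addr0 /sc /delta ?eqxx ?mul1r //.
by move=> k; rewrite -val_eqE /= eq_sym => /negPf ->; rewrite mul0r.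
Qed.

(** The primitive in the homotopy formula [normal_form]. *)
Definition homotopy N a := \sum_(i < N) htheta i (ctr i a).
Lemma normal_form N a :
  \sum_(i < N) wtheta i (ctr i a) = wtheta 0 (eulerop N a) + arrX (homotopy N a).
Proof.
rewrite /eulerop /homotopy !raddf_sum /= -big_split; apply: eq_bigr => i _ /=.
by rewrite X_htheta addrC subrK.
Qed.

Definition predv (F : nat -> A) i := if i is j.+1 then F j else 0.
Lemma arrX2 a i j : arrX a [:: i; j] =
  X (a [:: i; j]) + predv (fun k => a [:: i; k]) j + predv (fun k => a [:: k; j]) i.
Proof. by rewrite /arrX /der /=; case: i j => [|i] [|j]. Qed.

Lemma arrT2 P a i j : arrT P a [:: i; j] =
  T (a [:: i; j]) + \sum_(k < P) DXK k j * a [:: i; k : nat] + \sum_(k < P) DXK k i * a [:: (k : nat); j].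
Proof. by rewrite /arrT /der /= /matrow !arrE. Qed.

(** The symbol xi + eta of X on 2-arrays is not a zero divisor. Concretely,
   entries of high total degree vanish by finiteness; given this above degree
   i + j, the entries of X a in degree i + j + 1 express a [:: i; j] through a
   [:: i.+1; j.-1]. *)
Lemma X_inj N a : supp N a -> (forall i j, arrX a [:: i; j] = 0) ->
  forall i j, a [:: i; j] = 0.
Proof.
move=> hs h; pose m := (N + N)%N.
(* descending induction on the total degree, then ascending on j *)
suff H : forall d i j, (m <= i + j + d)%N -> a [:: i; j] = 0.
  by move=> i j; apply: (H m); rewrite leq_addl.
elim=> [|d IH] i j hij.
  have [hi|hi] := leqP N i; first by apply: (hs i) => //; rewrite inE eqxx.
  by apply: (hs j); rewrite ?inE ?eqxx ?orbT //; rewrite /m in hij; lia.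
elim: j i hij => [|j IHj] i hij.
  by have := h i.+1 0; rewrite arrX2 /= IH ?X0 ?add0r //; lia.
have := h i.+1 j.+1; rewrite arrX2 /= IH ?X0 ?add0r; last by lia.
by rewrite IHj ?add0r //; lia.
Qed.

(** The coefficient a [:: p; q] is seen as that of xi^p eta^q. No monomial has
   total degree above m, and those of degree m have second exponent >= j, so
   that for m = i + j the monomial xi^i eta^j is the first one that may occur.
   *)
Definition topdeg m j a := forall p q, ((m < p + q) || (p + q == m) && (q < j))%N ->
  a [:: p; q] = 0.

Lemma topdeg_oppX m j a : topdeg m j a -> topdeg m.+1 j (oppX a).
Proof.
move=> h p q hpq; rewrite /oppX arrE arrX2 h; last by lia.
rewrite X0 add0r.
have -> : predv (fun k => a [:: p; k]) q = 0 by case: q hpq => //= q hpq; rewrite h //; lia.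
have -> : predv (fun k => a [:: k; q]) p = 0 by case: p hpq => //= p hpq; rewrite h //; lia.
by rewrite addr0 oppr0.
Qed.

Lemma topdeg_iter m j a k : topdeg m j a -> topdeg (m + k) j (iter k oppX a).
Proof.
by elim: k => [|k IH] h; rewrite ?addn0 //= addnS; apply: topdeg_oppX; apply: IH.
Qed.

(** With [top_coef2]: in the leading part, (-X)^k multiplies by (-1)^k (xi +
   eta)^k, and the first two coefficients of (xi + eta)^k are 1 and k. *)
Lemma top_coef1 i j a k : topdeg (i + j) j a ->
  iter k oppX a [:: (i + k)%N; j] = (-1) ^+ k * a [:: i; j].
Proof.
elim: k => [|k IH] h; first by rewrite addn0 mul1r.
have ht := topdeg_iter (k := k) h.
rewrite addnS /= /oppX arrE arrX2 /= IH // ht; last by lia.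
rewrite X0 add0r (_ : predv _ j = 0) ?add0r ?exprS ?mulN1r ?mulNr //.
by case: (j) ht => //= q ht; rewrite ht //; lia.
Qed.

Lemma top_coef2 i j a k : topdeg (i + j) j a ->
  predv (fun p => iter k oppX a [:: p; j.+1]) (i + k) =
  (-1) ^+ k * (predv (fun p => a [:: p; j.+1]) i + a [:: i; j] *+ k).
Proof.
elim: k => [|k IH] h; first by rewrite addn0 mul1r mulr0n addr0.
have ht := topdeg_iter (k := k) h.
rewrite addnS /= /oppX arrE arrX2 /= IH // ht; last by lia.
rewrite X0 add0r top_coef1 // exprS mulrS.
ring.
Qed.

(** Only the term of order n of [linadj] reaches total degree m + n. *)
Lemma symbol_linadj m j a p q : topdeg m j a -> (p + q = m + n)%N ->
  linadj a [:: p; q] = iter n oppX (sc (D n K) a) [:: p; q].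
Proof.
move=> h hpq; rewrite /linadj /pairing arrE big_ord_recr /= big1 ?add0r // => l _.
apply: (topdeg_iter (m := m) (j := j)); last by have := ltn_ord l; lia.
by move=> p' q' hp; rewrite /sc h ?mulr0.
Qed.

(** The leading part of T acts on one index by K_n xi^n. *)
Lemma symbol_sum P N m (F : nat -> A) p : (forall k, (N <= k)%N -> F k = 0) -> (N <= P)%N ->
  (forall k, (m < k)%N -> F k = 0) -> (n + m = p)%N ->
  \sum_(k < P) DXK k p * F k = D n K * F m.
Proof.
move=> hN NP hm hp; have [mP|Pm] := ltnP m P; last first.
  rewrite (hN m) ?mulr0 ?big1 //; last by lia.
  by move=> k _; rewrite DXK_vanish ?mul0r //; have := ltn_ord k; lia.
rewrite (bigD1 (Ordinal mP)) //= -hp DXK_top big1 ?addr0 // => k hk.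
have {}hk : (k != m :> nat) by rewrite -val_eqE in hk.
have [km|mk] := ltnP k m; first by rewrite DXK_vanish ?mul0r //; lia.
by rewrite hm ?mulr0 //; lia.
Qed.

(** Apply E to X b = T a. *)
Lemma cocycle_eulerop N Q P a b : supp N a -> supp Q b -> (N + N <= P)%N ->
  arrX b = arrT P a -> arrT P (eulerop N a) + linadj (eulerop N a) = 0.
Proof.
move=> ha hb hP e; rewrite -(eulerop_T (N' := (Q + n + N).+1) ha hP); last by lia.
by rewrite -e (eulerop_widen (supp_X hb)) ?eulerop_X //; lia.
Qed.

Hypothesis n2 : (2 <= n)%N.
Hypothesis Kn_reg : forall f, D n K * f = 0 -> f = 0.
Hypothesis char0 : forall m f, f *+ m.+1 = 0 -> f = 0.

(** The leading symbol of T + [linadj] on 2-arrays is K_n (xi^n + eta^n +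
   (-1)^n (xi + eta)^n). Let xi^i eta^j be the first monomial of the leading
   part of a, and c its coefficient. If n is even, the coefficient of xi^(i+n)
   eta^j in the image is 2 K_n c. If n is odd, the two copies of xi^n cancel
   and the coefficient of xi^(i+n-1) eta^(j+1) is - n K_n c; eta^n does not
   interfere because n > 1. *)
Lemma symbol_inj N P a : supp N a -> (N <= P)%N ->
  (forall i j, (arrT P a + linadj a) [:: i; j] = 0) -> forall i j, a [:: i; j] = 0.
Proof.
move=> hs NP h; pose mm := (N + N)%N.
have z1 i j : (N <= i)%N -> a [:: i; j] = 0.
  by move=> hi; apply: (hs i) => //; rewrite inE eqxx.
have z2 i j : (N <= j)%N -> a [:: i; j] = 0.
  by move=> hi; apply: (hs j) => //; rewrite !inE eqxx orbT.
(* as in [X_inj] *)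
suff H : forall d i j, (mm <= i + j + d)%N -> a [:: i; j] = 0.
  by move=> i j; apply: (H mm); rewrite leq_addl.
elim=> [|d IH] i j hij.
  have [hi|hi] := leqP N i; first exact: z1.
  by apply: z2; rewrite /mm in hij; lia.
elim/ltn_ind: j i hij => j IHj i hij.
have ht : topdeg (i + j) j a.
  move=> p q /orP[hpq|/andP[/eqP hpq hq]]; first by apply: IH; lia.
  by apply: IHj => //; lia.
have ht' : topdeg (i + j) j (sc (D n K) a).
  by move=> p q hpq; rewrite /sc ht ?mulr0.
have S2 p q : (p + q = i + j + n)%N -> (q <= j.+1)%N ->
    \sum_(k < P) DXK k q * a [:: p; k : nat] = 0.
  move=> hpq hq; rewrite big1 // => k _.
  have [kq|qk] := ltnP (n + k) q; first by rewrite DXK_vanish ?mul0r.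
  by rewrite ht ?mulr0 //; lia.
have T0 p q : (i + j < p + q)%N -> T (a [:: p; q]) = 0.
  by move=> hpq; rewrite ht ?raddf0 // hpq.
(* for odd n the terms in xi^n cancel and the next coefficient is read *)
have [on|en] := boolP (odd n).
  have := h (i + n).-1 j.+1.
  have n0 : ((i + n).-1.+1 = i + n)%N by lia.
  have := top_coef2 n ht'; rewrite -n0 [predv _ _.+1]/= => e2.
  rewrite arrE arrT2 (symbol_linadj (q := j.+1) ht) ?e2; last by lia.
  rewrite -signr_odd on expr1 T0 ?S2; try lia.
  have -> : \sum_(k < P) DXK k (i + n).-1 * a [:: (k : nat); j.+1] =
      D n K * predv (fun p => a [:: p; j.+1]) i.
    case: (i) ht {S2 T0 e2 n0} => [|p] ht /=.
      rewrite mulr0 big1 // => k _; rewrite ht ?mulr0 //; lia.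
    apply: (symbol_sum (N := N) (F := fun p => a [:: p; j.+1])) => //.
    - by move=> k hk; apply: z1.
    - by move=> k hk; apply: ht; lia.
    - lia.
  have -> : predv (fun p => sc (D n K) a [:: p; j.+1]) i =
      D n K * predv (fun p => a [:: p; j.+1]) i.
    by case: (i) => [|p] //=; rewrite mulr0.
  rewrite /sc -mulrnAr !add0r mulN1r -mulrDr -mulrBr.
  rewrite opprD addrA subrr sub0r => /Kn_reg /eqP; rewrite oppr_eq0 => /eqP.
  by case: (n) n2 => // n' _; apply: char0.
have := h (i + n)%N j.
rewrite arrE arrT2 (symbol_linadj ht); last by lia.
rewrite (top_coef1 n ht') -signr_odd (negPf en) expr0 mul1r T0 ?S2; try lia.
rewrite (symbol_sum (N := N) (m := i) (F := fun p => a [:: p; j])) //; first last.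
- by rewrite addnC.
- by move=> k hk; apply: ht; lia.
- by move=> k hk; apply: z1.
by rewrite !add0r /sc -mulrDr => /Kn_reg; rewrite -mulr2n; apply: char0.
Qed.

Definition Darr i a : arr := fun s => D i (a s).
Lemma Darr_zmod i : zmod_morphism (Darr i).
Proof. by move=> a b; apply/funext => s; rewrite /Darr arrB raddfB. Qed.
HB.instance Definition _ i := GRing.isZmodMorphism.Build arr arr (Darr i) (Darr_zmod i).

(** The vertical differential d_V. *)
Fixpoint vdiff_at s a : A :=
  if s is i :: s' then D i (a s') - vdiff_at s' (ctr i a) else 0.
Definition vdiff a : arr := fun s => vdiff_at s a.
Lemma vdiff_zmod : zmod_morphism vdiff.
Proof.
move=> a b; apply/funext => s; rewrite arrB /vdiff.
elim: s a b => [|j s IH] a b /=; first by rewrite subr0.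
by rewrite arrB !raddfB /= IH; ring.
Qed.
HB.instance Definition _ := GRing.isZmodMorphism.Build arr arr vdiff vdiff_zmod.

Lemma ctr_vdiff i a : ctr i (vdiff a) = Darr i a - vdiff (ctr i a).
Proof. by []. Qed.
Lemma ctr_Darr i j a : ctr i (Darr j a) = Darr j (ctr i a).
Proof. by []. Qed.

Lemma Darr_sc i f a : Darr i (sc f a) = sc (D i f) a + sc f (Darr i a).
Proof. by apply/funext => s; rewrite arrE /Darr /sc DM. Qed.

Lemma vdiff_sc f a : vdiff (sc f a) = wedge1 (D^~ f) a + sc f (vdiff a).
Proof.
apply/funext => s; elim: s a => [|j s IH] a; first by rewrite arrE add0r /sc mulr0.
rewrite -[LHS]/(ctr j (vdiff _) s) arrE -[wedge1 _ _ (j :: s)]/(ctr j (wedge1 _ _) s).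
rewrite -[sc f _ _]/(sc f (ctr j (vdiff a)) s) !ctr_vdiff ctr_wedge1 Darr_sc raddfB ctr_sc !arrE IH arrE /=.
by rewrite /sc; ring.
Qed.

(** Coefficientwise differentiation obeys the same commutation rule with X as
   on functions, the theta^i having constant coefficients in X theta^i. *)
Lemma Darr_X i a : Darr i (arrX a) = arrX (Darr i a) + (if i is j.+1 then Darr j a else 0).
Proof.
apply/funext => s; elim: s a => [|j s IH] a.
  by rewrite arrE -[LHS]/(D i (X (a [::]))) DX; case: i.
rewrite -[LHS]/(Darr i (ctr j (arrX a)) s) arrE -[arrX _ (j :: s)]/(ctr j (arrX _) s).
rewrite !ctrX ctr_Darr !raddfD !arrE /= IH arrE.
by case: (i) => [|k]; case: (j) => [|l] /=; rewrite ?raddf0 ?arr0 ?addr0 //;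
  rewrite -?[Darr _ _ (_ :: s)]/(Darr _ (ctr _ a) s) /=; ring.
Qed.

Lemma vdiff_X a : vdiff (arrX a) = arrX (vdiff a).
Proof.
apply/funext => s; elim: s a => [|j s IH] a; first by rewrite /arrX /der /= raddf0.
rewrite -[LHS]/(ctr j (vdiff _) s) -[RHS]/(ctr j (arrX _) s) ctr_vdiff !ctrX ctr_vdiff Darr_X.
rewrite raddfD raddfB !arrE /= IH.
by case: (j) => [|k] /=; rewrite ?raddf0 ?ctr_vdiff !arrE; ring.
Qed.

Definition Dvanisharr P a := forall s, Dvanish P (a s).

Lemma D_DXK i k j : D i (DXK k j) = D j (DXK k i).
Proof. exact: DD. Qed.

(** Besides the rule on functions, the coefficients D_j (X^k K) of T theta^k
   are differentiated, which gives d_V (D_i X^k K) /\ (d/du_k _| a).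
   Alternation brings the contraction by d/du_k in front of the one by d/du_j.
   *)
Lemma Darr_T P i a : alt a -> Dvanisharr P a ->
  Darr i (arrT P a) = arrT P (Darr i a) + \sum_(k < P) sc (DXK k i) (Darr k a)
    + \sum_(k < P) wedge1 (D^~ (DXK k i)) (ctr k a).
Proof.
move=> ha hd; apply/funext => s; elim: s a ha hd => [|j s IH] a ha hd.
  rewrite 2!arrD !arr_sum [X in _ = _ + X]big1 // addr0.
  by rewrite -[LHS]/(D i (T (a [::]))) (DT (P := P)).
rewrite -[LHS]/(Darr i (ctr j (arrT P a)) s) 2!arrD -[arrT _ _ (j :: s)]/(ctr j (arrT P _) s).
rewrite !ctrT ctr_Darr [Darr i (_ + _)]raddfD !arrD /= IH; [|exact: alt_ctr|by move=> t; apply: hd].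
rewrite !arrD -!addrA; congr (_ + _).
rewrite [RHS]addrCA; congr (_ + _) => //.
  by rewrite !arr_sum; apply: eq_bigr => k _.
rewrite /matrow raddf_sum !arr_sum -!big_split /=; apply: eq_bigr => k _.
rewrite Darr_sc (@alt_swap a j k ha) raddfN !arrE /sc D_DXK /= ctr_Darr.
by ring.
Qed.

Lemma vdiff_T P a : alt a -> Dvanisharr P a -> vdiff (arrT P a) = arrT P (vdiff a).
Proof.
move=> ha hd; apply/funext => s; elim: s a ha hd => [|j s IH] a ha hd.
  by rewrite -[RHS]/(T 0) raddf0.
rewrite -[LHS]/(ctr j (vdiff _) s) -[RHS]/(ctr j (arrT P _) s) ctr_vdiff !ctrT ctr_vdiff.
rewrite Darr_T // raddfD raddfB !arrE /= IH; [|exact: alt_ctr|by move=> t; apply: hd].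
rewrite /matrow [vdiff (\sum_(_ < P) _)]raddf_sum !arr_sum.
under [X in _ - (_ + X) = _]eq_bigr => k _ do rewrite /= vdiff_sc arrE.
under [X in _ = _ + X]eq_bigr => k _ do rewrite /= ctr_vdiff raddfB arrE.
rewrite big_split sumrB /=; ring.
Qed.

Lemma supp_vdiff N a : supp N a -> Dvanisharr N a -> supp N (vdiff a).
Proof.
move=> hs hd i s; elim: s a hs hd => [//|j s IH] a hs hd hi.
rewrite inE -[vdiff _ _]/(ctr j (vdiff a) s) ctr_vdiff arrE => /orP[/eqP e|si].
  rewrite e in hi; rewrite /Darr hd // (supp_ctr0 hs hi) raddf0 subr0 //.
rewrite IH // ?subr0 /Darr; first by rewrite (hs i) ?raddf0.
- exact: supp_ctr.
- by move=> t; apply: hd.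
Qed.

Lemma supp_wedge1 N lam a : supp N a -> (forall i, (N <= i)%N -> lam i = 0) -> supp N (wedge1 lam a).
Proof.
move=> hs hl i s; elim: s a hs => [//|j s IH] a hs hi.
rewrite inE -[wedge1 _ _ _]/(ctr j (wedge1 lam a) s) ctr_wedge1 arrE => /orP[/eqP e|si].
  rewrite e in hi; rewrite /sc hl // (supp_ctr0 hs hi) raddf0 mul0r subr0 //.
by rewrite IH // ?subr0 /sc ?(hs i) ?mulr0 //; apply: supp_ctr.
Qed.

Lemma supp_wtheta N i a : supp N a -> (i < N)%N -> supp N (wtheta i a).
Proof.
move=> hs hi; apply: supp_wedge1 => // k hk; rewrite /delta gtn_eqF //.
exact: leq_trans hk.
Qed.

Lemma supp_eulerop N a : supp N a -> supp (N + N) (eulerop N a).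
Proof.
move=> hs; apply: supp_sum => i; apply: supp_le (supp_iterNX (k := i) (@supp_ctr _ _ i hs)).
by rewrite leq_add2l ltnW.
Qed.

Lemma supp_htheta N i a : supp N a -> supp (N + i) (htheta i a).
Proof.
move=> hs; apply: supp_sum => k; apply: supp_wtheta.
  apply: supp_le (supp_iterNX (k := k) hs); rewrite leq_add2l; exact: ltnW.
by have := ltn_ord k; lia.
Qed.

Lemma supp_homotopy N a : supp N a -> supp (N + N) (homotopy N a).
Proof.
move=> hs; apply: supp_sum => i; apply: supp_le (supp_htheta (i := i) (@supp_ctr _ _ i hs)).
by rewrite leq_add2l ltnW.
Qed.

(** d_V b and d_V a again solve X (d_V b) = T (d_V a), so that q = E(d_V a) is
   in the kernel of T + [linadj], which is zero on 2-arrays. *)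
Lemma cocycle_closed N Q P a b : supp N a -> supp Q b -> (N + N <= P)%N ->
  alt a -> Dvanisharr N a -> Dvanisharr Q b ->
  arrX b = arrT P a -> forall i j, eulerop N (vdiff a) [:: i; j] = 0.
Proof.
move=> ha hb hP alta da db e.
have dvs := supp_vdiff ha da.
have hda : Dvanisharr P a by move=> s k hk; apply: da; lia.
have e' : arrX (vdiff b) = arrT P (vdiff a) by rewrite -vdiff_X e vdiff_T.
have h := cocycle_eulerop dvs (supp_vdiff hb db) hP e'.
apply: (symbol_inj (N := N + N) (P := P)) => //; first exact: supp_eulerop.
by rewrite h.
Qed.

Definition arity m a := forall s, size s != m -> a s = 0.

Lemma arity_ctr m i a : arity m.+1 a -> arity m (ctr i a).
Proof. by move=> h s hs; exact: h. Qed.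
Lemma arity_ctr0 i a : arity 0 a -> ctr i a = 0.
Proof. by move=> h; apply/funext => s; exact: h. Qed.

Lemma arity_pre m i a : arity m.+1 a -> arity m (pre i a).
Proof. by case: i => [|i] h //=; exact: arity_ctr. Qed.

Lemma arity_X m a : arity m a -> arity m (arrX a).
Proof.
move=> h s; elim: s m a h => [|i s IH] m a h hs.
  by rewrite /arrX /der /= h ?raddf0.
rewrite -[LHS]/(ctr i (arrX a) s) ctrX arrE; case: m h hs => [|m] h hs.
  by rewrite (arity_ctr0 i h) raddf0 add0r; case: (i) => // k; rewrite /= (arity_ctr0 k h).
by rewrite (IH m _ (@arity_ctr _ i _ h) hs) (@arity_pre _ i _ h _ hs) addr0.
Qed.

Lemma arity_oppX m k a : arity m a -> arity m (iter k oppX a).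
Proof. by move=> h; elim: k => [//|k IH] s hs; rewrite iterS /oppX arrN (arity_X IH hs) oppr0. Qed.

Lemma arity_wedge1 m lam a : arity m a -> arity m.+1 (wedge1 lam a).
Proof.
move=> h s; elim: s m a h => [//|i s IH] m a h hs.
rewrite -[LHS]/(ctr i (wedge1 lam a) s) ctr_wedge1 arrE /sc h // mulr0 sub0r.
case: m h hs => [|m] h hs; first by rewrite (arity_ctr0 i h) raddf0 oppr0.
by rewrite (IH m _ (@arity_ctr _ i _ h) hs) oppr0.
Qed.

Lemma arity_sum m I (q : seq I) (F : I -> arr) : (forall i, arity m (F i)) -> arity m (\sum_(i <- q) F i).
Proof. by move=> h s hs; rewrite arr_sum big1 // => i _; exact: h. Qed.

Lemma arity_T P m a : arity m a -> arity m (arrT P a).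
Proof.
move=> h s; elim: s m a h => [|i s IH] m a h hs.
  by rewrite /arrT /der /= h ?raddf0.
rewrite -[LHS]/(ctr i (arrT P a) s) ctrT arrE /matrow arr_sum; case: m h hs => [|m] h hs.
  rewrite (arity_ctr0 i h) raddf0 add0r big1 // => k _.
  by rewrite (arity_ctr0 k h) raddf0.
rewrite (IH m _ (@arity_ctr _ i _ h) hs) add0r big1 // => k _.
by rewrite /sc (@arity_ctr _ k _ h _ hs) mulr0.
Qed.

End Arrays.

(** * Smooth functions on the jet space *)

Section Smooth.
Variable R : realType.
Implicit Types (f g : fn R) (p q : jet R) (c d : coord).

Lemma jet_cvg (F : set_system (jet R)) (p : jet R) : Filter F ->
  (forall c, (fun q : jet R => q c) @ F --> p c) -> F --> p.
Proof.
move=> FF h; apply/cvg_sup => c; apply/cvg_image.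
  by rewrite eqEsubset; split => // y _; exists (fun=> y).
move=> A hA; exists ((fun q : jet R => q c) @^-1` A); first exact: h.
by apply: image_preimage; rewrite eqEsubset; split => // y _; exists (fun=> y).
Qed.

Lemma coord_continuous c : continuous (coordfn c : {ptws coord -> R} -> R).
Proof. exact: (@proj_continuous _ (fun=> R) c). Qed.

Lemma updE p c h d : upd p c h d = if d == c then h else p d.
Proof. by []. Qed.
Lemma upd_id p c : upd p c (p c) = p.
Proof. by apply/funext => d; rewrite updE; case: eqVneq => [->|]. Qed.
Lemma upd_upd p c h h' : upd (upd p c h) c h' = upd p c h'.
Proof. by apply/funext => d; rewrite !updE; case: eqVneq. Qed.
Lemma upd_fun f p c h : (fun x => f (upd (upd p c h) c x)) = (fun x => f (upd p c x)).
Proof. by apply/funext => x; rewrite upd_upd. Qed.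
Lemma updC p c d h h' : c != d -> upd (upd p c h) d h' = upd (upd p d h') c h.
Proof.
move=> cd; apply/funext => e; rewrite !updE.
by case: (eqVneq e d) => [->|//]; rewrite eq_sym (negPf cd).
Qed.

Lemma has_partial_at c f p h : has_partial c f ->
  derivable (fun x : R => f (upd p c x)) h 1.
Proof.
by move=> /(_ (upd p c h)); rewrite updE eqxx upd_fun.
Qed.

Lemma partial_is_derive c f p h : has_partial c f ->
  is_derive (h : R) 1 (fun x : R => f (upd p c x)) (partial c f (upd p c h)).
Proof.
move=> hf; apply: DeriveDef; first exact: has_partial_at.
by rewrite /partial derive1E updE eqxx upd_fun.
Qed.

Lemma is_derive_partial c f g :
  (forall p, is_derive (p c : R) 1 (fun x : R => f (upd p c x)) (g p)) ->
  has_partial c f /\ partial c f = g.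
Proof.
move=> h; split => [p|]; first by have [] := h p.
by apply/funext => p; rewrite /partial derive1E; have [_ ->] := h p.
Qed.

Lemma partial_is_derive_id c f p : has_partial c f ->
  is_derive (p c : R) 1 (fun x : R => f (upd p c x)) (partial c f p).
Proof. by move=> hf; have := partial_is_derive p (p c) hf; rewrite upd_id. Qed.

Lemma has_partialD c f g : has_partial c f -> has_partial c g ->
  has_partial c (f + g) /\ partial c (f + g) = partial c f + partial c g.
Proof.
move=> hf hg; apply: is_derive_partial => p.
by apply: is_deriveD; apply: partial_is_derive_id.
Qed.

Lemma has_partialN c f : has_partial c f ->
  has_partial c (- f) /\ partial c (- f) = - partial c f.
Proof.
by move=> hf; apply: is_derive_partial => p; apply: is_deriveN; apply: partial_is_derive_id.
Qed.

Lemma has_partialM c f g : has_partial c f -> has_partial c g ->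
  has_partial c (f * g) /\ partial c (f * g) = partial c f * g + f * partial c g.
Proof.
move=> hf hg; apply: is_derive_partial => p.
have := is_deriveM (partial_is_derive_id p hf) (partial_is_derive_id p hg).
rewrite upd_id => h; apply: is_derive_eq h _.
by rewrite -[RHS]/(partial c f p * g p + f p * partial c g p) addrC [X in X + _]mulrC.
Qed.

Lemma has_partial_cst c (a : R) :
  has_partial c (cst a : fn R) /\ partial c (cst a : fn R) = 0.
Proof. by apply: is_derive_partial => p; apply: is_derive_cst. Qed.

Lemma has_partial_coord c d :
  has_partial c (coordfn d : fn R) /\ partial c (coordfn d : fn R) = (c == d)%:R.
Proof.
apply: is_derive_partial => p.
have [->|cd] := eqVneq c d.
  rewrite (_ : (fun x => _) = id) //; first exact: is_derive_id.
  by apply/funext => x; rewrite /coordfn updE eqxx.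
rewrite (_ : (fun x => _) = cst (p d)) //; first exact: is_derive_cst.
by apply/funext => x; rewrite /coordfn updE eq_sym (negPf cd).
Qed.

(** Smoothness unfolded one derivative at a time; unlike the quantification
   over lists of coordinates, this form is proved for sums and products by
   induction on k. *)
Fixpoint Ck (k : nat) f : Prop :=
  [/\ continuous (f : {ptws coord -> R} -> R), (forall c, has_partial c f) &
    if k is l.+1 then forall c, Ck l (partial c f) else True].

Lemma CkW k f : Ck k.+1 f -> Ck k f.
Proof.
elim: k f => [|k IH] f [cf hf hpf]; first by split.
by split => // c; apply: IH; apply: hpf.
Qed.

Lemma smoothP f : smooth f <-> (exists n, depends_upto n f) /\ forall k, Ck k f.
Proof.
split=> [[hd h]|[hd h]]; split=> //.
  have H : forall cs, continuous (foldr (@partial R) f cs : {ptws coord -> R} -> R)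
     /\ forall c, has_partial c (foldr (@partial R) f cs) by exact: h.
  move=> k; elim: k f H {hd h} => [|k IH] f H.
    by have [h1 h2] := H [::]; split.
  have [h1 h2] := H [::]; split => // c; apply: IH => cs.
  by rewrite -foldr_rcons; apply: H.
elim/last_ind => [|cs c IH] /=.
  by have [h1 h2 _] := h 0.
rewrite foldr_rcons.
have {}h : forall k, Ck k (partial c f) by move=> k; have [_ _] := h k.+1; apply.
elim/last_ind: cs (partial c f) h {IH} => [|cs d IH] g h.
  by have [] := h 0.
rewrite foldr_rcons; apply: IH => k; by have [_ _] := h k.+1; apply.
Qed.

Lemma smooth_depends_upto f : smooth f -> exists n, depends_upto n f. Proof. by case. Qed.
Lemma smooth_cont f : smooth f -> continuous (f : {ptws coord -> R} -> R).
Proof. by case/smoothP => _ /(_ 0) []. Qed.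
Lemma smooth_has_partial f c : smooth f -> has_partial c f.
Proof. by case/smoothP => _ /(_ 0) []. Qed.

Lemma contD f g : continuous (f : {ptws coord -> R} -> R) ->
  continuous (g : {ptws coord -> R} -> R) -> continuous (f + g : {ptws coord -> R} -> R).
Proof. move=> cf cg p; exact: (cvgD (cf p) (cg p)). Qed.

Lemma contM f g : continuous (f : {ptws coord -> R} -> R) ->
  continuous (g : {ptws coord -> R} -> R) -> continuous (f * g : {ptws coord -> R} -> R).
Proof. move=> cf cg p; exact: (cvgM (cf p) (cg p)). Qed.

Lemma CkD k f g : Ck k f -> Ck k g -> Ck k (f + g).
Proof.
elim: k f g => [|k IH] f g [cf pf hf] [cg pg hg]; split.
- exact: contD.
- by move=> c; exact: (proj1 (has_partialD (pf c) (pg c))).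
- by [].
- exact: contD.
- by move=> c; exact: (proj1 (has_partialD (pf c) (pg c))).
- by move=> c; have [_ ->] := has_partialD (pf c) (pg c); exact: IH (hf c) (hg c).
Qed.

Lemma CkM k f g : Ck k f -> Ck k g -> Ck k (f * g).
Proof.
elim: k f g => [|k IH] f g Hf Hg; have [cf pf hf] := Hf; have [cg pg hg] := Hg; split.
- exact: contM.
- by move=> c; exact: (proj1 (has_partialM (pf c) (pg c))).
- by [].
- exact: contM.
- by move=> c; exact: (proj1 (has_partialM (pf c) (pg c))).
- move=> c; have [_ ->] := has_partialM (pf c) (pg c).
  apply: CkD; apply: IH; [exact: hf|exact: CkW|exact: CkW|exact: hg].
Qed.

Lemma Ck_cst k (a : R) : Ck k (cst a : fn R).
Proof.
elim: k a => [|k IH] a; split.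
- exact: cst_continuous.
- by move=> c; exact: (proj1 (has_partial_cst c a)).
- by [].
- exact: cst_continuous.
- by move=> c; exact: (proj1 (has_partial_cst c a)).
- by move=> c; have [_ ->] := has_partial_cst c a; apply: (IH 0).
Qed.

Lemma depends_uptoW m n f : (m <= n)%N -> depends_upto m f -> depends_upto n f.
Proof. by move=> mn h p q ht hx hu; apply: h => // i hi; apply: hu; apply: leq_trans mn. Qed.

Lemma depends_upto2 f g : (exists n, depends_upto n f) -> (exists n, depends_upto n g) ->
  exists n, depends_upto n f /\ depends_upto n g.
Proof.
move=> [m hm] [n hn]; exists (maxn m n); split.
  by apply: depends_uptoW hm; apply: leq_maxl.
by apply: depends_uptoW hn; apply: leq_maxr.
Qed.

Lemma smoothD f g : smooth f -> smooth g -> smooth (f + g).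
Proof.
move=> /smoothP[df hf] /smoothP[dg hg]; apply/smoothP; split; last by move=> k; apply: CkD.
have [n [hn1 hn2]] := depends_upto2 df dg; exists n => p q ht hx hu.
by rewrite -[LHS]/(f p + g p) (hn1 p q) // (hn2 p q).
Qed.

Lemma smoothM f g : smooth f -> smooth g -> smooth (f * g).
Proof.
move=> /smoothP[df hf] /smoothP[dg hg]; apply/smoothP; split; last by move=> k; apply: CkM.
have [n [hn1 hn2]] := depends_upto2 df dg; exists n => p q ht hx hu.
by rewrite -[LHS]/(f p * g p) (hn1 p q) // (hn2 p q).
Qed.

Lemma smooth_cst (a : R) : smooth (cst a : fn R).
Proof. by apply/smoothP; split; [exists 0|move=> k; exact: Ck_cst]. Qed.

Lemma smooth_coord c : smooth (coordfn c : fn R).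
Proof.
apply/smoothP; split.
  case: c => [||i]; [by exists 0|by exists 0|].
  by exists i => p q _ _ /(_ i (leqnn i)).
case=> [|k]; split.
- exact: coord_continuous.
- by move=> d; exact: (proj1 (has_partial_coord d c)).
- by [].
- exact: coord_continuous.
- by move=> d; exact: (proj1 (has_partial_coord d c)).
move=> d; have [_ ->] := has_partial_coord d c.
by case: (d == c); [exact: (Ck_cst k 1)|exact: (Ck_cst k 0)].
Qed.

Lemma smooth_partial f c : smooth f -> smooth (partial c f).
Proof.
move=> /smoothP[[n df] hf]; apply/smoothP; split; last first.
  by move=> k; have [_ _] := hf k.+1; apply.
exists (maxn n (if c is cu i then i else 0)) => p q ht hx hu; rewrite /partial.
have e : (fun h : R => f (upd p c h)) = (fun h : R => f (upd q c h)).
  apply/funext => h; apply: df => [||i hi]; rewrite !updE ?ht ?hx //.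
  by rewrite hu //; apply: leq_trans hi (leq_maxl _ _).
rewrite e; have -> // : p c = q c.
by case: c hu {e} => // i hu; apply: hu; apply: leq_maxr.
Qed.

Lemma partial_depends_upto n f i : depends_upto n f -> (n < i)%N -> partial (cu i) f = 0.
Proof.
move=> df ni; have [] := @is_derive_partial (cu i) f 0 => // p.
rewrite (_ : (fun x => _) = cst (f p)); first exact: is_derive_cst.
apply/funext => h; apply: df; rewrite ?updE //= => j hj.
rewrite updE; case: eqP => // -[e]; rewrite e in hj; lia.
Qed.

(** The second difference of f over a square equals h^2 times a mixed second
   derivative at some point of the square, by two applications of the mean
   value theorem. *)
Lemma partial_square c d f p (h : R) : c != d -> smooth f -> 0 < h ->
  exists a b, [/\ a \in `]p c, p c + h[, b \in `]p d, p d + h[ &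
   f (upd (upd p c (p c + h)) d (p d + h)) - f (upd p d (p d + h))
   - (f (upd p c (p c + h)) - f p) =
   partial d (partial c f) (upd (upd p c a) d b) * h * h].
Proof.
move=> cd sf h0; have hcf := @smooth_has_partial f c sf.
have hdcf := @smooth_has_partial _ d (@smooth_partial f c sf).
pose F (x : R) : R := f (upd (upd p c x) d (p d + h)) - f (upd p c x).
pose dF (x : R) : R := partial c f (upd (upd p c x) d (p d + h)) - partial c f (upd p c x).
have hF (x : R) : is_derive x 1 F (dF x).
  apply: is_deriveB; last exact: partial_is_derive.
  rewrite (_ : (fun x => _) = (fun x => f (upd (upd p d (p d + h)) c x))).
    by rewrite updC //; apply: partial_is_derive.
  by apply/funext => y; rewrite updC.
have Fc : {within `[p c, p c + h], continuous F}.
  by apply: derivable_within_continuous => x _; have [] := hF x.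
have hlt : p c < p c + h by rewrite ltrDl.
have [a ha] := MVT hlt (fun x _ => hF x) Fc.
pose G (y : R) : R := partial c f (upd (upd p c a) d y).
pose dG (y : R) : R := partial d (partial c f) (upd (upd p c a) d y).
have hG (x : R) : is_derive x 1 G (dG x) by apply: partial_is_derive.
have Gc : {within `[p d, p d + h], continuous G}.
  by apply: derivable_within_continuous => x _; have [] := hG x.
have hlt' : p d < p d + h by rewrite ltrDl.
have [b hb] := MVT hlt' (fun x _ => hG x) Gc.
have Gd : G (p d) = partial c f (upd p c a).
  by rewrite /G -[in X in upd _ d X](_ : upd p c a d = p d) ?upd_id // updE eq_sym (negPf cd).
have hz z : z + h - z = h by rewrite addrAC subrr add0r.
rewrite !hz Gd => e2 e1; exists a, b; split => //.
move: e1; rewrite /F upd_id /dF -/(G (p d + h)) e2 => <-.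
by rewrite opprB addrCA addrC -!addrA; congr (_ + _); ring.
Qed.

Lemma dist_le_half2 (x y z e : R) : `|x - z| < e / 2 -> `|y - z| < e / 2 -> `|y - x| <= e.
Proof.
move=> h h'; rewrite (_ : y - x = (y - z) - (x - z)); last by ring.
by apply: le_trans (ler_normB _ _) _; lra.
Qed.

(** Both mixed derivatives evaluate the same second difference up to h^2, at
   points of arbitrarily small squares, and both are continuous. *)
Lemma partialC c d f : smooth f -> partial c (partial d f) = partial d (partial c f).
Proof.
have [->//|cd] := eqVneq c d; move=> sf; apply/funext => p.
pose g1 := partial d (partial c f); pose g2 := partial c (partial d f).
have c1 : continuous (g1 : {ptws coord -> R} -> R).
  by apply: smooth_cont; do 2 apply: smooth_partial.
have c2 : continuous (g2 : {ptws coord -> R} -> R).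
  by apply: smooth_cont; do 2 apply: smooth_partial.
apply/eqP; rewrite -subr_eq0 -normr_le0; apply/ler_addgt0Pl => e e0; rewrite addr0.
pose pt (ab : R * R) : jet R := upd (upd p c ab.1) d ab.2.
have ptc : pt ab @[ab --> (p c, p d)] --> (p : jet R).
  apply: jet_cvg => k.
  suff : (fun ab : R * R => pt ab k) @ nbhs (p c, p d) --> p k by exact.
  rewrite /pt.
  have [->|kd] := eqVneq k d.
    rewrite (_ : (fun _ => _) = snd); first exact: cvg_snd.
    by apply/funext => ab /=; rewrite updE eqxx.
  have [->|kc] := eqVneq k c.
    rewrite (_ : (fun _ => _) = fst); first exact: cvg_fst.
    by apply/funext => ab /=; rewrite !updE (negPf cd) eqxx.
  rewrite (_ : (fun _ => _) = cst (p k)); first exact: cvg_cst.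
  by apply/funext => ab /=; rewrite !updE (negPf kd) (negPf kc).
have e2 : 0 < e / 2 by rewrite divr_gt0.
have h1 : \forall ab \near (p c, p d), `|g1 p - g1 (pt ab)| < e / 2.
  have H : g1 (pt ab) @[ab --> (p c, p d)] --> (g1 p : R).
    exact: (@cvg_comp _ _ _ pt g1 _ _ _ ptc (c1 p)).
  by move/cvgrPdist_lt : H => /(_ _ e2).
have h2 : \forall ab \near (p c, p d), `|g2 p - g2 (pt ab)| < e / 2.
  have H : g2 (pt ab) @[ab --> (p c, p d)] --> (g2 p : R).
    exact: (@cvg_comp _ _ _ pt g2 _ _ _ ptc (c2 p)).
  by move/cvgrPdist_lt : H => /(_ _ e2).
have [r /= r0 hr] := proj1 (nbhs_ballP (p c, p d) _) (filterI h1 h2).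
have r2 : 0 < r / 2 by rewrite divr_gt0.
have inb a b : a \in `]p c, p c + r / 2[ -> b \in `]p d, p d + r / 2[ ->
  ball (p c, p d) r (a, b).
  rewrite !in_itv /= => /andP[a1 a2] /andP[b1 b2]; split; rewrite /ball /= ltr_norml; lra.
have [a [b [ha hb E1]]] := @partial_square c d f p _ cd sf r2.
have dc : d != c by rewrite eq_sym.
have [b' [a' [hb' ha' E2]]] := @partial_square d c f p _ dc sf r2.
have [k1 _] := hr _ (inb _ _ ha hb).
have [_ k2] := hr _ (inb _ _ ha' hb').
have E : g1 (pt (a, b)) = g2 (pt (a', b')).
  have rn : r / 2 != 0 by rewrite gt_eqF.
  have E' : (g1 (pt (a, b)) : R) * (r / 2) * (r / 2) = (g2 (pt (a', b')) : R) * (r / 2) * (r / 2).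
    apply: (etrans (esym E1)).
    have -> : g2 (pt (a', b')) = partial c (partial d f) (upd (upd p d b') c a').
      by rewrite /g2 /pt /= updC.
    apply: etrans E2.
    by rewrite (updC p _ _ cd) !opprB; ring.
  exact: (mulIf rn (mulIf rn E')).
rewrite E in k1.
exact: (dist_le_half2 k1 k2).
Qed.
End Smooth.

(** * Finitely supported sums *)

Section Fsum.
Variable V : nmodType.
Lemma fsum_nat (F : nat -> V) N : (forall i, (N <= i)%N -> F i = 0) ->
  \sum_(i \in [set: nat]) F i = \sum_(i < N) F i.
Proof.
move=> h; rewrite (@fsbigE _ _ _ _ [set: nat] (iota 0 N)) ?iota_uniq //.
  by rewrite -(big_mkord (fun=> true)) /index_iota subn0; apply: eq_bigl => i; rewrite mem_set.
by move=> i _; rewrite mem_iota add0n leq0n /= -leqNgt; apply: h.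
Qed.

Lemma fsum_coord (F : coord -> V) N : (forall i, (N <= i)%N -> F (cu i) = 0) ->
  \sum_(c \in [set: coord]) F c = F ct + (F cx + \sum_(i < N) F (cu i)).
Proof.
move=> h; rewrite (@fsbigE _ _ _ _ [set: coord] [:: ct, cx & map cu (iota 0 N)]) //=.
- rewrite (eq_bigl xpredT) => [|i]; last by rewrite mem_set.
  rewrite !big_cons big_map /=; congr (_ + (_ + _)).
  by rewrite -(big_mkord (fun=> true) (fun i => F (cu i))) /index_iota subn0.
- rewrite !inE /= map_inj_uniq ?iota_uniq; last by move=> i j [].
  by apply/andP; split; [|rewrite andbT]; apply/negP => /mapP[].
- move=> c _; case: c => [||i]; rewrite !inE ?eqxx //= => hi; apply: h.
  rewrite leqNgt; apply: contra hi => hi; apply/mapP; exists i => //.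
  by rewrite mem_iota.
Qed.
End Fsum.

(** * The differential ring of smooth functions *)

Section SmoothRing.
Variable R : realType.

Definition smoothp : {pred fn R} := [pred f | `[<smooth f>]].
Lemma smoothpP f : reflect (smooth f) (f \in smoothp).
Proof. exact: asboolP. Qed.

Lemma smoothN (f : fn R) : smooth f -> smooth (- f).
Proof. by move=> sf; rewrite -[- f]mulN1r; exact: (smoothM (smooth_cst (-1)) sf). Qed.

Record sfun := SFun { sfun_val : fn R; sfun_smoothp : sfun_val \in smoothp }.
HB.instance Definition _ := [isSub for sfun_val].
HB.instance Definition _ := [Choice of sfun by <:].

Definition fval (f : sfun) : fn R := sfun_val f.
Lemma sfun_inj (f g : sfun) : fval f = fval g -> f = g.
Proof. exact: val_inj. Qed.
Lemma sfunP (f : sfun) : smooth (fval f).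
Proof. exact/smoothpP/valP. Qed.

Lemma smooth0 : smooth (0 : fn R). Proof. exact: (smooth_cst 0). Qed.

Definition mkS f (sf : smooth f) : sfun := SFun (introT (smoothpP f) sf).
Definition szero := mkS smooth0.
Definition sone := mkS (smooth_cst (1 : R)).
Definition sopp f := mkS (smoothN (sfunP f)).
Definition sadd f g := mkS (smoothD (sfunP f) (sfunP g)).
Definition smul f g := mkS (smoothM (sfunP f) (sfunP g)).
Lemma saddA : associative sadd.
Proof. by move=> f g h; apply: sfun_inj; exact: addrA. Qed.
Lemma saddC : commutative sadd.
Proof. by move=> f g; apply: sfun_inj; exact: addrC. Qed.
Lemma sadd0 : left_id szero sadd.
Proof. by move=> f; apply: sfun_inj; exact: add0r. Qed.
Lemma saddN : left_inverse szero sopp sadd.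
Proof. by move=> f; apply: sfun_inj; exact: addNr. Qed.
HB.instance Definition _ := GRing.isZmodule.Build sfun saddA saddC sadd0 saddN.
Lemma smulA : associative smul.
Proof. by move=> f g h; apply: sfun_inj; exact: mulrA. Qed.
Lemma smulC : commutative smul.
Proof. by move=> f g; apply: sfun_inj; exact: mulrC. Qed.
Lemma smul1 : left_id sone smul.
Proof. by move=> f; apply: sfun_inj; exact: mul1r. Qed.
Lemma smulDl : left_distributive smul sadd.
Proof. by move=> f g h; apply: sfun_inj; exact: mulrDl. Qed.
Lemma sone_neq0 : sone != szero.
Proof.
apply/eqP => /(congr1 (fun f => fval f (fun=> 0))).
by move/eqP; rewrite /fval /= oner_eq0.
Qed.
HB.instance Definition _ := GRing.Zmodule_isComNzRing.Build sfun smulA smulC smul1 smulDl sone_neq0.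

Lemma valD (f g : sfun) : fval (f + g) = fval f + fval g. Proof. by []. Qed.
Lemma valN (f : sfun) : fval (- f) = - fval f. Proof. by []. Qed.
Lemma valB (f g : sfun) : fval (f - g) = fval f - fval g. Proof. by []. Qed.
Lemma valM (f g : sfun) : fval (f * g) = fval f * fval g. Proof. by []. Qed.
Lemma val_sum I (r : seq I) (P : pred I) (F : I -> sfun) :
  fval (\sum_(i <- r | P i) F i) = \sum_(i <- r | P i) fval (F i).
Proof. by apply: (big_morph fval) => // f g; exact: valD. Qed.
Lemma val_nat n : fval n%:R = n%:R.
Proof. by elim: n => [|n IH] //; rewrite !mulrS valD IH. Qed.

Lemma lift_ex f : {g : sfun | smooth f -> fval g = f}.
Proof.
exists (insubd szero f) => /smoothpP sf.
by rewrite /fval [LHS]val_insubd sf.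
Qed.

(** The function f when it is smooth, and otherwise an unspecified smooth
   function, so that [lift] is total. *)
Definition lift f : sfun := sval (lift_ex f).
Lemma liftK f : smooth f -> fval (lift f) = f.
Proof. exact: (svalP (lift_ex f)). Qed.
Lemma val_lift (f : sfun) : lift (fval f) = f.
Proof. by apply: sfun_inj; rewrite liftK //; exact: sfunP. Qed.

Lemma smooth_sum I (r : seq I) (P : pred I) (F : I -> fn R) :
  (forall i, smooth (F i)) -> smooth (\sum_(i <- r | P i) F i).
Proof.
move=> h; apply: (big_ind (@smooth R)); [exact: smooth0|exact: smoothD|].
by move=> i _; exact: h.
Qed.

Lemma sd_ex c f : {g : sfun | fval g = partial c (fval f)}.
Proof. by exists (lift (partial c (fval f))); apply: liftK; apply: smooth_partial; exact: sfunP. Qed.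
Definition sd c f : sfun := sval (sd_ex c f).
Lemma val_sd c f : fval (sd c f) = partial c (fval f).
Proof. exact: (svalP (sd_ex c f)). Qed.

Lemma partialB (f g : fn R) c : smooth f -> smooth g ->
  partial c (f - g) = partial c f - partial c g.
Proof.
move=> sf sg; have [h1 h2] := has_partialN (@smooth_has_partial _ _ c sg).
by have [_ ->] := has_partialD (@smooth_has_partial _ _ c sf) h1; rewrite h2.
Qed.
Lemma sd_zmod c : zmod_morphism (sd c).
Proof.
move=> f g; apply: sfun_inj.
by rewrite [RHS]valB !val_sd valB (partialB c (sfunP f) (sfunP g)).
Qed.
HB.instance Definition _ c := GRing.isZmodMorphism.Build sfun sfun (sd c) (sd_zmod c).

Lemma sdM c (f g : sfun) : sd c (f * g) = sd c f * g + f * sd c g.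
Proof.
apply: sfun_inj; rewrite valD !valM !val_sd valM.
by have [_ ->] := has_partialM (@smooth_has_partial _ _ c (sfunP f)) (@smooth_has_partial _ _ c (sfunP g)).
Qed.

Lemma sdC c d (f : sfun) : sd c (sd d f) = sd d (sd c f).
Proof. by apply: sfun_inj; rewrite !val_sd (@partialC _ c d _ (sfunP f)). Qed.

Definition scoord c : sfun := lift (coordfn c).
Lemma val_scoord c : fval (scoord c) = coordfn c.
Proof. by apply: liftK; exact: smooth_coord. Qed.
Lemma sd_coord c d : sd c (scoord d) = (c == d)%:R.
Proof.
apply: sfun_inj; rewrite val_sd val_scoord val_nat.
by have [_ ->] := has_partial_coord R c d.
Qed.

Lemma sd_bound (f : sfun) : exists N, forall i, (N <= i)%N -> sd (cu i) f = 0.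
Proof.
have [N h] := smooth_depends_upto (sfunP f); exists N.+1 => i hi.
by apply: sfun_inj; rewrite val_sd (partial_depends_upto h).
Qed.

Lemma smooth_vact (V : vfield R) f : (forall c, smooth (V c)) -> smooth f -> smooth (vact V f).
Proof.
move=> hV sf; have [N hN] := smooth_depends_upto sf.
rewrite /vact (@fsum_coord _ _ N.+1); last first.
  by move=> i hi; rewrite (partial_depends_upto hN) // mulr0.
have s c : smooth (V c * partial c f) := smoothM (hV c) (smooth_partial c sf).
apply: (smoothD (s ct)); apply: (smoothD (s cx)); apply: smooth_sum => i; exact: s.
Qed.

Lemma sact_ex V f : {g : sfun | fval g = vact (fun c => fval (V c)) (fval f)}.
Proof.
exists (lift (vact (fun c => fval (V c)) (fval f))); apply: liftK.
by apply: smooth_vact => [c|]; exact: sfunP.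
Qed.

(** The action of a vector field with smooth components. *)
Definition sact (V : coord -> sfun) f : sfun := sval (sact_ex V f).
Lemma val_sact V f : fval (sact V f) = vact (fun c => fval (V c)) (fval f).
Proof. exact: (svalP (sact_ex V f)). Qed.

Lemma sactE N V f : (forall i, (N <= i)%N -> sd (cu i) f = 0) ->
  sact V f = V ct * sd ct f + (V cx * sd cx f + \sum_(i < N) V (cu i) * sd (cu i) f).
Proof.
move=> h; apply: sfun_inj; rewrite val_sact /vact (@fsum_coord _ _ N); last first.
  by move=> i hi; rewrite -val_sd h // mulr0.
rewrite !valD !valM !val_sd val_sum; congr (_ + (_ + _)).
by apply: eq_bigr => i _; rewrite valM val_sd.
Qed.

Lemma sd_bound2 (f g : sfun) : exists N, forall i, (N <= i)%N -> sd (cu i) f = 0 /\ sd (cu i) g = 0.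
Proof.
have [M hM] := sd_bound f; have [N hN] := sd_bound g; exists (maxn M N) => i.
by rewrite geq_max => /andP[h1 h2]; rewrite hM ?hN.
Qed.

Lemma sact_zmod V : zmod_morphism (sact V).
Proof.
move=> f g; have [N hN] := sd_bound2 f g.
have hf i : (N <= i)%N -> sd (cu i) f = 0 by move/hN => [].
have hg i : (N <= i)%N -> sd (cu i) g = 0 by move/hN => [].
rewrite !(@sactE N) // => [|i hi]; last by rewrite raddfB /= hf // hg // subrr.
rewrite !raddfB /= !mulrBr.
under eq_bigr => i _ do rewrite raddfB mulrBr.
rewrite sumrB; ring.
Qed.
HB.instance Definition _ V := GRing.isZmodMorphism.Build sfun sfun (sact V) (sact_zmod V).

Lemma sactM V f g : sact V (f * g) = sact V f * g + f * sact V g.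
Proof.
have [N hN] := sd_bound2 f g.
have hf i : (N <= i)%N -> sd (cu i) f = 0 by move/hN => [].
have hg i : (N <= i)%N -> sd (cu i) g = 0 by move/hN => [].
rewrite !(@sactE N) // => [|i hi]; last by rewrite sdM hf // hg // mulr0 mul0r addr0.
rewrite !sdM.
have -> : \sum_(i < N) V (cu i) * sd (cu i) (f * g) =
  (\sum_(i < N) V (cu i) * sd (cu i) f) * g + f * (\sum_(i < N) V (cu i) * sd (cu i) g).
  by rewrite mulr_suml mulr_sumr -big_split; apply: eq_bigr => i _ /=; rewrite sdM; ring.
ring.
Qed.

(** [d/dc, V] has the components dV_c'/dc; this uses the symmetry of second
   derivatives. *)
Lemma sd_sact c V f : sd c (sact V f) = sact (fun d => sd c (V d)) f + sact V (sd c f).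
Proof.
have [N hN] := sd_bound f.
rewrite !(@sactE N) // => [|i hi]; last by rewrite sdC hN // raddf0.
rewrite !raddfD /= raddf_sum !sdM ![sd _ (sd c f)]sdC /=.
have -> : \sum_(i < N) sd c (V (cu i) * sd (cu i) f) =
  \sum_(i < N) sd c (V (cu i)) * sd (cu i) f + \sum_(i < N) V (cu i) * sd (cu i) (sd c f).
  by rewrite -big_split; apply: eq_bigr => i _ /=; rewrite sdM [sd _ (sd c f)]sdC.
by rewrite [RHS]addrACA; congr (_ + _); exact: addrACA.
Qed.

Definition sXf c : sfun := match c with ct => 0 | cx => 1 | cu i => scoord (cu i.+1) end.
Definition sX := sact sXf.
HB.instance Definition _ := GRing.isZmodMorphism.Build sfun sfun sX (sact_zmod sXf).

Lemma sXM f g : sX (f * g) = sX f * g + f * sX g. Proof. exact: sactM. Qed.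

Lemma val_sX f : fval (sX f) = vact (@Xf R) (fval f).
Proof.
rewrite /sX val_sact (_ : (fun c => _) = @Xf R) //.
by apply/funext => -[||i] //=; rewrite val_scoord.
Qed.

Lemma val_sX_iter i f : fval (iter i sX f) = iter i (vact (@Xf R)) (fval f).
Proof. by elim: i => //= i <-; rewrite val_sX. Qed.

Definition sD i := sd (cu i).
HB.instance Definition _ i := GRing.isZmodMorphism.Build sfun sfun (sD i) (sd_zmod (cu i)).

Lemma sDX i f : sD i (sX f) = sX (sD i f) + (if i is j.+1 then sD j f else 0).
Proof.
rewrite /sD /sX sd_sact addrC; congr (_ + _).
have [N hN] := sd_bound f.
rewrite (@sactE (maxn N i)) => [|k hk]; last by rewrite hN //; lia.
rewrite /= raddf0 mul0r add0r.
have -> : sd (cu i) 1 = 0.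
  have := sdM (cu i) 1 1; rewrite mulr1 mul1r mulr1 => h.
  by apply: (addrI (sd (cu i) 1)); rewrite -h addr0.
rewrite mul0r add0r; under eq_bigr => k _ do rewrite sd_coord.
case: i => [|i]; first by rewrite big1 // => k _; rewrite mul0r.
have hi : (i < maxn N i.+1)%N by rewrite leq_max leqnn orbT.
rewrite (bigD1 (Ordinal hi)) //= eqxx mul1r big1 ?addr0 // => k.
rewrite -val_eqE /= => /negPf hk.
by case: eqP => [[e]|]; rewrite ?mul0r //; rewrite -e eqxx in hk.
Qed.

Lemma sdtX f : sd ct (sX f) = sX (sd ct f).
Proof.
rewrite /sX sd_sact addrC -[RHS]addr0; congr (_ + _).
have [N hN] := sd_bound f; rewrite (@sactE N) //= raddf0 mul0r add0r.
have -> : sd ct 1 = 0.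
  have := sdM ct 1 1; rewrite mulr1 mul1r mulr1 => h.
  by apply: (addrI (sd ct 1)); rewrite -h addr0.
by rewrite mul0r add0r big1 // => k _; rewrite sd_coord mul0r.
Qed.

Variable K : sfun.
Definition sTf c : sfun := match c with ct => 1 | cx => 0 | cu i => iter i sX K end.
Definition sT := sact sTf.
HB.instance Definition _ := GRing.isZmodMorphism.Build sfun sfun sT (sact_zmod sTf).

Lemma sTM f g : sT (f * g) = sT f * g + f * sT g. Proof. exact: sactM. Qed.

Lemma val_sT f : fval (sT f) = vact (Tf (fval K)) (fval f).
Proof.
rewrite /sT val_sact (_ : (fun c => _) = Tf (fval K)) //.
by apply/funext => -[||i] //=; rewrite val_sX_iter.
Qed.

Lemma sDT P i f : (forall k, (P <= k)%N -> sD k f = 0) ->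
  sD i (sT f) = sT (sD i f) + \sum_(k < P) sD i (iter k sX K) * sD k f.
Proof.
move=> h; rewrite /sD /sT sd_sact addrC; congr (_ + _).
rewrite (@sactE P) //= raddf0 mul0r add0r.
have -> : sd (cu i) 1 = 0.
  have := sdM (cu i) 1 1; rewrite mulr1 mul1r mulr1 => h'.
  by apply: (addrI (sd (cu i) 1)); rewrite -h' addr0.
by rewrite mul0r add0r.
Qed.

(** X and T commute because T acts on u_i as X^i (T u_0). *)
Lemma sXT f : sX (sT f) = sT (sX f).
Proof.
have [N hN] := sd_bound f.
have hX i : (N.+1 <= i)%N -> sd (cu i) (sX f) = 0.
  case: i => // i hi; rewrite -/(sD _) sDX /sD hN ?raddf0 ?add0r; last exact: ltnW.
  by rewrite hN.
rewrite /sT (@sactE N) // (@sactE N.+1) //= !mul1r !mul0r !add0r raddfD /= sdtX; congr (_ + _).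
rewrite raddf_sum /=.
have -> : \sum_(i < N.+1) iter i sX K * sd (cu i) (sX f) =
   \sum_(i < N.+1) iter i sX K * sX (sD i f)
   + \sum_(i < N.+1) iter i sX K * (if (i : nat) is j.+1 then sD j f else 0).
  by rewrite -big_split; apply: eq_bigr => i _ /=; rewrite -/(sD _) sDX mulrDr; case: (i : nat).
rewrite big_ord_recr /= {2}/sD hN // raddf0 mulr0 addr0.
rewrite [X in _ = _ + X]big_ord_recl /= mulr0 add0r -big_split; apply: eq_bigr => i _ /=.
by rewrite sXM addrC.
Qed.

Lemma sfun_char0 m (f : sfun) : f *+ m.+1 = 0 -> f = 0.
Proof.
move=> h; apply: sfun_inj; apply/funext => p.
have e k : fval (f *+ k) p = fval f p *+ k.
  by elim: k => [|k IH] //; rewrite !mulrS valD -IH.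
have : fval (f *+ m.+1) p = 0 by rewrite h.
by rewrite e => /eqP; rewrite mulrn_eq0 /= => /eqP.
Qed.

(** The ring of smooth functions has zero divisors; a function without zeros
   is not one of them. *)
Lemma sfun_reg (f g : sfun) : (forall p, fval f p != 0) -> f * g = 0 -> g = 0.
Proof.
move=> h fg; apply: sfun_inj; apply/funext => p.
have H : (fval f p : R) * fval g p = 0 by rewrite -[LHS]/(fval (f * g) p) fg.
by move/eqP: H; rewrite mulf_eq0 (negPf (h p)) /= => /eqP.
Qed.

End SmoothRing.

(** * Exterior algebra of forms *)

Section Forms.
Variable R : realType.
Implicit Types (v w : form R) (f g : fn R) (c d : coord) (l : seq coord).

Lemma formD v w l : (v + w) l = v l + w l. Proof. by []. Qed.
Lemma formN v l : (- v) l = - v l. Proof. by []. Qed.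
Lemma formB v w l : (v - w) l = v l - w l. Proof. by []. Qed.
Lemma form0 l : (0 : form R) l = 0. Proof. by []. Qed.
Lemma form_sum I (r : seq I) (P : pred I) (F : I -> form R) l :
  (\sum_(i <- r | P i) F i) l = \sum_(i <- r | P i) F i l.
Proof. by elim/big_rec2: _ => // i _ y _ <-. Qed.

Lemma formP v w : v [::] = w [::] -> (forall c, contract c v = contract c w) -> v = w.
Proof.
move=> h0 hS; apply/funext => -[|c l]; first exact: h0.
by rewrite -[LHS]/(contract c v l) hS.
Qed.

Lemma contractD c v w : contract c (v + w) = contract c v + contract c w. Proof. by []. Qed.
Lemma contractN c v : contract c (- v) = - contract c v. Proof. by []. Qed.
Lemma contractB c v w : contract c (v - w) = contract c v - contract c w. Proof. by []. Qed.
Lemma contract0 c : contract c (0 : form R) = 0. Proof. by []. Qed.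
Lemma contract_sum c I (r : seq I) (P : pred I) (F : I -> form R) :
  contract c (\sum_(i <- r | P i) F i) = \sum_(i <- r | P i) contract c (F i).
Proof. by apply/funext => l; rewrite [LHS]form_sum form_sum. Qed.
Lemma contract_fmul c f w : contract c (fmul f w) = fmul f (contract c w). Proof. by []. Qed.

Lemma fmulDr f v w : fmul f (v + w) = fmul f v + fmul f w.
Proof. by apply/funext => l; exact: mulrDr. Qed.
Lemma fmulNr f w : fmul f (- w) = - fmul f w.
Proof. by apply/funext => l; exact: mulrN. Qed.
Lemma fmul0r f : fmul f (0 : form R) = 0.
Proof. by apply/funext => l; exact: mulr0. Qed.
Lemma fmul0l w : fmul (0 : fn R) w = 0.
Proof. by apply/funext => l; exact: mul0r. Qed.
Lemma fmulA f g w : fmul f (fmul g w) = fmul (f * g) w.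
Proof. by apply/funext => l; exact: mulrA. Qed.
Lemma fmulC f g w : fmul f (fmul g w) = fmul g (fmul f w).
Proof. by apply/funext => l; exact: mulrCA. Qed.
Lemma fmul1l w : fmul (1 : fn R) w = w.
Proof. by apply/funext => l; exact: mul1r. Qed.

(** Exterior products of the development have a 1-form on the left, where the
   rule for contractions takes the simple form [contract_wedge]. *)
Definition oneform v := forall l, size l != 1%N -> v l = 0.

Lemma oneformD v w : oneform v -> oneform w -> oneform (v + w).
Proof. by move=> hv hw l hl; rewrite formD hv // hw // addr0. Qed.
Lemma oneformN v : oneform v -> oneform (- v).
Proof. by move=> hv l hl; rewrite formN hv // oppr0. Qed.
Lemma oneform_fmul f v : oneform v -> oneform (fmul f v).
Proof. by move=> hv l hl; rewrite /fmul hv // mulr0. Qed.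
Lemma oneform0 : oneform 0. Proof. by []. Qed.
Lemma oneform_sum I (r : seq I) (F : I -> form R) :
  (forall i, oneform (F i)) -> oneform (\sum_(i <- r) F i).
Proof. by move=> h; elim/big_rec: _ => [|i x _ hx]; [exact: oneform0|exact: oneformD]. Qed.
Lemma oneform_gen c : oneform (@gen R c).
Proof. by move=> [|d [|e l]] //; rewrite /gen eqseq_cons andbF. Qed.
Lemma gen1 c d : @gen R c [:: d] = (d == c)%:R.
Proof. by rewrite /gen eqseq_cons andbT. Qed.

Lemma degsign1 v : oneform v -> degsign v = - v.
Proof.
move=> hv; apply/funext => l; rewrite /degsign formN.
have [->|hl] := eqVneq (size l) 1%N; first by rewrite expr1 mulN1r.
by rewrite hv // mulr0 oppr0.
Qed.

Lemma wedge_atDl l v v' w : wedge_at l (v + v') w = wedge_at l v w + wedge_at l v' w.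
Proof.
elim: l v v' w => [|c l IH] v v' w /=; first exact: mulrDl.
have -> : degsign (v + v') = degsign v + degsign v'.
  by apply/funext => k; exact: mulrDr.
by rewrite contractD !IH addrACA.
Qed.
Lemma wedge_atDr l v w w' : wedge_at l v (w + w') = wedge_at l v w + wedge_at l v w'.
Proof.
elim: l v w w' => [|c l IH] v w w' /=; first exact: mulrDr.
by rewrite contractD !IH addrACA.
Qed.
Lemma wedgeDl v v' w : wedge (v + v') w = wedge v w + wedge v' w.
Proof. by apply/funext => l; exact: wedge_atDl. Qed.
Lemma wedgeDr v w w' : wedge v (w + w') = wedge v w + wedge v w'.
Proof. by apply/funext => l; exact: wedge_atDr. Qed.
Lemma wedge0l w : wedge 0 w = 0.
Proof. by apply: (@addrI _ (wedge 0 w)); rewrite -wedgeDl !addr0. Qed.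
Lemma wedge0r v : wedge v 0 = 0.
Proof. by apply: (@addrI _ (wedge v 0)); rewrite -wedgeDr !addr0. Qed.
Lemma wedgeNl v w : wedge (- v) w = - wedge v w.
Proof. by apply: (@addrI _ (wedge v w)); rewrite -wedgeDl !subrr wedge0l. Qed.
Lemma wedgeNr v w : wedge v (- w) = - wedge v w.
Proof. by apply: (@addrI _ (wedge v w)); rewrite -wedgeDr !subrr wedge0r. Qed.
Lemma wedge_sumr v I (r : seq I) (F : I -> form R) :
  wedge v (\sum_(i <- r) F i) = \sum_(i <- r) wedge v (F i).
Proof. by apply: (big_morph (wedge v)); [exact: wedgeDr|exact: wedge0r]. Qed.

Lemma wedge_zero z w : (forall c, contract c z = 0) -> wedge z w = fmul (z [::]) w.
Proof.
move=> hz; apply/funext => l; rewrite /wedge /fmul.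
elim: l z w hz => [//|c l IH] z w hz /=.
rewrite hz -/(wedge 0 w l) wedge0l form0 add0r.
have -> : degsign z = z.
  apply: formP => [|d]; first by rewrite /degsign /= expr0 mul1r.
  by apply/funext => k; rewrite -[RHS]/(contract d z k) hz -[LHS]/(_ * contract d z k) hz mulr0.
exact: IH.
Qed.

Lemma contract_wedge c v w : oneform v ->
  contract c (wedge v w) = fmul (v [:: c]) w - wedge v (contract c w).
Proof.
move=> hv; have -> : contract c (wedge v w) =
    wedge (contract c v) w + wedge (degsign v) (contract c w) by [].
rewrite degsign1 // wedgeNl wedge_zero // => d; apply/funext => l.
by rewrite -[LHS]/(v (c :: d :: l)) hv.
Qed.

Lemma wedge_nil v w : oneform v -> wedge v w [::] = 0.
Proof. by move=> hv; rewrite -[LHS]/(v [::] * w [::]) hv // mul0r. Qed.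

Lemma wedge_fmulr f v w : oneform v -> wedge v (fmul f w) = fmul f (wedge v w).
Proof.
move=> hv; apply/funext => l; elim: l w => [|c l IH] w.
  by rewrite wedge_nil // /fmul wedge_nil // mulr0.
rewrite -[LHS]/(contract c (wedge v _) l) contract_wedge // formB contract_fmul IH.
rewrite -[RHS]/(fmul f (contract c (wedge v w)) l) contract_wedge // fmulDr fmulNr formD formN.
by congr (_ - _); rewrite fmulC.
Qed.

Definition falt w := forall l1 c d l2, w (l1 ++ c :: d :: l2) = - w (l1 ++ d :: c :: l2).
Definition fbnd N w := forall i l, (N <= i)%N -> cu i \in l -> w l = 0.
Definition fsmooth w := forall l, smooth (w l).

(** Smoothness, alternation and finite support characterize the finite sums of
   smooth multiples of monomials among all families of functions; see
   [good_Omega]. *)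
Definition good w := [/\ fsmooth w, falt w & exists N, fbnd N w].

Lemma falt_contract c w : falt w -> falt (contract c w).
Proof. by move=> h l1 d e l2; exact: (h (c :: l1)). Qed.
Lemma fbnd_contract N c w : fbnd N w -> fbnd N (contract c w).
Proof. by move=> h i l hi hl; apply: (h i) => //; rewrite inE hl orbT. Qed.
Lemma fsmooth_contract c w : fsmooth w -> fsmooth (contract c w).
Proof. by move=> h l; exact: h. Qed.
Lemma good_contract c w : good w -> good (contract c w).
Proof.
move=> [h1 h2 [N h3]]; split; [exact: fsmooth_contract|exact: falt_contract|].
by exists N; exact: fbnd_contract.
Qed.

Lemma fbnd_le N M w : (N <= M)%N -> fbnd N w -> fbnd M w.
Proof. by move=> NM h i l hi; apply: h; apply: leq_trans hi. Qed.
Lemma fbnd0 N w i : fbnd N w -> (N <= i)%N -> contract (cu i) w = 0.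
Proof. by move=> h hi; apply/funext => l; apply: (h i) => //; rewrite inE eqxx. Qed.
Lemma fbndD N v w : fbnd N v -> fbnd N w -> fbnd N (v + w).
Proof. by move=> hv hw i l hi hl; rewrite formD (hv i) // (hw i) // addr0. Qed.

Lemma falt_swap c d w : falt w -> contract c (contract d w) = - contract d (contract c w).
Proof. by move=> h; apply/funext => l; exact: (h [::]). Qed.

Lemma good0 : good 0.
Proof.
split; [by move=> l; exact: smooth0|by move=> *; rewrite !form0 oppr0|by exists 0].
Qed.
Lemma goodD v w : good v -> good w -> good (v + w).
Proof.
move=> [s1 a1 [N b1]] [s2 a2 [M b2]]; split.
- by move=> l; exact: smoothD (s1 l) (s2 l).
- by move=> l1 c d l2; rewrite !formD a1 a2 opprD.
- exists (maxn N M); apply: fbndD.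
    by apply: fbnd_le b1; exact: leq_maxl.
  by apply: fbnd_le b2; exact: leq_maxr.
Qed.
Lemma good_fmul f w : smooth f -> good w -> good (fmul f w).
Proof.
move=> sf [s1 a1 [N b1]]; split.
- by move=> l; exact: smoothM sf (s1 l).
- by move=> l1 c d l2; rewrite /fmul a1 mulrN.
- by exists N => i l hi hl; rewrite /fmul (b1 i) // mulr0.
Qed.
Lemma fmulN1 w : fmul (- 1) w = - w.
Proof. by apply/funext => l; exact: mulN1r. Qed.
Lemma goodN w : good w -> good (- w).
Proof. by rewrite -fmulN1; apply: good_fmul; exact: (smooth_cst (- 1)). Qed.
Lemma good_sum I (r : seq I) (F : I -> form R) :
  (forall i, good (F i)) -> good (\sum_(i <- r) F i).
Proof. by move=> h; elim/big_rec: _ => [|i x _ hx]; [exact: good0|exact: goodD]. Qed.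

Lemma scale_fmul (a : R) w : a *: w = fmul (cst a) w.
Proof. by []. Qed.
Lemma good_scale (a : R) w : good w -> good (a *: w).
Proof. by rewrite scale_fmul; apply: good_fmul; exact: smooth_cst. Qed.

Lemma smooth_nat n : smooth (n%:R : fn R).
Proof. by rewrite -[n%:R](@val_nat R n); exact: sfunP. Qed.

Lemma good_gen c : good (@gen R c).
Proof.
split.
- by move=> l; exact: smooth_nat.
- move=> l1 d e l2; rewrite !oneform_gen ?oppr0 // size_cat /=; lia.
- exists (if c is cu i then i.+1 else 0) => i l hi hl; rewrite /gen; case: eqP => // e.
  by move: hl; rewrite e inE => /eqP ec; rewrite -ec ltnn in hi.
Qed.

Lemma falt_wedge v w : oneform v -> falt w -> falt (wedge v w).
Proof.
move=> hv hw l1; elim: l1 w hw => [|e l1 IH] w hw c d l2.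
  rewrite !cat0s -[LHS]/(contract d (contract c (wedge v w)) l2).
  rewrite -[wedge v w _ in RHS]/(contract c (contract d (wedge v w)) l2).
  rewrite !contract_wedge // !contractB !contract_fmul !contract_wedge //.
  rewrite (falt_swap d c hw) wedgeNr opprK !formB !formD /fmul.
  by rewrite !opprD !opprK addrCA.
rewrite !cat_cons -[LHS]/(contract e (wedge v w) _) -[wedge v w _ in RHS]/(contract e (wedge v w) (l1 ++ d :: c :: l2)).
rewrite contract_wedge // !formB /fmul hw IH; last exact: falt_contract.
by rewrite mulrN opprB opprK addrC.
Qed.

Lemma fsmooth_wedge v w : oneform v -> fsmooth v -> fsmooth w -> fsmooth (wedge v w).
Proof.
move=> hv sv sw l; elim: l w sw => [|c l IH] w sw; first by rewrite wedge_nil //; exact: smooth0.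
rewrite -[wedge _ _ _]/(contract c (wedge v w) l) contract_wedge // formB /fmul.
exact: smoothD (smoothM (sv _) (sw l)) (smoothN (IH _ (@fsmooth_contract c _ sw))).
Qed.

Lemma fbnd_wedge N v w : oneform v -> fbnd N v -> fbnd N w -> fbnd N (wedge v w).
Proof.
move=> hv bv bw i l hi; elim: l w bw => [//|c l IH] w bw.
rewrite inE -[wedge _ _ _]/(contract c (wedge v w) l) contract_wedge // formB /fmul.
move=> /orP[/eqP <-|hl].
  by rewrite (bv i) ?inE ?eqxx // mul0r (fbnd0 bw) // wedge0r subr0.
by rewrite (bw i) // mulr0 IH ?subr0 //; exact: fbnd_contract.
Qed.

Lemma good_wedge v w : oneform v -> good v -> good w -> good (wedge v w).
Proof.
move=> hv [s1 a1 [N b1]] [s2 a2 [M b2]]; split; [exact: fsmooth_wedge|exact: falt_wedge|].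
exists (maxn N M); apply: fbnd_wedge => //.
  by apply: fbnd_le b1; exact: leq_maxl.
by apply: fbnd_le b2; exact: leq_maxr.
Qed.

Lemma good_gen_wedge c w : good w -> good (wedge (gen c) w).
Proof. exact: good_wedge (oneform_gen c) (good_gen c). Qed.

(** Bidegree (r, s), shifted by a horizontal and b vertical slots already
   filled, so that contraction changes a or b and leaves r and s alone. *)
Definition bideg (a b r s : nat) w := forall l,
  ~~ ((a + count (predC is_u) l == r) && (b + count is_u l == s))%N -> w l = 0.

Lemma bideg_contract a b r s c w : bideg a b r s w ->
  bideg (a + ~~ is_u c) (b + is_u c) r s (contract c w).
Proof. by move=> h l hl; apply: h => /=; rewrite !addnA. Qed.

Lemma bideg0 a b r s : bideg a b r s 0. Proof. by []. Qed.
Lemma bidegD a b r s v w : bideg a b r s v -> bideg a b r s w -> bideg a b r s (v + w).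
Proof. by move=> hv hw l hl; rewrite formD hv // hw // addr0. Qed.
Lemma bideg_fmul a b r s f w : bideg a b r s w -> bideg a b r s (fmul f w).
Proof. by move=> hw l hl; rewrite /fmul hw // mulr0. Qed.
Lemma bidegN a b r s w : bideg a b r s w -> bideg a b r s (- w).
Proof. by move=> hw l hl; rewrite formN hw // oppr0. Qed.
Lemma bideg_sum a b r s I (q : seq I) (F : I -> form R) :
  (forall i, bideg a b r s (F i)) -> bideg a b r s (\sum_(i <- q) F i).
Proof. by move=> h; elim/big_rec: _ => [|i x _ hx]; [exact: bideg0|exact: bidegD]. Qed.

(** A purely vertical (k = true) or purely horizontal 1-form. *)
Definition kind1 (k : bool) v := oneform v /\ forall c, is_u c != k -> v [:: c] = 0.
Lemma kind1_gen c : kind1 (is_u c) (@gen R c).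
Proof.
split; first exact: oneform_gen.
by move=> d hd; rewrite gen1; have [e|//] := eqVneq d c; rewrite e eqxx in hd.
Qed.

Lemma bideg_wedge a b r s k v w : kind1 k v -> bideg a b r s w ->
  bideg a b (r + ~~ k) (s + k) (wedge v w).
Proof.
move=> [hv hk] hw l; elim: l a b w hw => [|c l IH] a b w hw hl; first exact: wedge_nil.
rewrite -[LHS]/(contract c (wedge v w) l) contract_wedge // formB /fmul.
rewrite (IH _ _ _ (bideg_contract (c := c) hw)) ?subr0; last by move: hl; rewrite /= !addnA.
have [e|ne] := eqVneq (is_u c) k; last by rewrite hk // mul0r.
rewrite hw ?mulr0 //; move: hl; rewrite /= -e; case: (is_u c) => /=; lia.
Qed.

Lemma bideg_gen_u a b r s i w : bideg a b r s w -> bideg a b r s.+1 (wedge (gen (cu i)) w).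
Proof. by move=> h; have := bideg_wedge (kind1_gen (cu i)) h; rewrite /= addn0 addn1. Qed.
Lemma bideg_gen_h a b r s c w : ~~ is_u c -> bideg a b r s w -> bideg a b r.+1 s (wedge (gen c) w).
Proof.
move=> hc h; have := bideg_wedge (kind1_gen c) h.
by rewrite (negPf hc) addn0 addn1.
Qed.

End Forms.

(** * Derivations of forms, and the spaces Omega *)

Section Derivations.
Variable R : realType.
Implicit Types (v w : form R) (f g : fn R) (c d : coord) (l : seq coord).

Definition framesum (V : nmodType) N (F : coord -> V) := F ct + (F cx + \sum_(i < N) F (cu i)).

Lemma derivationE N V lam w : fbnd N w ->
  derivation V lam w = (fun l => vact V (w l)) + framesum N (fun c => wedge (lam c) (contract c w)).
Proof.
move=> h; rewrite /derivation (@fsum_coord _ _ N) // => i hi.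
by rewrite (fbnd0 h) // wedge0r.
Qed.

Lemma contract_framesum c N (F : coord -> form R) :
  contract c (framesum N F) = framesum N (fun d => contract c (F d)).
Proof. by rewrite /framesum !contractD contract_sum. Qed.
Lemma framesum_form N (F : coord -> form R) l : framesum N F l = framesum N (fun d => F d l).
Proof. by rewrite /framesum !formD form_sum. Qed.
Lemma good_framesum N (F : coord -> form R) : (forall c, good (F c)) -> good (framesum N F).
Proof. by move=> h; apply: goodD => //; apply: goodD => //; apply: good_sum. Qed.

Lemma vact0 (V : vfield R) : vact V 0 = 0.
Proof.
rewrite /vact fsbig1 // => c _.
have -> : partial c (0 : fn R) = 0 by have [_] := has_partial_cst c (0 : R).
exact: mulr0.
Qed.

Lemma vactN (V : vfield R) f : (forall c, smooth (V c)) -> smooth f -> vact V (- f) = - vact V f.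
Proof.
move=> hV sf.
have e g : smooth g -> vact V g = fval (sact (fun c => lift (V c)) (lift g)).
  have eV : (fun c => fval (lift (V c))) = V by apply/funext => c; exact: liftK (hV c).
  by move=> sg; rewrite val_sact eV (liftK sg).
rewrite (e _ sf) (e _ (smoothN sf)).
rewrite (_ : lift (- f) = - lift f); first by rewrite raddfN.
apply: sfun_inj.
exact: etrans (liftK (smoothN sf)) (congr1 -%R (esym (liftK sf))).
Qed.

Definition good1 (lam : coord -> form R) := forall c, oneform (lam c) /\ good (lam c).

Lemma good_derivation V lam w : (forall c, smooth (V c)) -> good1 lam ->
  good w -> good (derivation V lam w).
Proof.
move=> hV hl gw; have [sw aw [N bw]] := gw; rewrite (derivationE _ _ bw).
apply: goodD; last first.
  apply: good_framesum => c; have [h1 h2] := hl c.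
  exact: good_wedge h1 h2 (@good_contract _ c _ gw).
split.
- by move=> l; exact: smooth_vact hV (sw l).
- by move=> l1 c d l2; rewrite aw; exact: vactN.
- by exists N => i l hi hl'; rewrite (bw i) // vact0.
Qed.

(** A derivation commutes with e_c _| up to the transpose of its matrix on the
   coframe. *)
Lemma contract_derivation N V lam w c : good1 lam -> falt w -> fbnd N w ->
  contract c (derivation V lam w) = derivation V lam (contract c w)
    + framesum N (fun d => fmul (lam d [:: c]) (contract d w)).
Proof.
move=> hl aw bw; rewrite (derivationE _ _ bw) (derivationE _ _ (@fbnd_contract _ _ c _ bw)).
rewrite contractD -[RHS]addrA; congr (_ + _).
rewrite contract_framesum.
have e d : contract c (wedge (lam d) (contract d w)) =
  wedge (lam d) (contract d (contract c w)) + fmul (lam d [:: c]) (contract d w).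
  rewrite contract_wedge; last by case: (hl d).
  by rewrite (falt_swap c d aw) wedgeNr opprK addrC.
rewrite /framesum !e addrACA; congr (_ + _); rewrite addrACA; congr (_ + _).
by rewrite -big_split; apply: eq_bigr => i _; exact: e.
Qed.

Lemma bideg_derivation a b r s V lam w : good1 lam ->
  (forall c d, is_u c != is_u d -> lam c [:: d] = 0) -> falt w -> (exists N, fbnd N w) ->
  bideg a b r s w -> bideg a b r s (derivation V lam w).
Proof.
move=> hl hk aw [N bw] gw l.
elim: l a b w aw bw gw => [|c l IH] a b w aw bw gw hl'.
  rewrite (derivationE _ _ bw) formD gw // vact0 add0r framesum_form /framesum.
  have z d : wedge (lam d) (contract d w) [::] = 0 by apply: wedge_nil; case: (hl d).
  by rewrite !z big1 ?addr0.
rewrite -[LHS]/(contract c (derivation V lam w) l) (contract_derivation _ _ hl aw bw) formD.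
rewrite (IH _ _ _ (@falt_contract _ c _ aw) (@fbnd_contract _ _ c _ bw) (@bideg_contract _ _ _ _ _ c _ gw)); last first.
  by move: hl'; rewrite /= !addnA.
rewrite add0r framesum_form.
have z d : fmul (lam d [:: c]) (contract d w) l = 0.
  have [e|ne] := eqVneq (is_u d) (is_u c); last by rewrite hk // /fmul mul0r.
  rewrite /fmul -[contract d w l]/(w (d :: l)) gw ?mulr0 //.
  by move: hl'; rewrite /= e.
by rewrite /framesum !z big1 ?addr0.
Qed.

Lemma framesum_gen (F : coord -> form R) N c l : (forall i, c = cu i -> (i < N)%N) ->
  framesum N (fun d => fmul (@gen R d [:: c]) (F d)) l = F c l.
Proof.
move=> hc; rewrite framesum_form /framesum /fmul.
case: c hc => [||i] hc.
- rewrite !gen1 eqxx mul1r mul0r add0r big1 ?addr0 // => i _; by rewrite gen1 mul0r.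
- rewrite !gen1 eqxx mul1r mul0r add0r big1 ?addr0 // => i _; by rewrite gen1 mul0r.
have hi := hc i erefl; rewrite !gen1 !mul0r !add0r (bigD1 (Ordinal hi)) //= gen1 eqxx mul1r big1 ?addr0 //.
move=> j; rewrite -val_eqE /= gen1 => hj; case: eqP => [[e]|]; rewrite ?mul0r //.
by rewrite e eqxx in hj.
Qed.

Lemma form_euler N w l : falt w -> fbnd N w ->
  framesum N (fun c => wedge (gen c) (contract c w)) l = w l *+ size l.
Proof.
elim: l w => [|c l IH] w aw bw.
  rewrite mulr0n framesum_form /framesum.
  have z d : wedge (@gen R d) (contract d w) [::] = 0 by apply: wedge_nil; exact: oneform_gen.
  by rewrite !z big1 ?addr0.
have [[i [ec hi]]|hc] := EM (exists i, c = cu i /\ (N <= i)%N).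
  rewrite ec.
  rewrite [RHS](_ : _ = 0); last by rewrite (bw i) ?mul0rn // inE eqxx.
  have z d : fbnd N (wedge (@gen R d) (contract d w)) \/ contract d w = 0.
    have [[j [-> hj]]|hd] := EM (exists i, d = cu i /\ (N <= i)%N).
      by right; exact: fbnd0 bw hj.
    left; apply: fbnd_wedge (oneform_gen R d) _ (@fbnd_contract _ _ d _ bw).
    move=> j l' hj hl'; rewrite /gen; case: eqP => // e.
    by move: hl'; rewrite e inE => /eqP ed; case: hd; exists j.
  have z' d : wedge (@gen R d) (contract d w) (cu i :: l) = 0.
    case: (z d) => [h|->]; last by rewrite wedge0r.
    by apply: (h i) => //; rewrite inE eqxx.
  by rewrite framesum_form /framesum !z' big1 ?addr0.
rewrite -[LHS]/(contract c (framesum N (fun d => wedge (gen d) (contract d w))) l).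
rewrite contract_framesum /= mulrS -[w (c :: l)]/(contract c w l) -IH; last 2 first.
  exact: falt_contract.
  exact: fbnd_contract.
have hc' i : c = cu i -> (i < N)%N.
  by move=> ec; rewrite ltnNge; apply/negP => hN; case: hc; exists i.
rewrite -(@framesum_gen (fun d => contract d w) N c l hc') -formD; congr (_ l).
have e d : contract c (wedge (gen d) (contract d w)) =
  fmul (gen d [:: c]) (contract d w) + wedge (gen d) (contract d (contract c w)).
  by rewrite contract_wedge; [rewrite (falt_swap c d aw) wedgeNr opprK|exact: oneform_gen].
rewrite /framesum !e [RHS]addrACA; congr (_ + _); rewrite [RHS]addrACA; congr (_ + _).
by rewrite -big_split; apply: eq_bigr => i _; exact: e.
Qed.

Lemma OmegaD r s v w : Omega r s v -> Omega r s w -> Omega r s (v + w).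
Proof.
move=> [N [f [lf [hf ->]]]] [M [g [lg [hg ->]]]].
exists (N + M)%N, (fun k => match fintype.split k with inl i => f i | inr j => g j end),
  (fun k => match fintype.split k with inl i => lf i | inr j => lg j end).
split; first by move=> k; case: fintype.split => i; [exact: hf|exact: hg].
rewrite big_split_ord; congr (_ + _); apply: eq_bigr => k _.
  by rewrite -[lshift M k]/(unsplit (inl k)) unsplitK.
by rewrite -[rshift N k]/(unsplit (inr k)) unsplitK.
Qed.

Lemma Omega0 r s : Omega r s (0 : form R).
Proof.
exists 0%N, (fun=> 0), (fun=> [::]); split; first by case.
by rewrite big_ord0.
Qed.

Lemma Omega_fmul r s f w : smooth f -> Omega r s w -> Omega r s (fmul f w).
Proof.
move=> sf [N [g [l [h ->]]]]; exists N, (fun k => f * g k), l; split.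
  move=> k; have [h1 h2 h3] := h k; split; [exact: smoothM sf h1|exact: h2|exact: h3].
have e (v1 v2 : form R) : fmul f (v1 + v2) = fmul f v1 + fmul f v2 := fmulDr f v1 v2.
rewrite (big_morph (fmul f) e (fmul0r f)); apply: eq_bigr => k _.
by rewrite fmulA.
Qed.

Lemma Omega_gen r s c w : Omega r s w -> Omega (r + ~~ is_u c) (s + is_u c) (wedge (gen c) w).
Proof.
move=> [N [g [l [h ->]]]]; exists N, g, (fun k => c :: l k); split.
  by move=> k; have [h1 <- <-] := h k; split => //=; rewrite addnC.
rewrite wedge_sumr; apply: eq_bigr => k _.
by rewrite wedge_fmulr //; exact: oneform_gen.
Qed.

Lemma Omega_sum r s I (q : seq I) (F : I -> form R) :
  (forall i, Omega r s (F i)) -> Omega r s (\sum_(i <- q) F i).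
Proof. by move=> h; elim/big_rec: _ => [|i x _ hx]; [exact: Omega0|exact: OmegaD]. Qed.

(** Euler's identity writes w through the products gen c /\ (e_c _| w), where
   e_c _| w has lower degree; induction on the degree gives the monomials. *)
Lemma good_Omega r s w : good w -> bideg 0 0 r s w -> Omega r s w.
Proof.
move e: (r + s)%N => m; elim: m r s w e => [|m IH] r s w e gw grw.
  have [er es] : r = 0%N /\ s = 0%N by lia.
  subst r s; exists 1%N, (fun=> w [::]), (fun=> [::]); split.
    by move=> _; split => //; have [] := gw.
  rewrite big_ord1 /=; apply/funext => -[|c l].
    by rewrite /fmul /one_form0 eqxx mulr1.
  rewrite /fmul mulr0 grw //=; case: (is_u c) => /=; lia.
have [sw aw [N bw]] := gw.
(* c has no slot left in w, or the contraction is of lower degree *)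
have H c : Omega r s (wedge (gen c) (contract c w)).
  case: (boolP ((is_u c && (s == 0%N)) || (~~ is_u c && (r == 0%N)))) => hc.
    rewrite (_ : contract c w = 0) ?wedge0r; first exact: Omega0.
    apply/funext => l; apply: grw => /=; case: (is_u c) hc => /=; rewrite ?orbF => /eqP e0; lia.
  have -> : r = (r - ~~ is_u c + ~~ is_u c)%N by case: (is_u c) hc => /=; lia.
  have -> : s = (s - is_u c + is_u c)%N by case: (is_u c) hc => /=; lia.
  apply: Omega_gen; apply: IH.
  - by case: (is_u c) hc => /=; lia.
  - exact: good_contract.
  - move=> l hl; apply: grw; move: hl hc => /=; case: (is_u c) => /=; lia.
have -> : w = fmul (cst (m.+1%:R^-1)) (framesum N (fun c => wedge (gen c) (contract c w))).
  apply/funext => l; rewrite /fmul form_euler //.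
  have [el|nl] := eqVneq (size l) m.+1; last first.
    rewrite grw ?mul0rn ?mulr0 //.
    have := count_predC is_u l; lia.
  apply/funext => p; rewrite el -[RHS]/(m.+1%:R^-1 * ((w l *+ m.+1) p)).
  have -> : (w l *+ m.+1) p = w l p *+ m.+1.
    by elim: (m.+1) => // k IHk; rewrite !mulrS -IHk.
  by rewrite -[X in _ * X]mulr_natl mulrA mulVf ?mul1r // pnatr_eq0.
apply: Omega_fmul; first exact: smooth_cst.
apply: OmegaD => //; apply: OmegaD => //; exact: Omega_sum.
Qed.

Lemma good_monomial cs : good (@monomial R cs) /\
  bideg 0 0 (count (predC is_u) cs) (count is_u cs) (@monomial R cs).
Proof.
elim: cs => [|c cs [IH1 IH2]].
  split; last first.
    by case=> [|d l] //=; case: (is_u d) => //=; lia.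
  split; first by move=> l; exact: smooth_nat.
    by move=> l1 c d l2; rewrite /= /one_form0; case: l1 => [|? ?] /=; rewrite oppr0.
  by exists 0 => i [|d l] //.
split; first by apply: good_wedge => //; [exact: oneform_gen|exact: good_gen].
have := bideg_wedge (kind1_gen R c) IH2.
by rewrite [X in bideg _ _ X _ _ -> _]addnC [X in bideg _ _ _ X _ -> _]addnC.
Qed.

Lemma Omega_good r s w : Omega r s w -> good w /\ bideg 0 0 r s w.
Proof.
move=> [N [f [l [h ->]]]]; split.
  apply: good_sum => k; have [sf _ _] := h k; apply: good_fmul => //.
  by case: (good_monomial (l k)).
apply: bideg_sum => k; have [sf <- <-] := h k; apply: bideg_fmul.
by case: (good_monomial (l k)).
Qed.

(** Transpositions of neighbours that bring the horizontal labels to the front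
   change at most the sign. *)
Lemma falt_sort w l : falt w ->
  w (seq.filter (predC is_u) l ++ seq.filter is_u l) = 0 -> w l = 0.
Proof.
elim: l w => [//|c l IH] w aw h.
apply: (IH (contract c w)); first exact: falt_contract.
move: h; rewrite /=; case: (is_u c) => //=.
set hs := [seq x <- l | _]; set us := [seq x <- l | _].
rewrite -[contract c w _]/(w ([::] ++ c :: hs ++ us)) -[w (hs ++ _)]/(w ([::] ++ hs ++ c :: us)).
move: ([::]) => l1; elim: hs l1 => [//|d hs IHh] l1 h.
rewrite /= aw -cat_rcons IHh ?oppr0 //.
by rewrite cat_rcons.
Qed.

Lemma filter_u l : exists s, seq.filter is_u l = map cu s.
Proof.
elim: l => [|[||i] l [s e]] /=; [by exists [::]|by exists s|by exists s|].
by exists (i :: s); rewrite e.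
Qed.

End Derivations.

(** * Lie derivatives as operators on arrays *)

Section Transport.
Variable R : realType.
Implicit Types (v w : form R) (f g : fn R) (c d : coord) (l : seq coord).

Lemma framesum_pick N (F : coord -> fn R) c : (forall i, c = cu i -> (i < N)%N) ->
  framesum N (fun d => F d * (c == d)%:R) = F c.
Proof.
move=> hc; rewrite /framesum; case: c hc => [||i] hc.
- by rewrite mulr1 mulr0 add0r big1 ?addr0 // => i _; exact: mulr0.
- by rewrite mulr1 mulr0 add0r big1 ?addr0 // => i _; exact: mulr0.
have hi := hc i erefl.
rewrite !mulr0 !add0r (bigD1 (Ordinal hi)) //= eqxx mulr1 big1 ?addr0 //.
move=> j; rewrite -val_eqE /= => hj; case: eqP => [[e]|_]; last exact: mulr0.
by rewrite e eqxx in hj.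
Qed.

Section Dfun.
Variable F : nat -> fn R.
Hypothesis sF : forall i, smooth (F i).

Lemma good1_dcoord : good1 (dcoord F).
Proof.
case=> [||i]; [by split; [exact: oneform_gen|exact: good_gen]|by split; [exact: oneform_gen|exact: good_gen]|].
split.
  apply: oneformD; last by apply: oneform_fmul; exact: oneform_gen.
  by apply: oneformD; [exact: oneform_gen|apply: oneform_fmul; exact: oneform_gen].
apply: goodD; last exact: good_fmul (smooth_coord _ _) (good_gen _ _).
by apply: goodD; [exact: good_gen|exact: good_fmul (sF i) (good_gen _ _)].
Qed.

Lemma dfunE N f : depends_upto N f ->
  dfun F f = framesum N.+1 (fun c => fmul (partial c f) (dcoord F c)).
Proof.
move=> hN; rewrite /dfun (@fsum_coord _ _ N.+1) // => i hi.
by rewrite (partial_depends_upto hN) // fmul0l.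
Qed.

Lemma dfun1 f : smooth f -> oneform (dfun F f) /\ good (dfun F f).
Proof.
move=> sf; have [N hN] := smooth_depends_upto sf; rewrite (dfunE hN).
have h c : oneform (fmul (partial c f) (dcoord F c)) /\ good (fmul (partial c f) (dcoord F c)).
  have [h1 h2] := good1_dcoord c.
  by split; [exact: oneform_fmul|exact: good_fmul (smooth_partial c sf) h2].
split; last by apply: good_framesum => c; case: (h c).
by apply: oneformD; [case: (h ct)|apply: oneformD; [case: (h cx)|apply: oneform_sum => i; case: (h (cu i))]].
Qed.

Lemma dfun_u f i : smooth f -> dfun F f [:: cu i] = partial (cu i) f.
Proof.
move=> sf; have [N hN] := smooth_depends_upto sf.
have hM : depends_upto (maxn N i) f by apply: depends_uptoW hN; exact: leq_maxl.
rewrite (dfunE hM) framesum_form -[RHS](@framesum_pick (maxn N i).+1 (fun c => partial c f) (cu i)).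
  rewrite /framesum /fmul; congr (_ + (_ + _)).
  apply: eq_bigr => k _; congr (_ * _).
  by rewrite /dcoord !formD /fmul !gen1 !mulr0 !addr0.
by move=> j [->]; rewrite ltnS leq_maxr.
Qed.

Lemma dfun_x f : smooth f -> dfun F f [:: cx] = vact (@Xf R) f.
Proof.
move=> sf; have [N hN] := smooth_depends_upto sf.
rewrite (dfunE hN) framesum_form /vact (@fsum_coord _ _ N.+1) /framesum; last first.
  by move=> i hi; rewrite (partial_depends_upto hN) // mulr0.
rewrite /fmul; congr (_ + (_ + _)).
- by rewrite -?[dcoord F ct]/(gen ct) gen1 mulr0 [RHS]mul0r.
- by rewrite -?[dcoord F cx]/(gen cx) gen1 mulr1 [RHS]mul1r.
apply: eq_bigr => k _; rewrite [RHS]mulrC; congr (_ * _).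
by rewrite /dcoord !formD /fmul !gen1 mulr0 mulr1 !add0r.
Qed.

Lemma dfun_t f : smooth f -> dfun F f [:: ct] =
  vact (fun c => match c with ct => 1 | cx => 0 | cu i => F i end) f.
Proof.
move=> sf; have [N hN] := smooth_depends_upto sf.
rewrite (dfunE hN) framesum_form /vact (@fsum_coord _ _ N.+1) /framesum; last first.
  by move=> i hi; rewrite (partial_depends_upto hN) // mulr0.
rewrite /fmul; congr (_ + (_ + _)).
- by rewrite -?[dcoord F ct]/(gen ct) gen1 mulr1 [RHS]mul1r.
- by rewrite -?[dcoord F cx]/(gen cx) gen1 mulr0 [RHS]mul0r.
apply: eq_bigr => k _; rewrite [RHS]mulrC; congr (_ * _).
by rewrite /dcoord !formD /fmul !gen1 mulr0 mulr1 addr0 add0r.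
Qed.

Lemma dfun_cst (a : R) : dfun F (cst a : fn R) = 0.
Proof.
have h : depends_upto 0 (cst a : fn R) by [].
rewrite (dfunE h); have z c : fmul (partial c (cst a : fn R)) (dcoord F c) = 0.
  by have [_ ->] := has_partial_cst c a; rewrite fmul0l.
by rewrite /framesum !z big1 ?addr0.
Qed.

Lemma dfun_coord c : dfun F (coordfn c : fn R) = dcoord F c.
Proof.
pose N := if c is cu i then i else 0.
have h : depends_upto N (coordfn c : fn R).
  by rewrite {}/N; case: c => [||i] p q // _ _ /(_ i (leqnn i)).
rewrite (dfunE h).
have z d : fmul (partial d (coordfn c : fn R)) (dcoord F d) = if c == d then dcoord F d else 0.
  have [_ ->] := has_partial_coord R d c; rewrite eq_sym; case: eqP => _.
    exact: fmul1l.
  exact: fmul0l.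
rewrite /framesum !z; under eq_bigr => i _ do rewrite z.
rewrite /N; case: (c) => [||i] /=.
- by rewrite add0r big1 ?addr0 // => i _.
- by rewrite add0r big1 ?addr0 // => i _.
rewrite !add0r (bigD1 ord_max) //= eqxx big1 ?addr0 // => k.
by rewrite -val_eqE /= => hk; case: eqP => // -[e]; rewrite -e eqxx in hk.
Qed.
End Dfun.

Variable K : sfun R.
Notation Kf := (fval K).

Lemma smooth_Xf c : smooth (@Xf R c).
Proof. by case: c => [||i]; [exact: smooth0|exact: (smooth_cst 1)|exact: smooth_coord]. Qed.

Lemma smooth_coframeK i : smooth (coframeK Kf i).
Proof. by rewrite /coframeK -val_sX_iter; exact: sfunP. Qed.

Lemma smooth_Tf c : smooth (Tf Kf c).
Proof. by case: c => [||i]; [exact: (smooth_cst 1)|exact: smooth0|exact: smooth_coframeK]. Qed.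

Definition lamX c : form R := if c is cu i then gen (cu i.+1) else 0.

(** X theta^i = theta^(i+1): the dt-component of d(X u_i), that is X^(i+1) K,
   is cancelled by that of L_X (X^i K dt), so that the Lie derivative along X
   has the same coframe matrix as D_x. *)
Lemma lie_coframe_X c : lie_coframe (coframeK Kf) (@Xf R) c = lamX c.
Proof.
have hs := smooth_coframeK.
case: c => [||i]; rewrite /lie_coframe /lamX.
- exact: (dfun_cst _ 0).
- exact: (dfun_cst _ 1).
rewrite [dfun _ (Xf ct)](dfun_cst _ 0) [dfun _ (Xf cx)](dfun_cst _ 1) !fmul0r !addr0.
rewrite [dfun _ _](dfun_coord _ (cu i.+1)) /dcoord.
rewrite -[coframeK Kf i.+1]/(vact (@Xf R) (coframeK Kf i)).
by rewrite -[Xf (cu i.+1)]/(coordfn (cu i.+2)) [_ + fmul (coordfn _) _ - _]addrAC addrK addrK.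
Qed.

Lemma lieX_Dx : lieX Kf = @Dx R.
Proof.
apply/funext => w; rewrite /lieX /Dx /lie; congr derivation.
by apply/funext => c; exact: lie_coframe_X.
Qed.

Lemma good1_lamX : good1 lamX.
Proof. by case=> [||i]; split => //; [exact: good0|exact: good0|exact: oneform_gen|exact: good_gen]. Qed.

Lemma DxE w : Dx w = derivation (@Xf R) lamX w. Proof. by []. Qed.
Lemma LTE F w : lie F (Tf Kf) w = derivation (Tf Kf) (lie_coframe F (Tf Kf)) w. Proof. by []. Qed.

Section LieT.
Variable F : nat -> fn R.
Hypothesis sF : forall i, smooth (F i).

(** T theta^k in the coframe: its theta-components are those of d_V (X^k K)
   whatever F is ([lamT_u]); the dx-component vanishes since T u_(k+1) = X (T
   u_k) ([lamT_x]), and so does the dt-component on the equation manifold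
   ([lamT_t]). *)
Definition lamT := lie_coframe F (Tf Kf).

Lemma lamTE i : lamT (cu i) =
  dfun F (coframeK Kf i) - fmul (vact (Tf Kf) (F i)) (gen ct) - fmul (coframeK Kf i.+1) (gen cx).
Proof.
rewrite /lamT /lie_coframe [dfun _ (Tf _ ct)](dfun_cst _ 1) [dfun _ (Tf _ cx)](dfun_cst _ 0).
by rewrite !fmul0r !addr0.
Qed.

Lemma good1_lamT : good1 lamT.
Proof.
case=> [||i].
- by rewrite /lamT /lie_coframe [dfun _ _](dfun_cst _ 1); split; [exact: oneform0|exact: good0].
- by rewrite /lamT /lie_coframe [dfun _ _](dfun_cst _ 0); split; [exact: oneform0|exact: good0].
have [h1 h2] := dfun1 sF (smooth_coframeK i); rewrite lamTE; split.
  by apply: oneformD; [apply: oneformD => //|]; apply: oneformN; apply: oneform_fmul; exact: oneform_gen.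
apply: goodD; last by apply: goodN; exact: good_fmul (smooth_coframeK i.+1) (good_gen _ _).
apply: goodD => //; apply: goodN; apply: good_fmul (good_gen _ _).
exact: smooth_vact smooth_Tf (sF i).
Qed.

Lemma lamT_u k i : lamT (cu k) [:: cu i] = partial (cu i) (coframeK Kf k).
Proof.
rewrite lamTE !formB /fmul !gen1 !mulr0 !subr0 dfun_u //; exact: smooth_coframeK.
Qed.

Lemma lamT_x c : lamT c [:: cx] = 0.
Proof.
case: c => [||i].
- by rewrite /lamT /lie_coframe [dfun _ _](dfun_cst _ 1).
- by rewrite /lamT /lie_coframe [dfun _ _](dfun_cst _ 0).
rewrite lamTE !formB /fmul !gen1 mulr0 mulr1 subr0 dfun_x //; last exact: smooth_coframeK.
exact: subrr.
Qed.

Lemma lamT_nu d c : ~~ is_u d -> lamT d [:: c] = 0.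
Proof.
case: d => [||//] _.
- by rewrite /lamT /lie_coframe [dfun _ _](dfun_cst _ 1).
- by rewrite /lamT /lie_coframe [dfun _ _](dfun_cst _ 0).
Qed.
End LieT.

Lemma lamT_t c : lamT (coframeK Kf) c [:: ct] = 0.
Proof.
have sF := smooth_coframeK.
case: c => [||i].
- by rewrite /lamT /lie_coframe [dfun _ _](dfun_cst _ 1).
- by rewrite /lamT /lie_coframe [dfun _ _](dfun_cst _ 0).
rewrite lamTE !formB /fmul !gen1 mulr0 mulr1 subr0 dfun_t //.
exact: subrr.
Qed.

(** The purely vertical part of a form. *)
Definition vert w : arr (sfun R) := fun s => lift (w (map cu s)).
Lemma fval_vert w s : fsmooth w -> fval (vert w s) = w (map cu s).
Proof. by move=> h; exact: liftK. Qed.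

Lemma liftD f g : smooth f -> smooth g -> lift (f + g) = lift f + lift g.
Proof.
move=> sf sg; apply: sfun_inj; apply: (etrans (liftK (smoothD sf sg))).
exact: (f_equal2 (fun a b : fn R => a + b) (esym (liftK sf)) (esym (liftK sg))).
Qed.
Lemma lift0 : lift (0 : fn R) = 0.
Proof. by apply: sfun_inj; rewrite liftK //; exact: smooth0. Qed.
Lemma liftN f : smooth f -> lift (- f) = - lift f.
Proof.
move=> sf; apply: sfun_inj.
exact: etrans (liftK (smoothN sf)) (congr1 -%R (esym (liftK sf))).
Qed.
Lemma liftM f g : smooth f -> smooth g -> lift (f * g) = lift f * lift g.
Proof.
move=> sf sg; apply: sfun_inj; apply: (etrans (liftK (smoothM sf sg))).
exact: (f_equal2 (fun a b : fn R => a * b) (esym (liftK sf)) (esym (liftK sg))).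
Qed.

Lemma vertD v w : fsmooth v -> fsmooth w -> vert (v + w) = vert v + vert w.
Proof. by move=> sv sw; apply/funext => s; exact: liftD (sv _) (sw _). Qed.
Lemma vertN v : fsmooth v -> vert (- v) = - vert v.
Proof. by move=> sv; apply/funext => s; exact: liftN (sv _). Qed.
Lemma vert0 : vert 0 = 0.
Proof. by apply/funext => s; exact: lift0. Qed.
Lemma vert_fmul f w : smooth f -> fsmooth w -> vert (fmul f w) = sc (lift f) (vert w).
Proof. by move=> sf sw; apply/funext => s; exact: liftM sf (sw _). Qed.
Lemma vert_sum I (r : seq I) (F : I -> form R) : (forall i, good (F i)) ->
  vert (\sum_(i <- r) F i) = \sum_(i <- r) vert (F i).
Proof.
move=> h; elim: r => [|i r IH]; first by rewrite !big_nil vert0.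
by rewrite !big_cons vertD ?IH //; [case: (h i)|case: (good_sum r h)].
Qed.

Lemma vert_wedge v w : oneform v -> fsmooth v -> fsmooth w ->
  vert (wedge v w) = wedge1 (fun j => lift (v [:: cu j])) (vert w).
Proof.
move=> hv sv sw; apply/funext => s; elim: s w sw => [|j s IH] w sw.
  by rewrite -[LHS]/(lift (wedge v w [::])) wedge_nil // lift0.
rewrite -[LHS]/(vert (contract (cu j) (wedge v w)) s) contract_wedge //.
have s1 : fsmooth (fmul (v [:: cu j]) w) by move=> l; exact: smoothM (sv _) (sw _).
have s2 : fsmooth (wedge v (contract (cu j) w)) := fsmooth_wedge hv sv (@fsmooth_contract _ (cu j) _ sw).
have s3 : fsmooth (- wedge v (contract (cu j) w)) by move=> l; exact: smoothN (s2 l).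
rewrite (vertD s1 s3) (vertN s2) (vert_fmul (sv _) sw) -[RHS]/(ctr j (wedge1 _ (vert w)) s) ctr_wedge1 !arrE.
by rewrite (IH _ (@fsmooth_contract _ (cu j) _ sw)).
Qed.

Lemma vert_gen_wedge i w : fsmooth w -> vert (wedge (gen (cu i)) w) = wtheta i (vert w).
Proof.
move=> sw; have [sg _ _] := good_gen R (cu i).
rewrite (vert_wedge (oneform_gen R (cu i)) sg sw); congr (wedge1 _ _); apply/funext => j.
rewrite gen1 /delta (_ : (cu j == cu i) = (j == i)); last by apply/eqP/eqP => [[]|->].
apply: sfun_inj; rewrite val_nat; exact: liftK (smooth_nat R _).
Qed.

Lemma vert_horizontal_wedge c w : ~~ is_u c -> fsmooth w -> vert (wedge (gen c) w) = 0.
Proof.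
move=> hc sw; have [sg _ _] := good_gen R c.
rewrite (vert_wedge (oneform_gen R c) sg sw) -[RHS](wedge1_0l (vert w)); congr (wedge1 _ _).
apply/funext => j; rewrite gen1.
by case: eqP => [e|_]; [rewrite -e in hc|exact: lift0].
Qed.

Lemma supp_vert N w : fbnd N w -> supp N (vert w).
Proof.
move=> h i s hi si; rewrite /vert (h i) ?lift0 //.
by apply/mapP; exists i.
Qed.

Lemma alt_vert w : fsmooth w -> falt w -> alt (vert w).
Proof.
by move=> sw h s1 i j s2; rewrite /vert !map_cat /= h liftN.
Qed.

Definition aX : {additive sfun R -> sfun R} := @sX R.
Definition aT : {additive sfun R -> sfun R} := sT K.
Definition aD (i : nat) : {additive sfun R -> sfun R} := @sD R i.

Lemma lift_vactX f : smooth f -> lift (vact (@Xf R) f) = aX (lift f).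
Proof.
move=> sf; apply: sfun_inj; rewrite liftK; last exact: smooth_vact smooth_Xf sf.
by rewrite val_sX (liftK sf).
Qed.
Lemma lift_vactT f : smooth f -> lift (vact (Tf Kf) f) = aT (lift f).
Proof.
move=> sf; apply: sfun_inj; rewrite liftK; last exact: smooth_vact smooth_Tf sf.
by rewrite val_sT (liftK sf).
Qed.

Lemma good_Dx w : good w -> good (Dx w).
Proof. exact: good_derivation smooth_Xf good1_lamX. Qed.

Lemma vert_Dx w : good w -> vert (Dx w) = arrX aX (vert w).
Proof.
move=> gw; apply/funext => s; elim: s w gw => [|j s IH] w gw.
  have [sw aw [N bw]] := gw; rewrite -[LHS]/(lift (Dx w [::])) DxE (derivationE _ _ bw) formD framesum_form.
  have z c : wedge (lamX c) (contract c w) [::] = 0.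
    by apply: wedge_nil; case: (good1_lamX c).
  by rewrite /framesum !z big1 // !addr0 lift_vactX.
have [sw aw [N bw]] := gw.
have gc := good_contract (cu j) gw.
have bw' : fbnd (N + j) w by apply: fbnd_le bw; lia.
rewrite -[LHS]/(vert (contract (cu j) (Dx w)) s) DxE (contract_derivation _ (cu j) good1_lamX aw bw').
have e : framesum (N + j) (fun d => fmul (lamX d [:: cu j]) (contract d w)) =
   if j is k.+1 then contract (cu k) w else 0.
  rewrite /framesum /= !fmul0l !add0r; case: j {gc bw'} => [|j].
    by rewrite big1 // => k _; rewrite gen1 fmul0l.
  have hj : (j < N + j.+1)%N by lia.
  rewrite (bigD1 (Ordinal hj)) //= gen1 eqxx fmul1l big1 ?addr0 // => k.
  rewrite -val_eqE /= gen1 => hk; case: eqP => [[e]|_]; last exact: fmul0l.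
  by rewrite -e eqxx in hk.
rewrite e vertD; first last.
- by case: (j) => [|k] l; [exact: smooth0|exact: sw].
- by case: (good_Dx gc).
rewrite arrE -DxE IH // -[RHS]/(ctr j (arrX aX (vert w)) s) ctrX arrE; congr (_ + _).
by case: (j) => [|k] //; rewrite /vert lift0.
Qed.

Section TransportT.
Variable F : nat -> fn R.
Hypothesis sF : forall i, smooth (F i).
Notation LT := (lie F (Tf Kf)).

Lemma good_LT w : good w -> good (LT w).
Proof. exact: good_derivation smooth_Tf (good1_lamT sF). Qed.

(** Only the theta-components of T theta^k matter here, so the result holds on
   the equation manifold and on E alike. *)
Lemma vert_LT P w : good w -> fbnd P w -> vert (LT w) = arrT aX aT aD K P (vert w).
Proof.
move=> gw bw; apply/funext => s; elim: s w gw bw => [|j s IH] w gw bw.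
  have [sw aw _] := gw; rewrite -[LHS]/(lift (LT w [::])) LTE -/(lamT F) (derivationE _ _ bw) formD framesum_form.
  have z c : wedge (lamT F c) (contract c w) [::] = 0.
    by apply: wedge_nil; case: (good1_lamT sF c).
  by rewrite /framesum !z big1 // !addr0 lift_vactT.
have [sw aw _] := gw.
have gc := good_contract (cu j) gw.
rewrite -[LHS]/(vert (contract (cu j) (LT w)) s) LTE -/(lamT F) (contract_derivation _ (cu j) (good1_lamT sF) aw bw).
have e : framesum P (fun d => fmul (lamT F d [:: cu j]) (contract d w)) =
   \sum_(k < P) fmul (partial (cu j) (coframeK Kf k)) (contract (cu k) w).
  rewrite /framesum !lamT_nu // !fmul0l !add0r; apply: eq_bigr => k _.
  by rewrite lamT_u.
have gk k : good (fmul (partial (cu j) (coframeK Kf k)) (contract (cu k) w)).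
  exact: good_fmul (smooth_partial _ (smooth_coframeK k)) (good_contract _ gw).
rewrite e vertD; [|by case: (good_LT gc)|by case: (good_sum (index_enum _) (fun k : 'I_P => gk k))].
rewrite arrE -LTE IH //; last exact: fbnd_contract.
rewrite -[RHS]/(ctr j (arrT aX aT aD K P (vert w)) s) ctrT arrE; congr (_ + _).
rewrite (vert_sum _ (fun k : 'I_P => gk k)) /matrow; congr (_ s); apply: eq_bigr => k _.
rewrite vert_fmul; [|exact: smooth_partial (smooth_coframeK k)|exact: fsmooth_contract].
congr (sc _ _); apply: sfun_inj; rewrite liftK; last exact: smooth_partial (smooth_coframeK k).
by rewrite /DXK /aD /= /sD val_sd val_sX_iter.
Qed.

Lemma contract_LT c w : good w -> (forall d, lamT F d [:: c] = 0) ->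
  contract c (LT w) = LT (contract c w).
Proof.
move=> [sw aw [N bw]] h; rewrite !LTE -/(lamT F) (contract_derivation _ c (good1_lamT sF) aw bw).
by rewrite /framesum !h !fmul0l big1 ?addr0 // => i _; rewrite h fmul0l.
Qed.
End TransportT.

Lemma contract_Dx c w : good w -> ~~ is_u c -> contract c (Dx w) = Dx (contract c w).
Proof.
move=> [sw aw [N bw]] h; rewrite !DxE (contract_derivation _ c good1_lamX aw bw).
have z d : lamX d [:: c] = 0.
  by case: d => [||i] //=; rewrite gen1; case: eqP => // e; rewrite e in h.
rewrite /framesum !z !fmul0l big1 ?addr0 // => i _.
by rewrite z fmul0l.
Qed.

Lemma bideg_Dx a b r s w : good w -> bideg a b r s w -> bideg a b r s (Dx w).
Proof.
move=> [sw aw bw]; apply: bideg_derivation => //; first exact: good1_lamX.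
move=> [||i] [||j] //=; rewrite gen1 //.
Qed.

Lemma bideg_LT a b r s w : good w -> bideg a b r s w ->
  bideg a b r s (lie (coframeK Kf) (Tf Kf) w).
Proof.
have sF := smooth_coframeK.
move=> [sw aw bw]; apply: bideg_derivation => //; first exact: good1_lamT.
move=> c d; case: d => [||j] hcd.
- exact: lamT_t.
- exact: lamT_x.
- by apply: lamT_nu; move: hcd; case: (is_u c).
Qed.

End Transport.

(** * Variational operators on arrays *)

Section Operators.
Variable R : realType.
Implicit Types (v w : form R) (f g : fn R) (c d : coord) (l : seq coord).
Local Notation A := (sfun R).
Local Notation X := (@aX R).
Local Notation D := (@aD R).

Lemma aXM (f g : A) : X (f * g) = X f * g + f * X g. Proof. exact: sXM. Qed.
Lemma aDM i (f g : A) : D i (f * g) = D i f * g + f * D i g. Proof. exact: sdM. Qed.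
Lemma aDD i j (f : A) : D i (D j f) = D j (D i f). Proof. exact: sdC. Qed.
Lemma aDX i (f : A) : D i (X f) = X (D i f) + (if i is j.+1 then D j f else 0).
Proof. exact: sDX. Qed.

Lemma derivationN V lam w : (forall c, smooth (V c)) -> good w ->
  derivation V lam (- w) = - derivation V lam w.
Proof.
move=> hV gw; have [sw aw [N bw]] := gw.
have bw' : fbnd N (- w) by move=> i l hi hl; rewrite formN (bw i) // oppr0.
rewrite (derivationE _ _ bw) (derivationE _ _ bw') opprD; congr (_ + _).
  by apply/funext => l; exact: vactN hV (sw l).
rewrite /framesum !contractN !wedgeNr !opprD; congr (_ + (_ + _)).
by rewrite -sumrN; apply: eq_bigr => i _; rewrite contractN wedgeNr.
Qed.

Definition oppDx v : form R := - Dx v.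

Lemma good_oppDx w : good w -> good (oppDx w).
Proof. by move=> gw; apply: goodN; exact: good_Dx. Qed.
Lemma good_iter k w : good w -> good (iter k oppDx w).
Proof. by move=> gw; elim: k => //= k IH; exact: good_oppDx. Qed.
Lemma oppDxN w : good w -> oppDx (- w) = - oppDx w.
Proof. by move=> gw; rewrite /oppDx !DxE (derivationN _ (@smooth_Xf R) gw). Qed.
Lemma iter_oppDxN k w : good w -> iter k oppDx (- w) = - iter k oppDx w.
Proof. by move=> gw; elim: k => //= k ->; rewrite oppDxN //; exact: good_iter. Qed.
Lemma contract_iter k c w : good w -> ~~ is_u c ->
  contract c (iter k oppDx w) = iter k oppDx (contract c w).
Proof.
move=> gw hc; elim: k => //= k IH.
by rewrite {1}/oppDx contractN (contract_Dx (good_iter k gw) hc) IH.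
Qed.
Lemma vert_iter k w : good w -> vert (iter k oppDx w) = iter k (oppX X) (vert w).
Proof.
move=> gw; elim: k => //= k IH; rewrite {1}/oppDx vertN.
  by rewrite (vert_Dx (good_iter k gw)) IH.
by case: (good_Dx (good_iter k gw)).
Qed.
Lemma bideg_iter a b r s k w : good w -> bideg a b r s w -> bideg a b r s (iter k oppDx w).
Proof.
by move=> gw h; elim: k => //= k IH; apply: bidegN; apply: bideg_Dx => //; exact: good_iter.
Qed.
Lemma eqN0 (x : R) : x = - x -> x = 0.
Proof. by move=> h; lra. Qed.

Lemma iter_oppDx0 k : iter k oppDx 0 = 0.
Proof.
have := iter_oppDxN k (good0 R); rewrite oppr0 => h.
apply/funext => l; apply/funext => p.
apply: eqN0; exact: (congr1 (fun v : form R => v l p) h).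
Qed.

(** The operator of [eulerop] on forms; I_E multiplies it by theta^0 / s. *)
Definition eulerform w : form R := \sum_(i \in [set: nat]) iter i oppDx (contract (cu i) w).

Lemma eulerformE N w : fbnd N w -> eulerform w = \sum_(i < N) iter i oppDx (contract (cu i) w).
Proof. by move=> bw; apply: fsum_nat => i hi; rewrite (fbnd0 bw hi) iter_oppDx0. Qed.

Lemma IEE s w : IE s w = (s%:R^-1 : R) *: wedge (gen (cu 0)) (eulerform w).
Proof. by []. Qed.

Lemma good_eulerform w : good w -> good (eulerform w).
Proof.
move=> gw; have [_ _ [N bw]] := gw; rewrite (eulerformE bw); apply: good_sum => i.
by apply: good_iter; exact: good_contract.
Qed.

Lemma contract_eulerform c w : good w -> ~~ is_u c -> contract c (eulerform w) = - eulerform (contract c w).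
Proof.
move=> gw hc; have [_ aw [N bw]] := gw.
rewrite (eulerformE bw) (eulerformE (fbnd_contract c bw)) contract_sum -sumrN; apply: eq_bigr => i _.
rewrite (contract_iter _ (good_contract _ gw) hc) (falt_swap c (cu i) aw) iter_oppDxN //.
by apply: good_contract; exact: good_contract.
Qed.

Lemma vert_eulerform N w : good w -> fbnd N w -> vert (eulerform w) = eulerop X N (vert w).
Proof.
move=> gw bw; rewrite (eulerformE bw) vert_sum => [|i].
  by apply: eq_bigr => i _; rewrite (vert_iter _ (good_contract _ gw)).
by apply: good_iter; exact: good_contract.
Qed.

Lemma bideg_eulerform a b r s w : good w -> bideg a b r s w -> bideg a b.+1 r s (eulerform w).
Proof.
move=> gw h; have [_ aw [N bw]] := gw; rewrite (eulerformE bw); apply: bideg_sum => i.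
apply: bideg_iter; first exact: good_contract.
by have := bideg_contract (c := cu i) h; rewrite /= addn0 addn1.
Qed.

Lemma eulerform0 : eulerform 0 = 0.
Proof. by rewrite (@eulerformE 0) // big_ord0. Qed.

Lemma contract_horizontal a b s c w : bideg a b a s w -> ~~ is_u c -> contract c w = 0.
Proof. by move=> h hc; apply/funext => l; apply: h; rewrite /= hc; lia. Qed.

Lemma form_eq0 a b r s w : good w -> bideg a b r s w ->
  (forall hs us, all (predC is_u) hs -> (a + size hs = r)%N -> (b + size us = s)%N ->
    w (hs ++ map cu us) = 0) -> w = 0.
Proof.
move=> [_ aw _] gw h; apply/funext => l.
have [/andP[/eqP h1 /eqP h2]|] := boolP ((a + count (predC is_u) l == r) && (b + count is_u l == s))%N; last exact: gw.
apply: falt_sort => //; have [us eus] := filter_u l; rewrite eus; apply: h.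
- exact: filter_all.
- by rewrite size_filter.
- by rewrite -(size_map cu) -eus size_filter.
Qed.

Lemma vert_eq0 w us : good w -> vert w us = 0 -> w (map cu us) = 0.
Proof. by move=> [sw _ _] h; rewrite -(fval_vert us sw) h. Qed.

Definition fpartial i w : form R := fun s => partial (cu i) (w s).

(** A bound on the order of the coefficients, which makes the sum in d_V
   finite; [fbnd] only bounds the theta^i that occur. *)
Definition fdep N w := forall l, depends_upto N (w l).

Lemma good_fpartial i w : good w -> good (fpartial i w).
Proof.
move=> [sw aw [N bw]]; split.
- by move=> l; exact: smooth_partial (sw l).
- move=> l1 c d l2; rewrite /fpartial aw.
  by have [_ ->] := has_partialN (@smooth_has_partial _ _ (cu i) (sw (l1 ++ d :: c :: l2))).
- exists N => j l hj hl; rewrite /fpartial (bw j) //.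
  by have [_ ->] := has_partial_cst (cu i) (0 : R).
Qed.

Lemma dVE N w : fdep N w -> dV w = \sum_(i < N.+1) wedge (gen (cu i)) (fpartial i w).
Proof.
move=> h; apply: fsum_nat => i hi.
rewrite (_ : (fun s => _) = 0) ?wedge0r //.
by apply/funext => l; exact: partial_depends_upto (h l) hi.
Qed.

Lemma good_dV N w : fdep N w -> good w -> good (dV w).
Proof.
move=> h gw; rewrite (dVE h); apply: good_sum => i.
exact: good_gen_wedge _ (good_fpartial i gw).
Qed.

Lemma fdep_contract N c w : fdep N w -> fdep N (contract c w).
Proof. by move=> h l; exact: h. Qed.

Lemma contract_dV N c w : fdep N w -> contract c (dV w) =
   (if c is cu i then fpartial i w else 0) - dV (contract c w).
Proof.
move=> h; pose N' := if c is cu i then maxn N i else N.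
have h' : fdep N' w.
  by move=> l; apply: depends_uptoW (h l); rewrite /N'; case: (c) => // i; exact: leq_maxl.
rewrite (dVE h') (dVE (fdep_contract c h')) contract_sum.
under eq_bigr => i _ do rewrite (contract_wedge _ _ (oneform_gen _ _)).
rewrite sumrB; congr (_ - _); rewrite /N'; case: (c) => [||j].
- by rewrite big1 // => i _; rewrite gen1 fmul0l.
- by rewrite big1 // => i _; rewrite gen1 fmul0l.
have hj : (j < (maxn N j).+1)%N by rewrite ltnS leq_maxr.
rewrite (bigD1 (Ordinal hj)) //= gen1 eqxx fmul1l big1 ?addr0 // => k.
rewrite -val_eqE /= gen1 => hk; case: eqP => [[e]|_]; last exact: fmul0l.
by rewrite -e eqxx in hk.
Qed.

Lemma vert_dV N w : fdep N w -> good w -> vert (dV w) = vdiff D (vert w).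
Proof.
move=> h gw; apply/funext => s; elim: s w h gw => [|j s IH] w h gw.
  rewrite -[LHS]/(lift (dV w [::])) (dVE h) form_sum big1 ?lift0 // => i _.
  by rewrite wedge_nil //; exact: oneform_gen.
have gc := good_contract (cu j) gw; have hc := @fdep_contract _ (cu j) _ h.
rewrite -[LHS]/(vert (contract (cu j) (dV w)) s) (contract_dV _ h).
have [s1 _ _] := good_dV hc gc; have [s2 _ _] := good_fpartial j gw.
have s3 : fsmooth (- dV (contract (cu j) w)) by move=> l; exact: smoothN (s1 l).
have [sw _ _] := gw.
rewrite (vertD s2 s3) (vertN s1) arrE (IH _ hc gc) -[RHS]/(ctr j (vdiff D (vert w)) s) ctr_vdiff arrE.
congr (_ - _); apply: sfun_inj; apply: (etrans (fval_vert s s2)); apply: esym.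
exact: etrans (val_sd _ _) (congr1 (partial (cu j)) (fval_vert s sw)).
Qed.

Lemma bideg_dV N a b r s w : fdep N w -> bideg a b r s w -> bideg a b r s.+1 (dV w).
Proof.
move=> h gw; rewrite (dVE h); apply: bideg_sum => i.
have gp : bideg a b r s (fpartial i w).
  by move=> l hl; rewrite /fpartial (gw l hl); have [_ ->] := has_partial_cst (cu i) (0 : R).
exact: bideg_gen_u gp.
Qed.

Lemma fdepD N v w : fdep N v -> fdep N w -> fdep N (v + w).
Proof.
move=> h1 h2 l p q ht hx hu; rewrite formD -[LHS]/(v l p + w l p) (h1 l p q) // (h2 l p q) //.
Qed.
Lemma fdep_fmul N f w : depends_upto N f -> fdep N w -> fdep N (fmul f w).
Proof.
move=> h1 h2 l p q ht hx hu; rewrite /fmul -[LHS]/(f p * w l p) (h1 p q) // (h2 l p q) //.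
Qed.
Lemma fdep_le M N w : (M <= N)%N -> fdep M w -> fdep N w.
Proof. by move=> MN h l; exact: depends_uptoW MN (h l). Qed.
Lemma depends_upto_nat m : depends_upto 0 (m%:R : fn R).
Proof.
suff -> : (m%:R : fn R) = cst (m%:R : R) by [].
by elim: m => // m IH; rewrite !mulrS IH.
Qed.
Lemma fdep_wedge N v w : oneform v -> fdep N v -> fdep N w -> fdep N (wedge v w).
Proof.
move=> hv dv_ dw l; elim: l w dw => [|c l IH] w dw; first by rewrite wedge_nil.
rewrite -[wedge _ _ _]/(contract c (wedge v w) l) contract_wedge // formB /fmul.
move=> p q ht hx hu; rewrite -[LHS]/(v [:: c] p * w l p - wedge v (contract c w) l p).
by rewrite (dv_ _ p q) // (dw _ p q) // (IH _ (@fdep_contract _ c _ dw) p q).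
Qed.

Lemma fdep_monomial cs : fdep 0 (@monomial R cs).
Proof.
elim: cs => [|c cs IH]; first by move=> l; exact: depends_upto_nat.
apply: fdep_wedge => //; first exact: oneform_gen.
by move=> l; exact: depends_upto_nat.
Qed.

Lemma Omega_fdep r s w : Omega r s w -> exists N, fdep N w.
Proof.
move=> [N [f [l [h ->]]]].
elim/big_rec: _ => [|k v _ [M hM]]; first by exists 0.
have [sf _ _] := h k; have [M' hM'] := smooth_depends_upto sf.
exists (maxn M M'); apply: fdepD; last exact: fdep_le (leq_maxl _ _) hM.
apply: fdep_fmul; first exact: depends_uptoW (leq_maxr _ _) hM'.
by apply: fdep_le (fdep_monomial _).
Qed.

Section Theta.
Variable r : nat -> fn R.
Hypothesis dr : diffop r.

Lemma diffop_bound : exists N, forall i, (N <= i)%N -> r i = 0.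
Proof. by case: dr => _. Qed.

Lemma op_thetaE N : (forall i, (N <= i)%N -> r i = 0) ->
  op_theta r = \sum_(i < N) fmul (r i) (gen (cu i)).
Proof. by move=> h; apply: fsum_nat => i hi; rewrite h // fmul0l. Qed.

Lemma op_theta_u i : op_theta r [:: cu i] = r i.
Proof.
have [N0 h0] := diffop_bound.
have h j : (maxn N0 i.+1 <= j)%N -> r j = 0 by rewrite geq_max => /andP[/h0].
have hi : (i < maxn N0 i.+1)%N by rewrite leq_max leqnn orbT.
rewrite (op_thetaE h) form_sum (bigD1 (Ordinal hi)) //= /fmul gen1 eqxx mulr1 big1 ?addr0 //.
move=> k; rewrite -val_eqE /= gen1 => hk; case: eqP => [[e]|_]; last exact: mulr0.
by rewrite -e eqxx in hk.
Qed.

Lemma op_theta_facts : [/\ oneform (op_theta r), good (op_theta r) & bideg 0 0 0 1 (op_theta r)].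
Proof.
have [N h] := diffop_bound; rewrite (op_thetaE h); split.
- by apply: oneform_sum => i; apply: oneform_fmul; exact: oneform_gen.
- by apply: good_sum => i; apply: good_fmul (good_gen _ _); case: dr => + _; apply.
- apply: bideg_sum => i; apply: bideg_fmul => l hl.
  by rewrite /gen; case: eqP => // e; rewrite e in hl.
Qed.

Lemma fbnd_theta N : (forall i, (N <= i)%N -> r i = 0) -> fbnd N (op_theta r).
Proof.
move=> h i l hi hl; have [h1 _ _] := op_theta_facts.
case: l hl => [//|c [|d l]] hl; last exact: h1.
by move: hl; rewrite inE => /eqP <-; rewrite op_theta_u h.
Qed.

(** The operator \sum_i r_i X^i as the 1-form \sum_i r_i theta^i. *)
Definition oparr := vert (op_theta r).
Lemma oparr1 i : oparr [:: i] = lift (r i).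
Proof. by rewrite /oparr /vert /= op_theta_u. Qed.
Lemma oparr_arity s : size s != 1%N -> oparr s = 0.
Proof.
move=> hs; have [h1 _ _] := op_theta_facts.
by rewrite /oparr /vert h1 ?lift0 // size_map.
Qed.
Lemma supp_oparr N : (forall i, (N <= i)%N -> r i = 0) -> supp N oparr.
Proof. by move=> h; apply: supp_vert; exact: fbnd_theta. Qed.

Lemma oparr_arr0 : oparr = 0 -> r = 0.
Proof.
move=> h; apply/funext => i; have := oparr1 i; rewrite h => e.
by case: dr => sr _; rewrite -(liftK (sr i)) -e.
Qed.
End Theta.

(** Contraction with the evolutionary field \sum_k X^k(F) d/du_k. On 1-forms
   it is the application of the operator to F. *)
Definition evol N (F : A) (a : arr A) : A := \sum_(k < N) a [:: k : nat] * iter k (@sX R) F.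

Lemma evol_zmod N F : zmod_morphism (evol N F).
Proof. by move=> a b; rewrite /evol -sumrB; apply: eq_bigr => k _; rewrite arrB mulrBl. Qed.
HB.instance Definition _ N F := GRing.isZmodMorphism.Build (arr A) A (evol N F) (evol_zmod N F).

Lemma evol_widen N N' F a : (N <= N')%N -> supp N a -> evol N' F a = evol N F a.
Proof.
move=> hN h; rewrite /evol (big_ord_widen N' (fun k => a [:: k] * iter k (@sX R) F) hN).
rewrite [RHS]big_mkcond /=; apply: eq_bigr => k _; case: ifP => // /negbT.
by rewrite -leqNgt => hk; rewrite (h k) ?mul0r // inE.
Qed.

(** X commutes with evolutionary fields. *)
Lemma evol_oppX N F a : supp N a -> a [::] = 0 -> evol N.+1 F (oppX X a) = - X (evol N F a).
Proof.
move=> h h0; rewrite -(evol_widen F (leqnSn N) h) /evol raddf_sum -sumrN /=.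
have e (k : 'I_N.+1) : oppX X a [:: k : nat] * iter k (@sX R) F =
  - (X (a [:: k : nat]) * iter k (@sX R) F)
  - (if (k : nat) is j.+1 then a [:: j] * iter j.+1 (@sX R) F else 0).
  rewrite -[oppX X a _]/(- (arrX X a [:: k : nat])) /arrX /der /=.
  by case: (k : nat) => [|j]; rewrite /ctr /= ?addr0 ?subr0 ?mulNr // mulrDl opprD.
rewrite (eq_bigr _ (fun k _ => e k)) big_split /= [X in _ + X]big_ord_recl /= oppr0 add0r.
have e2 (k : 'I_N.+1) : - X (a [:: k : nat] * iter k (@sX R) F) =
  - (X (a [:: k : nat]) * iter k (@sX R) F) - a [:: k : nat] * iter k.+1 (@sX R) F.
  by rewrite /= aXM opprD.
rewrite [RHS](eq_bigr _ (fun k _ => e2 k)) big_split /=; congr (_ + _).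
by rewrite big_ord_recr /= (h N) ?mul0r ?oppr0 ?addr0 // inE.
Qed.

End Operators.

(** * An operator is determined by its action on functions *)

Section SkewTest.
Variable R : realType.
Local Notation A := (sfun R).
Local Notation X := (@aX R).

Lemma aX_coord_x : X (scoord R cx) = 1.
Proof.
rewrite /aX /= /sX (@sactE R 0) => [|i _]; last by rewrite sd_coord.
by rewrite big_ord0 /= !sd_coord mul0r mul1r add0r addr0.
Qed.

Lemma sd_cst c (a : R) : sd c (lift (cst a)) = 0.
Proof.
apply: sfun_inj; rewrite val_sd (liftK (smooth_cst a)).
by have [_ ->] := has_partial_cst c a.
Qed.

Lemma sact_cst V (a : R) : sact V (lift (cst a)) = 0.
Proof.
rewrite (@sactE R 0) => [|i _]; last exact: sd_cst.
by rewrite big_ord0 !sd_cst !mulr0 !addr0.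
Qed.

Lemma aX_cst (a : R) : X (lift (cst a)) = 0.
Proof. exact: sact_cst. Qed.

Lemma aX_exp (y : A) m : X y = 1 -> X (y ^+ m) = m%:R * y ^+ m.-1.
Proof.
move=> hy; elim: m => [|m IH]; first by rewrite expr0 mul0r (X_1 (@aXM R)).
rewrite exprS aXM hy mul1r IH /=; case: m {IH} => [|m] /=; first by rewrite mul0r mulr0 addr0 mul1r.
by rewrite mulrCA -exprS [m.+2%:R]mulrS mulrDl mul1r.
Qed.

Lemma aX_iter_exp (y : A) m j : X y = 1 -> iter j X (y ^+ m) = (m ^_ j)%:R * y ^+ (m - j).
Proof.
move=> hy; elim: j => [|j IH]; first by rewrite ffactn0 mul1r subn0.
rewrite iterS IH aXM (X_nat (@aXM R)) mul0r add0r aX_exp // mulrA -natrM ffactnSr.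
by rewrite subnS.
Qed.

Lemma fval_exp (y : A) m p : fval (y ^+ m) p = (fval y p : R) ^+ m.
Proof. by elim: m => [//|m IH]; rewrite !exprS -IH. Qed.

Lemma fval_natmul m (y : A) p : fval (m%:R * y) p = (m%:R : R) * fval y p.
Proof.
have e k : fval (k%:R : A) p = (k%:R : R).
  by elim: k => [//|k IH]; rewrite !mulrS -IH.
by rewrite -e.
Qed.

Lemma fval_sum p I (r : seq I) (P : pred I) (F : I -> A) :
  fval (\sum_(i <- r | P i) F i) p = \sum_(i <- r | P i) (fval (F i) p : R).
Proof. by elim/big_rec2: _ => [//|i x y _ <-]. Qed.

(** The coefficient of X^k at a point p is read off from the test function (x
   - x(p))^k: its derivatives X^j vanish at p for j <> k, and the k-th is k!.
   *)
Lemma evol_inj N (a : arr A) : supp N a -> (forall s, size s != 1%N -> a s = 0) ->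
  (forall F, evol N F a = 0) -> a = 0.
Proof.
move=> hs hl h; apply/funext => s.
have [/eqP|] := boolP (size s == 1%N); last exact: hl.
case: s => [//|k [|//]] _.
have [kN|Nk] := ltnP k N; last by rewrite (hs k) // inE.
apply: sfun_inj; apply/funext => p.
(* X y = 1 and y(p) = 0, so X^j (y^k) at p is k! if j = k and 0 otherwise *)
pose y : A := scoord R cx - lift (cst (p cx)).
have hy : X y = 1 by rewrite /y raddfB aX_coord_x aX_cst subr0.
have y0 : fval y p = (0 : R).
  rewrite /y valB (liftK (smooth_cst _)) val_scoord; exact: subrr.
have e j : iter j (@sX R) (y ^+ k) = (k ^_ j)%:R * y ^+ (k - j) := aX_iter_exp k j hy.
have E : \sum_(j < N) ((fval (a [:: j : nat]) p : R) * fval (iter j (@sX R) (y ^+ k)) p) = 0.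
  by have := congr1 (fun G : A => fval G p) (h (y ^+ k)); rewrite /evol fval_sum.
rewrite (bigD1 (Ordinal kN)) //= big1 in E; last first.
  move=> j hj; rewrite e fval_natmul fval_exp y0.
  have hjk : (j != k :> nat) by rewrite -val_eqE in hj.
  have [jk|kj] := ltnP j k; first by rewrite expr0n subn_eq0 leqNgt jk !mulr0.
  by rewrite ffact_small ?mul0r ?mulr0 //; lia.
move/eqP: E; rewrite addr0 e fval_natmul fval_exp subnn expr0 mulr1 ffactnn.
by rewrite mulf_eq0 pnatr_eq0 gtn_eqF ?fact_gt0 // orbF => /eqP.
Qed.
End SkewTest.

(** * Skew-adjointness in terms of coefficients *)

Section SkewOp.
Variable R : realType.
Local Notation A := (sfun R).
Local Notation X := (@aX R).
Variable r : nat -> fn R.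
Hypothesis dr : diffop r.
Variable N : nat.
Hypothesis hN : forall i, (N <= i)%N -> r i = 0.
Notation sg := (oparr r).

Lemma iter_vact0 i : iter i (fun g => - vact (@Xf R) g) 0 = 0.
Proof. by elim: i => //= i ->; rewrite vact0 oppr0. Qed.

Lemma op_applyE f : smooth f -> op_apply r f = fval (evol N (lift f) sg).
Proof.
move=> sf; rewrite /op_apply (@fsum_nat _ _ N) => [|i hi]; last by rewrite hN // mul0r.
rewrite /evol val_sum; apply: eq_bigr => i _.
rewrite (oparr1 dr) valM (val_sX_iter i (lift f)) (liftK sf).
by case: dr => sr _; rewrite (liftK (sr i)).
Qed.

Lemma op_adjointE f : smooth f ->
  op_adjoint r f = fval (\sum_(i < N) iter i (fun G => - X G) (sg [:: i : nat] * lift f)).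
Proof.
move=> sf; rewrite /op_adjoint (@fsum_nat _ _ N) => [|i hi]; last first.
  by rewrite hN // mul0r iter_vact0.
rewrite val_sum; apply: eq_bigr => i _.
have e k (G : A) : fval (iter k (fun G => - X G) G) = iter k (fun g => - vact (@Xf R) g) (fval G).
  elim: k => [//|k IH]; rewrite !iterS -IH; apply: etrans (valN _) _.
  by congr (- _); exact: val_sX.
rewrite e (oparr1 dr) valM (liftK sf).
by case: dr => sr _; rewrite (liftK (sr i)).
Qed.

Lemma supp_wtheta_oparr i : supp 1 (wtheta 0 (ctr i sg)).
Proof.
apply: supp_wtheta => // k s _ ks; rewrite /ctr (oparr_arity dr) //.
by case: s ks.
Qed.

Lemma supp_adjarr : supp N (adjarr X N sg).
Proof.
apply: supp_sum => i; apply: supp_le (supp_iterNX X (k := i) (supp_wtheta_oparr i)).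
by have := ltn_ord i; lia.
Qed.

Lemma oppX_nil k (a : arr A) : a [::] = 0 -> iter k (oppX X) a [::] = 0.
Proof.
move=> h; elim: k => //= k IH.
by rewrite /oppX arrN /arrX /der /= IH raddf0 oppr0.
Qed.

Lemma evol_iter m k F (a : arr A) : supp m a -> a [::] = 0 ->
  evol (m + k) F (iter k (oppX X) a) = iter k (fun G => - X G) (evol m F a).
Proof.
move=> hs h0; elim: k => [|k IH]; first by rewrite addn0.
by rewrite addnS iterS evol_oppX ?IH //; [exact: supp_iterNX|exact: oppX_nil].
Qed.

Lemma evol_adjarr F : evol N F (adjarr X N sg) =
  \sum_(i < N) iter i (fun G => - X G) (sg [:: i : nat] * F).
Proof.
rewrite /adjarr raddf_sum; apply: eq_bigr => i _.
have hi : (1 + i <= N)%N by have := ltn_ord i; lia.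
rewrite /= (evol_widen _ hi (supp_iterNX X (k := i) (supp_wtheta_oparr i))).
rewrite (evol_iter _ _ (supp_wtheta_oparr i)) //; congr (iter i _ _).
by rewrite /evol big_ord1 /= /wtheta /wedge1 /= /delta eqxx mul1r subr0.
Qed.

Lemma adjarr_arity : arity 1 (adjarr X N sg).
Proof.
apply: arity_sum => i; apply: arity_oppX; apply: arity_wedge1 => s hs.
by rewrite /ctr (oparr_arity dr).
Qed.

(** Skew-adjointness, tested on all functions, is an identity between
   coefficients by [evol_inj]. *)
Lemma skew_adjointP : skew_adjoint r <-> adjarr X N sg = - sg.
Proof.
split=> h; last first.
  move=> f sf; rewrite (op_adjointE sf) (op_applyE sf) -evol_adjarr h raddfN.
  exact: valN.
apply/eqP; rewrite -subr_eq0 opprK; apply/eqP.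
apply: (@evol_inj _ N).
- by apply: suppD; [exact: supp_adjarr|exact: supp_oparr].
- by move=> s hs; rewrite arrD adjarr_arity // (oparr_arity dr) // addr0.
move=> F; rewrite raddfD /= evol_adjarr; apply: sfun_inj.
have sF := sfunP F; have := h _ sF.
rewrite (op_adjointE sF) (op_applyE sF) val_lift valD => ->.
exact: addNr.
Qed.
End SkewOp.

(** * The cohomology space *)

Section Main.
Variable R : realType.
Implicit Types (v w : form R) (c d : coord) (l : seq coord).
Local Notation A := (sfun R).
Variables (n : nat) (K : A).
Local Notation X := (@aX R).
Local Notation D := (@aD R).
Local Notation T := (aT K).
Local Notation AX := (arrX X).
Local Notation AT := (arrT X T D K).
Local Notation LS := (linadj X D K n).
Local Notation Kf := (fval K).
Hypothesis n2 : (2 <= n)%N.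
Hypothesis DK : forall i, (n < i)%N -> D i K = 0.
Hypothesis Kn_reg : forall f : A, D n K * f = 0 -> f = 0.

Lemma aTM (f g : A) : T (f * g) = T f * g + f * T g. Proof. exact: sTM. Qed.
Lemma aXT (f : A) : X (T f) = T (X f). Proof. exact: sXT. Qed.
Lemma aDT P i (f : A) : Dvanish D P f ->
  D i (T f) = T (D i f) + \sum_(k < P) DXK X D K k i * D k f.
Proof. exact: sDT. Qed.

Lemma contract_oneform c v : oneform v -> contract c v = fmul (v [:: c]) (@one_form0 R).
Proof.
move=> hv; apply/funext => -[|d l]; first exact: (esym (mulr1 _)).
rewrite -[contract c v _]/(v (c :: d :: l)) hv //; exact: (esym (mulr0 _)).
Qed.

Lemma wedge_one_form0r v : oneform v -> wedge v (@one_form0 R) = v.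
Proof.
move=> hv; apply: formP => [|c]; first by rewrite wedge_nil // hv.
rewrite contract_wedge // (contract_oneform c hv).
have -> : contract c (@one_form0 R) = 0 by [].
by rewrite wedge0r subr0.
Qed.

Lemma wedge_oneformC v w : oneform v -> oneform w -> wedge v w = - wedge w v.
Proof.
move=> hv hw; apply: formP => [|c]; first by rewrite formN !wedge_nil // oppr0.
rewrite contractN !contract_wedge // (contract_oneform c hv) (contract_oneform c hw).
by rewrite (wedge_fmulr _ _ hv) (wedge_fmulr _ _ hw) !wedge_one_form0r // opprB.
Qed.

Lemma bideg_oneform w : bideg 0 0 0 1 w -> oneform w.
Proof.
move=> h l hl; apply: h; have := count_predC is_u l.
move: (count is_u l) (count (predC is_u) l) => a b; lia.
Qed.

Lemma contract_gen_self c w : contract c w = 0 -> contract c (wedge (gen c) w) = w.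
Proof.
move=> hw; rewrite (contract_wedge _ _ (oneform_gen R c)) hw wedge0r subr0 gen1 eqxx.
exact: fmul1l.
Qed.

Lemma contract_gen_other c d w : c != d -> contract c w = 0 -> contract c (wedge (gen d) w) = 0.
Proof.
move=> hcd hw; rewrite (contract_wedge _ _ (oneform_gen R d)) hw wedge0r subr0 gen1 (negPf hcd).
exact: fmul0l.
Qed.

Lemma form12_eq0 w : good w -> bideg 0 0 1 2 w ->
  vert (contract cx w) = 0 -> vert (contract ct w) = 0 -> w = 0.
Proof.
move=> gw hg hx ht; apply: (form_eq0 gw hg) => -[//|c [|//]] us /=.
rewrite andbT => hc _ _; rewrite -[w _]/(contract c w (map cu us)).
apply: vert_eq0; first exact: good_contract.
by case: c hc => [||i] // _; [rewrite ht|rewrite hx].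
Qed.

Lemma good_dH w : good w -> good (dH Kf w).
Proof.
move=> gw; apply: goodD.
  by rewrite lieX_Dx; exact: good_gen_wedge _ (good_Dx gw).
exact: good_gen_wedge _ (good_LT K (@smooth_coframeK R K) gw).
Qed.

Lemma bideg_dH r s w : good w -> bideg 0 0 r s w -> bideg 0 0 r.+1 s (dH Kf w).
Proof.
move=> gw h; apply: bidegD.
  have := bideg_wedge (kind1_gen R cx) (bideg_Dx gw h).
  by rewrite lieX_Dx /= addn0 addn1.
have := bideg_wedge (kind1_gen R ct) (bideg_LT K gw h).
by rewrite /= addn0 addn1.
Qed.

Lemma vert_dH_x w : good w -> bideg 0 0 0 2 w -> vert (contract cx (dH Kf w)) = AX (vert w).
Proof.
move=> gw h; rewrite /dH contractD lieX_Dx.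
have cX := contract_horizontal (c := cx) (bideg_Dx gw h) isT.
have cT := contract_horizontal (c := cx) (bideg_LT K gw h) isT.
by rewrite contract_gen_self // contract_gen_other // addr0 vert_Dx.
Qed.

Lemma vert_dH_t w P : good w -> fbnd P w -> bideg 0 0 0 2 w ->
  vert (contract ct (dH Kf w)) = AT P (vert w).
Proof.
move=> gw bw h; rewrite /dH contractD lieX_Dx.
have cX := contract_horizontal (c := ct) (bideg_Dx gw h) isT.
have cT := contract_horizontal (c := ct) (bideg_LT K gw h) isT.
rewrite contract_gen_other // add0r contract_gen_self //.
exact: (vert_LT K (@smooth_coframeK R K) gw bw).
Qed.

(** The only component of d_H w is the one at dx /\ dt, whose coefficient is X
   B - T A up to sign. *)
Lemma dH_eq0 w P : good w -> bideg 0 0 1 2 w -> fbnd P w ->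
  dH Kf w = 0 <-> AX (vert (contract ct w)) = AT P (vert (contract cx w)).
Proof.
move=> gw hg bw; have sF := @smooth_coframeK R K.
have gX := good_Dx gw; have gT := good_LT K sF gw.
have gcx := good_contract cx gw; have gct := good_contract ct gw.
have bcx : fbnd P (contract cx w) by exact: fbnd_contract.
have eXt : contract ct (Dx w) = Dx (contract ct w) by exact: contract_Dx.
have eTx : contract cx (lie (coframeK Kf) (Tf Kf) w) = lie (coframeK Kf) (Tf Kf) (contract cx w).
  by apply: contract_LT => // d; exact: lamT_x.
have E : vert (contract ct (contract cx (dH Kf w))) =
    AX (vert (contract ct w)) - AT P (vert (contract cx w)).
  rewrite /dH lieX_Dx -/(lieT Kf w) contractD !contract_wedge; try exact: oneform_gen.
  rewrite !gen1 /= fmul1l fmul0l sub0r contractD contractB contractN.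
  rewrite !contract_wedge; try exact: oneform_gen.
  rewrite !gen1 /= fmul1l fmul0l sub0r opprK.
  rewrite eXt -[lieT Kf w]/(lie (coframeK Kf) (Tf Kf) w) eTx.
  set y := contract ct (contract cx (Dx w)).
  set z := contract ct (lie _ _ (contract cx w)).
  have gy : good y by do 2 apply: good_contract.
  have gz : good z by apply: good_contract; exact: good_LT.
  have s1 : fsmooth (wedge (gen cx) y) by case: (good_gen_wedge cx gy).
  have s2 : fsmooth (wedge (gen ct) z) by case: (good_gen_wedge ct gz).
  have [s3 _ _] := good_Dx gct; have [s4 _ _] := good_LT K sF gcx.
  have s5 : fsmooth (Dx (contract ct w) + wedge (gen cx) y) by case: (goodD (good_Dx gct) (good_gen_wedge cx gy)).
  have g6 := goodD (good_LT K sF gcx) (goodN (good_gen_wedge ct gz)).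
  have [s6 _ _] := g6; have [s7 _ _] := goodN g6.
  have [s8 _ _] := goodN (good_gen_wedge ct gz).
  rewrite (vertD s5 s7) (vertD s3 s1) (vertN s6) (vertD s4 s8) (vertN s2).
  have [sy _ _] := gy; have [sz _ _] := gz.
  rewrite (vert_horizontal_wedge (c := cx) isT sy) (vert_horizontal_wedge (c := ct) isT sz).
  have fin (p q p' q' : arr A) : p = p' -> q = q' -> p + 0 - (q + - 0) = p' - q'.
    by move=> -> ->; rewrite oppr0 !addr0.
  exact: fin (vert_Dx gct) (vert_LT K sF gcx bcx).
split=> [h|h].
  by apply/eqP; rewrite -subr_eq0 -E h !contract0 vert0.
have g2 := good_dH gw; have h2 := bideg_dH gw hg.
apply: (form_eq0 g2 h2) => hs us hhs /= e _.
have {E h} E : forall us, dH Kf w (cx :: ct :: map cu us) = 0.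
  move=> vs; rewrite -[dH Kf w _]/(contract ct (contract cx (dH Kf w)) (map cu vs)).
  by apply: vert_eq0; [do 2 apply: good_contract|rewrite E h subrr].
have [_ a2 _] := g2.
(* a repeated horizontal label gives zero by alternation *)
have dup c : dH Kf w (c :: c :: map cu us) = 0.
  have := a2 [::] c c (map cu us) => h; apply/funext => p; apply: eqN0.
  exact: (congr1 (fun f : fn R => f p) h).
case: hs hhs e => [//|c [//|d [|//]]] /= /and3P[hc hd _] _.
case: c d hc hd => [||//] [||//] _ _; [exact: dup| |exact: E|exact: dup].
by rewrite (a2 [::] ct cx (map cu us)) E oppr0.
Qed.

(** The factors 1/2 in epsilon and in the normal form are treated by doubling,
   which keeps scalars out of the identities between arrays. *)
Lemma arr_dbl (x : arr A) : x + x = 0 -> x = 0.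
Proof.
move=> h; apply/funext => s; apply: (@sfun_char0 R 1).
by rewrite mulr2n -arrD h.
Qed.

Lemma bideg_shift w : bideg 1 0 1 2 w -> bideg 0 0 0 2 w.
Proof. by move=> h l hl; apply: h; move: hl; rewrite !add0n !add1n. Qed.

Lemma bideg_arity w m : bideg 0 0 0 m w -> arity m (vert w).
Proof.
move=> h s hs; have e : count is_u (map cu s) = size s by elim: s {hs} => //= i s ->.
by rewrite /vert h ?lift0 // e !add0n negb_and hs orbT.
Qed.

Section Operator.
Variable r : nat -> fn R.
Hypothesis dr : diffop r.
Local Notation sg := (oparr r).

Lemma theta_op_facts : let v := wedge (gen (cu 0)) (op_theta r) in
  [/\ good v, bideg 0 0 0 2 v & vert v = wtheta 0 sg].
Proof.
have [h1 gt ht] := (op_theta_facts dr); split.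
- exact: good_gen_wedge _ gt.
- exact: bideg_gen_u ht.
- by rewrite vert_gen_wedge //; case: gt.
Qed.

Lemma Sigma_facts : [/\ good (op_Sigma r), bideg 0 0 1 2 (op_Sigma r),
  contract ct (op_Sigma r) = 0 & contract cx (op_Sigma r) = wedge (gen (cu 0)) (op_theta r)].
Proof.
have [g2 h2 _] := theta_op_facts; rewrite /op_Sigma; split.
- exact: good_gen_wedge _ g2.
- exact: bideg_gen_h h2.
- by apply: contract_gen_other => //; exact: (contract_horizontal h2).
- by apply: contract_gen_self; exact: (contract_horizontal h2).
Qed.

Lemma good_pi12 w : good w -> good (@pi12 R w).
Proof.
move=> [sw aw [N bw]]; split.
- by move=> l; rewrite /pi12; case: ifP => _; [exact: sw|exact: smooth0].
- move=> l1 c d l2; rewrite /pi12.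
  have e (a : pred coord) : count a (l1 ++ c :: d :: l2) = count a (l1 ++ d :: c :: l2).
    by rewrite !count_cat /=; lia.
  by rewrite !e; case: ifP => _; [exact: aw|rewrite oppr0].
- by exists N => i l hi hl; rewrite /pi12 (bw i l hi hl) if_same.
Qed.

Lemma pi12_facts w : good w -> bideg 0 0 1 2 (@pi12 R w) /\ contract ct (@pi12 R w) = 0.
Proof.
move=> gw; split; last first.
  by apply/funext => l; rewrite -[LHS]/(pi12 w (ct :: l)) /pi12.
move=> l hl; rewrite /pi12; case: ifP => // /and3P[/eqP h1 /eqP h2 /eqP h3].
suff h4 : count (predC is_u) l = (count_mem ct l + count_mem cx l)%N.
  by move: hl; rewrite !add0n h4 h1 h2 h3.
by elim: (l) => //= -[||i] l' ->; rewrite /= ?add0n ?add1n ?addnS.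
Qed.

Lemma vert_pi12 w : vert (contract cx (@pi12 R w)) =
  fun s => if size s == 2%N then vert (contract cx w) s else 0.
Proof.
apply/funext => s; rewrite -[LHS]/(lift (pi12 w (cx :: map cu s))) /pi12.
have e1 : count_mem ct (map cu s) = 0%N by elim: (s).
have e2 : count_mem cx (map cu s) = 0%N by elim: (s).
have e3 : count is_u (map cu s) = size s by elim: (s) => //= i t ->.
by rewrite /= e1 e2 e3 /=; case: ifP => // _; exact: lift0.
Qed.

Lemma scale_eq0 (a : R) w : a != 0 -> a *: w = 0 -> w = 0.
Proof.
move=> ha h; have : a^-1 *: (a *: w) = 0 by rewrite h scaler0.
by rewrite scalerA mulVf // scale1r.
Qed.

Lemma vert_Lie_Sigma N P : (forall i, (N <= i)%N -> r i = 0) -> (0 < N)%N -> (N <= P)%N ->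
  vert (contract cx (@pi12 R (lie (fun=> 0) (Tf Kf) (op_Sigma r)))) = AT P (wtheta 0 sg).
Proof.
move=> hN N0 NP; have [gS hS cS xS] := Sigma_facts.
have [g2 h2 t2] := theta_op_facts.
have s0 (i : nat) : smooth (0 : fn R) := @smooth0 R.
have ex := contract_LT (K := K) s0 gS (fun d => lamT_x K (fun=> 0) d).
rewrite vert_pi12 ex xS.
have b2 : fbnd P (wedge (gen (cu 0)) (op_theta r)).
  have [h1 _ _] := (op_theta_facts dr).
  apply: fbnd_wedge (oneform_gen _ _) _ (fbnd_le NP (fbnd_theta dr hN)).
  move=> i l hi hl; rewrite /gen; case: eqP => // e.
  by move: hl; rewrite e inE => /eqP[e0]; rewrite e0 in hi; lia.
rewrite (vert_LT K s0 g2 b2) t2; apply/funext => s; case: ifP => // /negbT hs.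
have hl : arity 2 (wtheta 0 sg) by apply: arity_wedge1 => t ht; exact: oparr_arity.
exact: (esym (@arity_T A X T D K P 2 _ hl s hs)).
Qed.

Lemma supp_wtheta0 N : (forall i, (N <= i)%N -> r i = 0) -> (0 < N)%N -> supp N (wtheta 0 sg).
Proof. by move=> hN N0; apply: supp_wtheta => //; exact: supp_oparr. Qed.

(** For skew-adjoint s, E(theta^0 /\ s) = 2 s; so [eulerop_T] evaluates E of T
   (theta^0 /\ s) to 2 (T + [linadj]) s, and I_E adds the factor theta^0. P is
   any truncation of T that is large enough. *)
Lemma hamiltonianP N P : (forall i, (N <= i)%N -> r i = 0) -> (0 < N)%N -> (N + N <= P)%N ->
  adjarr X N sg = - sg ->
  hamiltonian Kf r <-> wtheta 0 (AT P sg + LS sg) = 0.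
Proof.
move=> hN N0 NP hadj.
have [gS hS cS xS] := Sigma_facts.
have s0 (i : nat) : smooth (0 : fn R) := @smooth0 R.
set L := pi12 (lie (fun=> 0) (Tf Kf) (op_Sigma r)).
have gL : good L by apply: good_pi12; exact: @good_LT R K (fun=> 0) s0 _ gS.
have [hL tL] := pi12_facts (@good_LT R K (fun=> 0) s0 _ gS).
have gE := good_eulerform gL; have hE := bideg_eulerform gL hL.
have [_ _ [Q bL]] := gL.
pose N' := (Q + n + N).+1.
have bL' : fbnd N' (contract cx L).
  by apply: fbnd_contract; apply: fbnd_le bL; rewrite /N'; lia.
have ex : vert (contract cx (eulerform L)) = - ((AT P sg + LS sg) + (AT P sg + LS sg)).
  rewrite contract_eulerform // vertN; last by case: (good_eulerform (good_contract cx gL)).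
  congr (- _); rewrite (vert_eulerform (good_contract cx gL) bL').
  rewrite (@vert_Lie_Sigma N P) //; last by lia.
  rewrite (eulerop_T (@aXM R) (@aDX R) aXT DK (supp_wtheta0 hN N0) NP); last by rewrite /N'; lia.
  rewrite eulerop_wtheta0 // hadj opprK.
  by rewrite (raddfD (AT P)) (raddfD LS) addrACA.
have gW := good_gen_wedge (cu 0) gE.
have hW : bideg 0 1 1 3 (wedge (gen (cu 0)) (eulerform L)).
  exact: bideg_gen_u hE.
have eW : vert (contract cx (wedge (gen (cu 0)) (eulerform L))) =
    wtheta 0 (AT P sg + LS sg) + wtheta 0 (AT P sg + LS sg).
  have gcE := good_contract cx gE.
  rewrite (contract_wedge _ _ (oneform_gen R (cu 0))) gen1 fmul0l sub0r vertN; last first.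
    by case: (good_gen_wedge (cu 0) gcE).
  rewrite vert_gen_wedge ?ex; last by case: gcE.
  by rewrite raddfN opprK raddfD.
rewrite /hamiltonian IEE -/L; split=> [h|h].
  have h0 : wedge (gen (cu 0)) (eulerform L) = 0.
    by apply: scale_eq0 h; rewrite invr_eq0 pnatr_eq0.
  by apply: arr_dbl; rewrite -eW h0 contract0 vert0.
suff -> : wedge (gen (cu 0)) (eulerform L) = 0 by rewrite scaler0.
apply: (form_eq0 gW hW) => -[//|c [|//]] us /=; rewrite andbT => hc _ _.
rewrite -[LHS]/(contract c (wedge (gen (cu 0)) (eulerform L)) (map cu us)).
apply: vert_eq0; first exact: good_contract.
case: c hc => [||//] _; last by rewrite eW h addr0.
suff -> : contract ct (wedge (gen (cu 0)) (eulerform L)) = 0 by rewrite vert0.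
apply: contract_gen_other => //.
by rewrite contract_eulerform // tL eulerform0 oppr0.
Qed.

Lemma X_dtpart_sg P : (0 < P)%N -> wtheta 0 (AT P sg + LS sg) = 0 ->
  AX (dtpart X D K n sg) = AT P (wtheta 0 sg).
Proof.
by move=> P0 h; rewrite (X_dtpart (@aXM R) aTM DK _ P0) h subr0.
Qed.

Lemma dtpart_dbl (x y : arr A) : x + x = - y -> dtpart X D K n y = - (dtpart X D K n x + dtpart X D K n x).
Proof. by move=> h; rewrite -(raddfD (dtpart X D K n)) h (raddfN (dtpart X D K n)) opprK. Qed.

Lemma Dvanisharr_vert M0 w : fsmooth w -> fdep M0 w -> Dvanisharr D M0.+1 (vert w).
Proof.
move=> sw h s k hk; apply: sfun_inj; rewrite [LHS]val_sd (fval_vert s sw).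
exact: partial_depends_upto (h _) hk.
Qed.

Lemma dV0 : dV (0 : form R) = 0.
Proof.
have h : fdep 0 (0 : form R) by move=> l; exact: depends_upto_nat 0.
rewrite (dVE h) big1 // => i _.
rewrite (_ : fpartial i 0 = 0) ?wedge0r //; apply/funext => l.
exact: (proj2 (has_partial_cst (cu i) (0 : R))).
Qed.

Local Notation eps := (vert (epsilon r)).

Lemma epsilonE : epsilon r = fmul (cst (- 2^-1 : R)) (op_theta r).
Proof. by []. Qed.

Lemma eps_facts : [/\ good (epsilon r), bideg 0 0 0 1 (epsilon r) & eps + eps = - sg].
Proof.
have [h1 gt ht] := (op_theta_facts dr); have sc_ := smooth_cst (- 2^-1 : R).
have [st _ _] := gt.
rewrite epsilonE; split; [exact: good_fmul|exact: bideg_fmul|].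
rewrite (vert_fmul sc_ st) -scDl; apply/funext => s; rewrite /sc arrN -[RHS]mulN1r; congr (_ * _).
apply: sfun_inj; rewrite valD (liftK sc_) valN; apply/funext => p.
by rewrite -[LHS]/(- 2^-1 + - 2^-1 : R) -[RHS]/(- 1 : R); lra.
Qed.

Definition omega_t : form R :=
  \sum_(1 <= j < n.+1) \sum_(1 <= a < j.+1)
    wedge (iter a.-1 (@oppDx R) (fmul (partial (cu j) Kf) (epsilon r))) (gen (cu (j - a))).

Lemma omegaE : omega n Kf r =
  wedge (gen cx) (wedge (gen (cu 0)) (epsilon r)) - wedge (gen ct) omega_t.
Proof. by rewrite /omega lieX_Dx. Qed.

Lemma omega_term j a : let v := iter a.-1 (@oppDx R) (fmul (partial (cu j) Kf) (epsilon r)) in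
  [/\ good (wedge v (gen (cu (j - a)))), bideg 0 0 0 2 (wedge v (gen (cu (j - a)))) &
    vert (wedge v (gen (cu (j - a)))) = - wtheta (j - a) (iter a.-1 (oppX X) (sc (D j K) eps))].
Proof.
move=> v; have [ge he _] := eps_facts.
have sK : smooth (partial (cu j) Kf) := smooth_partial (cu j) (sfunP K).
have gf := good_fmul sK ge; have hf : bideg 0 0 0 1 (fmul (partial (cu j) Kf) (epsilon r)) by exact: bideg_fmul.
have gv : good v by exact: good_iter.
have hv : bideg 0 0 0 1 v by exact: bideg_iter.
rewrite (wedge_oneformC (bideg_oneform hv) (oneform_gen R (cu (j - a)))).
have gw := good_gen_wedge (cu (j - a)) gv.
have [sw _ _] := gw; have [sv _ _] := gv; have [se _ _] := ge.
split; first exact: goodN.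
  apply: bidegN; have := bideg_wedge (kind1_gen R (cu (j - a))) hv.
  by rewrite /= addn0 addn1.
rewrite (vertN sw) (vert_gen_wedge _ sv) /v (vert_iter _ gf) (vert_fmul sK se).
congr (- wtheta _ (iter _ _ (sc _ _))); apply: sfun_inj; rewrite (liftK sK).
exact: (esym (val_sd _ _)).
Qed.

Lemma vert_big_nat m p (F : nat -> form R) : (forall i, good (F i)) ->
  vert (\sum_(m <= i < p) F i) = \sum_(m <= i < p) vert (F i).
Proof. by move=> h; rewrite vert_sum. Qed.

Lemma omega_t_facts : [/\ good omega_t, bideg 0 0 0 2 omega_t &
  vert omega_t = - dtpart X D K n eps].
Proof.
have ht j a := omega_term j a; rewrite /omega_t; split.
- by apply: good_sum => j; apply: good_sum => a; case: (ht j a).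
- by apply: bideg_sum => j; apply: bideg_sum => a; case: (ht j a).
rewrite vert_big_nat => [|j]; last by apply: good_sum => a; case: (ht j a).
rewrite /dtpart big_ord_recl /= {1}/htheta big_ord0 add0r big_add1 /= big_mkord -sumrN.
apply: eq_bigr => j _; rewrite vert_big_nat => [|a]; last by case: (ht j.+1 a).
rewrite big_add1 /= big_mkord /htheta -sumrN; apply: eq_bigr => k _.
by case: (ht j.+1 k.+1) => _ _ ->.
Qed.

(** A and B for omega = dx /\ A + dt /\ B. The sign in front of dt in omega is
   absorbed by exchanging the factors epsilon and theta^(j-a). *)
Lemma omega_facts : [/\ good (omega n Kf r), bideg 0 0 1 2 (omega n Kf r),
  vert (contract cx (omega n Kf r)) = wtheta 0 eps & vert (contract ct (omega n Kf r)) = dtpart X D K n eps].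
Proof.
have [ge he _] := eps_facts; have [gt ht et] := omega_t_facts.
have g2 := good_gen_wedge (cu 0) ge.
have h2 : bideg 0 0 0 2 (wedge (gen (cu 0)) (epsilon r)).
  exact: bideg_gen_u he.
have cx2 := contract_horizontal (c := cx) h2 isT; have ct2 := contract_horizontal (c := ct) h2 isT.
have cxt := contract_horizontal (c := cx) ht isT; have ctt := contract_horizontal (c := ct) ht isT.
rewrite omegaE; split.
- apply: goodD; first exact: good_gen_wedge _ g2.
  by apply: goodN; exact: good_gen_wedge _ gt.
- apply: bidegD.
    exact: bideg_gen_h h2.
  apply: bidegN; exact: bideg_gen_h ht.
- rewrite contractB contract_gen_self // contract_gen_other // subr0 vert_gen_wedge //.
  by case: ge.
- rewrite contractB contract_gen_other // contract_gen_self // sub0r vertN; last by case: gt.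
  by rewrite et opprK.
Qed.

(** Closedness follows from the Hamiltonian condition: dx /\ theta^0 /\ s is
   the dx-part of a cocycle, with [dtpart] as dt-part, so [cocycle_closed]
   applies. *)
Lemma deltaV_eq0 N P : (forall i, (N <= i)%N -> r i = 0) -> (0 < N)%N ->
  (forall Q, (P <= Q)%N -> wtheta 0 (AT Q sg + LS sg) = 0) ->
  deltaV 2 (op_Sigma r) = 0.
Proof.
move=> hN N0 hW.
have [gS hS cS xS] := Sigma_facts; have [g2 h2 t2] := theta_op_facts.
have [M0 hM0] := Omega_fdep (good_Omega gS hS).
have gd := good_dV hM0 gS; have hd := bideg_dV hM0 hS.
rewrite /deltaV IEE.
suff -> : eulerform (dV (op_Sigma r)) = 0 by rewrite wedge0r scaler0.
have gE := good_eulerform gd; have hE := bideg_eulerform gd hd.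
apply: (form_eq0 gE hE) => -[//|c [|//]] us /=; rewrite andbT => hc _ hus.
rewrite -[LHS]/(contract c (eulerform (dV (op_Sigma r))) (map cu us)).
apply: vert_eq0; first exact: good_contract.
case: c hc => [||//] _; rewrite contract_eulerform //.
  by rewrite (contract_dV _ hM0) cS sub0r dV0 oppr0 eulerform0 oppr0 vert0.
rewrite (contract_dV _ hM0) xS sub0r.
set v := wedge (gen (cu 0)) (op_theta r).
have hMv : fdep M0 v by rewrite /v -xS; exact: fdep_contract.
have gv := good_dV hMv g2.
have [_ _ [Q bv]] := gv.
(* one bound for the coefficients, the order and the truncation of T *)
pose B := (Q + N + M0 + P).+1.
have hB i : (B <= i)%N -> r i = 0 by move=> hi; apply: hN; rewrite /B in hi; lia.
have sB : supp B (wtheta 0 sg) by apply: supp_wtheta0.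
have bB : fbnd B (- dV v).
  by move=> i l hi hl; rewrite formN (bv i) ?oppr0 //; rewrite /B in hi; lia.
rewrite vertN; last by case: (good_eulerform (goodN gv)).
rewrite (vert_eulerform (goodN gv) bB) vertN; last by case: gv.
rewrite raddfN opprK (vert_dV hMv g2) t2.
have da : Dvanisharr D B (wtheta 0 sg).
  move=> s k hk; rewrite -t2; apply: sfun_inj; rewrite val_sd fval_vert; last by case: g2.
  by apply: (partial_depends_upto (hMv (map cu s))); rewrite /B in hk; lia.
have hWB : wtheta 0 (AT (B + B) sg + LS sg) = 0 by apply: hW; rewrite /B; lia.
have eBB := X_dtpart_sg (P := B + B) isT hWB.
have [Q' [sBB' dBB]] : exists Q', supp Q' (dtpart X D K n sg) /\ Dvanisharr D Q' (dtpart X D K n sg).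
  have [go ho _ eo] := omega_facts.
  have [M1 hM1] := Omega_fdep (good_Omega go ho).
  have gc := good_contract ct go; have [sc_ _ [Q1 hQ1]] := gc.
  have h1 := Dvanisharr_vert sc_ (@fdep_contract _ _ ct _ hM1); rewrite eo in h1.
  have h3 := supp_vert hQ1; rewrite eo in h3.
  have [_ _ he] := eps_facts.
  have e : dtpart X D K n sg = - (dtpart X D K n eps + dtpart X D K n eps).
    exact: dtpart_dbl he.
  exists (Q1 + M1).+1; rewrite e; split.
    by apply: suppN; apply: suppD; apply: supp_le h3; lia.
  move=> s k hk; rewrite arrN arrD raddfN raddfD /= h1 ?addr0 ?oppr0 //; lia.
case: us hus => [//|i [//|j [|//]]] _.
apply: (cocycle_closed (@aXM R) (@aDM R) (@aDD R) (@aDX R) aXT DK aDT n2 Kn_reg (@sfun_char0 R)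
  sB sBB' (leqnn _) _ da dBB eBB).
by rewrite -t2; apply: alt_vert; case: g2.
Qed.
End Operator.

Lemma arrX_scal (a : R) (x : arr A) : AX (sc (lift (cst a)) x) = sc (lift (cst a)) (AX x).
Proof. by rewrite (X_sc (@aXM R)) aX_cst sc0l add0r. Qed.
Lemma arrT_scal P (a : R) (x : arr A) :
  AT P (sc (lift (cst a)) x) = sc (lift (cst a)) (AT P x).
Proof.
rewrite (arrT_sc _ _ aTM) (_ : T (lift (cst a)) = 0) ?sc0l ?add0r //; exact: sact_cst.
Qed.
Lemma iterNX_scal k (a : R) (x : arr A) :
  iter k (oppX X) (sc (lift (cst a)) x) = sc (lift (cst a)) (iter k (oppX X) x).
Proof. by elim: k => [//|k IH]; rewrite !iterS IH /oppX arrX_scal raddfN. Qed.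
Lemma linadj_scal (a : R) (x : arr A) : LS (sc (lift (cst a)) x) = sc (lift (cst a)) (LS x).
Proof.
rewrite /linadj /pairing [RHS]raddf_sum; apply: eq_bigr => i _.
rewrite /= -iterNX_scal; congr (iter i _ _).
by apply/funext => s; rewrite /sc mulrCA.
Qed.
Lemma adjarr_scal N (a : R) (x : arr A) : adjarr X N (sc (lift (cst a)) x) = sc (lift (cst a)) (adjarr X N x).
Proof.
rewrite /adjarr [RHS]raddf_sum; apply: eq_bigr => i _.
by rewrite ctr_sc /wtheta wedge1_sc iterNX_scal.
Qed.

Lemma vert_scale (a : R) w : good w -> vert (a *: w) = sc (lift (cst a)) (vert w).
Proof. by move=> [sw _ _]; rewrite scale_fmul; apply: vert_fmul => //; exact: smooth_cst. Qed.

Lemma eq_dbl (x y : arr A) : x + x = y + y -> x = y.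
Proof.
move=> h; apply/eqP; rewrite -subr_eq0; apply/eqP; apply: arr_dbl.
by rewrite addrACA h -opprD subrr.
Qed.

Lemma commute_lin P (a : R) (x x' y y' : arr A) : AX x = AT P y -> AX x' = AT P y' ->
  AX (sc (lift (cst a)) x + x') = AT P (sc (lift (cst a)) y + y').
Proof.
move=> h h'; rewrite (raddfD AX) (raddfD (AT P)) /=.
by rewrite arrX_scal arrT_scal h h'.
Qed.

Lemma arrX_lin (a : R) (x x' : arr A) :
  AX (sc (lift (cst a)) x + x') = sc (lift (cst a)) (AX x) + AX x'.
Proof. by rewrite (raddfD AX) /= arrX_scal. Qed.

Lemma arrT_lin P (a : R) (x x' : arr A) :
  AT P (sc (lift (cst a)) x + x') = sc (lift (cst a)) (AT P x) + AT P x'.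
Proof. by rewrite (raddfD (AT P)) /= arrT_scal. Qed.

Lemma wtheta_lin (a : R) (s s' t e e' f : arr A) : t = sc (lift (cst a)) s + s' ->
  e + e = - s -> e' + e' = - s' -> f + f = - t ->
  wtheta 0 f = sc (lift (cst a)) (wtheta 0 e) + wtheta 0 e'.
Proof.
move=> -> he he' hf; suff -> : f = sc (lift (cst a)) e + e'.
  by rewrite (raddfD (wtheta 0)) /= {1}/wtheta wedge1_sc.
apply: eq_dbl; rewrite hf addrACA he' -(raddfD (sc _)) he (raddfN (sc _)).
by rewrite opprD.
Qed.

Lemma exact_dbl (s s' e e' y : arr A) : e + e = - s -> e' + e' = - s' ->
  wtheta 0 e' + y = wtheta 0 e -> wtheta 0 (s' - s) = y + y.
Proof.
move=> he he' h.
have : wtheta 0 (e' + e') + (y + y) = wtheta 0 (e + e).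
  by rewrite !(raddfD (wtheta 0)) /= -h addrACA.
rewrite he he' !(raddfN (wtheta 0)) (raddfB (wtheta 0)) /= => {}h.
by apply: (addrI (- wtheta 0 s')); rewrite h addrA addNr add0r.
Qed.

Lemma normal_dbl (x ex e c h : arr A) : x + x = wtheta 0 ex + AX h -> e + e = ex ->
  c + c = h -> x - wtheta 0 e - AX c = 0.
Proof.
move=> hx he hc; rewrite -he -hc in hx; apply: arr_dbl.
rewrite addrACA [X in X + _]addrACA -!opprD hx (raddfD (wtheta 0)) (raddfD AX) /=.
by rewrite addrAC addrK subrr.
Qed.

Lemma bracket_dbl P (e s : arr A) : e + e = - s -> wtheta 0 (AT P s + LS s) = 0 ->
  wtheta 0 (AT P e + LS e) = 0.
Proof.
move=> he h; apply: arr_dbl.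
rewrite -(raddfD (wtheta 0)) addrACA -(raddfD (AT P)) -(raddfD LS) he.
by rewrite (raddfN (AT P)) (raddfN LS) -opprD (raddfN (wtheta 0)) /= h oppr0.
Qed.

Lemma adjarr_fix N (x : arr A) : (0 < N)%N -> adjarr X N x = - x -> eulerop X N (wtheta 0 x) = 0 -> x = 0.
Proof. by move=> N0 h; rewrite eulerop_wtheta0 // h opprK; exact: arr_dbl. Qed.

Lemma bracket_lin P (a : R) (s s' : arr A) :
  wtheta 0 (AT P s + LS s) = 0 -> wtheta 0 (AT P s' + LS s') = 0 ->
  wtheta 0 (AT P (sc (lift (cst a)) s + s') + LS (sc (lift (cst a)) s + s')) = 0.
Proof.
move=> h h'; rewrite arrT_lin (raddfD LS) /= linadj_scal addrACA.
by rewrite -(raddfD (sc _)) (raddfD (wtheta 0)) /= h' {1}/wtheta wedge1_sc -/(wtheta 0 _) h (raddf0 (sc _)) addr0.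
Qed.

Lemma adjarr_lin N (a : R) (s s' : arr A) : adjarr X N s = - s -> adjarr X N s' = - s' ->
  adjarr X N (sc (lift (cst a)) s + s') = - (sc (lift (cst a)) s + s').
Proof. by move=> h h'; rewrite (raddfD (adjarr X N)) /= adjarr_scal h h' (raddfN (sc _)) opprD. Qed.

(** A description of the space of operators in which linearity is visible: for
   r <> 0, Sigma <> 0 and delta_V Sigma = 0 follow from these conditions. *)
Definition ham_ops (r : nat -> fn R) := [/\ diffop r, skew_adjoint r &
  exists P0, forall P, (P0 <= P)%N -> wtheta 0 (AT P (oparr r) + LS (oparr r)) = 0].

Lemma diffop_bound2 (r r' : nat -> fn R) : diffop r -> diffop r' ->
  exists N, [/\ (0 < N)%N, forall i, (N <= i)%N -> r i = 0 & forall i, (N <= i)%N -> r' i = 0].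
Proof.
move=> [_ [m hm]] [_ [m' hm']]; exists (m + m').+1; split => // i hi; [apply: hm|apply: hm']; lia.
Qed.

Lemma diffop0 : diffop (0 : nat -> fn R).
Proof. by split; [move=> i; exact: smooth0|exists 0]. Qed.

Lemma oparr0 : oparr (0 : nat -> fn R) = 0.
Proof.
apply/funext => s; have [e|ne] := eqVneq (size s) 1%N; last exact: (oparr_arity diffop0).
by case: s e => [//|i [|//]] _; rewrite (oparr1 diffop0) -/(lift 0) lift0.
Qed.

Lemma ham_ops0 : ham_ops 0.
Proof.
split; first exact: diffop0.
  apply/(skew_adjointP diffop0 (N := 0)) => //.
  by rewrite oparr0 oppr0 /adjarr big_ord0.
by exists 0%N => P _; rewrite oparr0 (raddf0 (AT P)) (raddf0 LS) addr0 raddf0.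
Qed.

(** A nonzero skew-adjoint s has Sigma <> 0 because E(theta^0 /\ s) = 2 s, and
   delta_V Sigma = 0 follows from the Hamiltonian condition. *)
Lemma hamiltonian_operatorsP r : hamiltonian_operators Kf r <-> ham_ops r.
Proof.
split.
  move=> [->|[[dr sk _ _] hr]]; first exact: ham_ops0.
  split => //; have [N [N0 hN _]] := diffop_bound2 dr dr.
  exists (N + N)%N => P hP.
  by apply/(hamiltonianP dr hN N0 hP) => //; apply/(skew_adjointP dr hN).
move=> [dr sk [P0 hP0]]; have [->|nz] := EM (r = 0); [by left|right].
have [N [N0 hN _]] := diffop_bound2 dr dr.
have hadj : adjarr X N (oparr r) = - oparr r by apply/(skew_adjointP dr hN).
split; last first.
  apply/(hamiltonianP (P := P0 + N + N) dr hN N0 _ hadj); first by lia.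
  by apply: hP0; lia.
split => //; last exact: (deltaV_eq0 dr hN N0 hP0).
move=> S0; apply: nz; apply: (oparr_arr0 dr).
have [_ _ _ xS] := Sigma_facts dr; have [_ _ t2] := theta_op_facts dr.
have e : wtheta 0 (oparr r) = 0 by rewrite -t2 -xS S0 contract0 vert0.
have := eulerop_wtheta0 X (oparr r) N0; rewrite e (raddf0 (eulerop X N)) hadj opprK => /esym.
exact: arr_dbl.
Qed.

Lemma oparr_lin (a : R) (u v : nat -> fn R) : diffop u -> diffop v -> diffop (a *: u + v) ->
  oparr (a *: u + v) = sc (lift (cst a)) (oparr u) + oparr v.
Proof.
move=> du dv_ duv; apply/funext => s; rewrite arrD /sc.
have [e|ne] := eqVneq (size s) 1%N; last by rewrite !oparr_arity // mulr0 addr0.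
case: s e => [//|i [|//]] _; rewrite !oparr1 //.
have [su _] := du; have [sv _] := dv_.
rewrite -(liftM (smooth_cst a) (su i)) -(liftD _ (sv i)) //.
exact: smoothM (smooth_cst a) (su i).
Qed.

Lemma diffop_lin (a : R) (u v : nat -> fn R) : diffop u -> diffop v -> diffop (a *: u + v).
Proof.
move=> [su [m hm]] [sv [m' hm']]; split.
  by move=> i; exact: smoothD (smoothM (smooth_cst a) (su i)) (sv i).
exists (m + m')%N => i hi; rewrite -[LHS]/(a *: u i + v i) hm ?hm' ?scaler0 ?addr0 //; lia.
Qed.

Lemma ham_ops_lin (a : R) (u v : nat -> fn R) : ham_ops u -> ham_ops v -> ham_ops (a *: u + v).
Proof.
move=> [du su [P1 hu]] [dv_ sv [P2 hv]]; have duv := diffop_lin a du dv_.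
split => //.
  have [N [N0 hNu hNv]] := diffop_bound2 du dv_.
  have hN i : (N <= i)%N -> (a *: u + v) i = 0.
    by move=> hi; rewrite -[LHS]/(a *: u i + v i) hNu ?hNv ?scaler0 ?addr0.
  apply/(skew_adjointP duv hN); rewrite (oparr_lin du dv_ duv).
  exact: adjarr_lin (proj1 (skew_adjointP du hNu) su) (proj1 (skew_adjointP dv_ hNv) sv).
exists (P1 + P2)%N => P hP; rewrite (oparr_lin du dv_ duv).
by apply: bracket_lin; [apply: hu|apply: hv]; lia.
Qed.

Local Notation Z := (cocycles Kf 1 2).
Local Notation B := (coboundaries Kf 1 2).

Lemma cocycleP w P : good w -> bideg 0 0 1 2 w -> fbnd P w ->
  Z w <-> AX (vert (contract ct w)) = AT P (vert (contract cx w)).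
Proof.
move=> gw hw bw; rewrite -(dH_eq0 gw hw bw); split; first by case.
by split => //; exact: good_Omega.
Qed.

Lemma form12_ext v w : good v -> good w -> bideg 0 0 1 2 v -> bideg 0 0 1 2 w ->
  vert (contract cx v) = vert (contract cx w) -> vert (contract ct v) = vert (contract ct w) -> v = w.
Proof.
move=> gv gw hv hw hx ht; apply/eqP; rewrite -subr_eq0; apply/eqP.
have [sx _ _] := good_contract cx gv; have [sx' _ _] := good_contract cx gw.
have [st _ _] := good_contract ct gv; have [st' _ _] := good_contract ct gw.
have [nx _ _] := goodN (good_contract cx gw); have [nt _ _] := goodN (good_contract ct gw).
apply: form12_eq0.
- exact: goodD gv (goodN gw).
- exact: bidegD hv (bidegN hw).
- by rewrite contractB (vertD sx nx) (vertN sx') hx subrr.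
- by rewrite contractB (vertD st nt) (vertN st') ht subrr.
Qed.

Lemma Omega_lin r s (a : R) v w : Omega r s v -> Omega r s w -> Omega r s (a *: v + w).
Proof. by move=> hv hw; apply: OmegaD => //; apply: Omega_fmul => //; exact: smooth_cst. Qed.

Lemma vert_lin (a : R) c v w : good v -> good w ->
  vert (contract c (a *: v + w)) = sc (lift (cst a)) (vert (contract c v)) + vert (contract c w).
Proof.
move=> gv gw; have gc := good_contract c gv; have [sw _ _] := good_contract c gw.
have [s1 _ _] := good_scale a gc.
by rewrite -(vert_scale a gc) -vertD.
Qed.

Lemma bideg_scale a b r s (x : R) w : bideg a b r s w -> bideg a b r s (x *: w).
Proof. by rewrite scale_fmul; exact: bideg_fmul. Qed.

(** If A = 0 then X B = 0, and X is injective on 2-forms. *)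
Lemma cocycle_x0 w : Z w -> vert (contract cx w) = 0 -> w = 0.
Proof.
move=> Zw hx; have [Ow _] := Zw; have [gw hw] := Omega_good Ow.
have [_ _ [P bw]] := gw.
have e := proj1 (cocycleP gw hw bw) Zw.
rewrite hx (raddf0 (AT P)) in e.
apply: (form12_eq0 gw hw hx).
have ht : bideg 0 0 0 2 (contract ct w) by apply: bideg_shift; exact: (bideg_contract (c := ct) hw).
apply/funext => s; have [es|ns] := eqVneq (size s) 2%N; last exact: (bideg_arity ht).
case: s es => [//|i [//|j [|//]]] _.
apply: (@X_inj _ X _ _ (supp_vert (fbnd_contract ct bw)) _ i j) => i' j'.
by rewrite e.
Qed.

Lemma coboundary_facts C : good C -> bideg 0 0 0 2 C ->
  [/\ good (dH Kf C), bideg 0 0 1 2 (dH Kf C) & vert (contract cx (dH Kf C)) = AX (vert C)].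
Proof.
by move=> gC hC; split; [exact: good_dH|exact: (bideg_dH gC hC)|exact: vert_dH_x].
Qed.

Lemma coboundary_cocycle : B `<=` Z.
Proof.
move=> _ [C /= OC <-]; have [gC hC] := Omega_good OC.
have [g1 h1 ex] := coboundary_facts gC hC.
have [_ _ [Q bC]] := gC; have [_ _ [Q' b1]] := g1.
have bC' : fbnd (Q + Q') C by apply: fbnd_le bC; lia.
have b1' : fbnd (Q + Q').+1 (dH Kf C) by apply: fbnd_le b1; lia.
apply/(cocycleP g1 h1 b1'); rewrite ex (vert_dH_t gC bC' hC).
exact: (arrXT (@aXM R) (@aDX R) aXT K (supp_vert bC')).
Qed.

Lemma cocycles_lin : linear_subspace Z.
Proof.
split.
  apply/(@cocycleP 0 0) => //; first exact: good0.
  by rewrite !contract0 vert0 raddf0 (raddf0 (arrT X T D K 0)).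
move=> a v w Zv Zw; have [Ov _] := Zv; have [Ow _] := Zw.
have [gv hv] := Omega_good Ov; have [gw hw] := Omega_good Ow.
have [_ _ [P1 b1]] := gv; have [_ _ [P2 b2]] := gw.
have c1 : fbnd (P1 + P2) v by apply: fbnd_le b1; lia.
have c2 : fbnd (P1 + P2) w by apply: fbnd_le b2; lia.
have ga := goodD (good_scale a gv) gw.
have ha := bidegD (bideg_scale a hv) hw.
have ba : fbnd (P1 + P2) (a *: v + w).
  by apply: fbndD => // i l hi hl; rewrite -[LHS]/(a *: v l) (c1 i) // scaler0.
apply/(cocycleP ga ha ba); rewrite (vert_lin a ct gv gw) (vert_lin a cx gv gw).
exact: commute_lin (proj1 (cocycleP gv hv c1) Zv) (proj1 (cocycleP gw hw c2) Zw).
Qed.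

Lemma coboundaries_lin : linear_subspace B.
Proof.
split.
  by exists 0; [exact: Omega0|case: cocycles_lin => -[]].
move=> a _ _ [C OC <-] [C' OC' <-]; exists (a *: C + C'); first exact: Omega_lin.
have [gC hC] := Omega_good OC; have [gC' hC'] := Omega_good OC'.
have [_ _ [P1 b1]] := gC; have [_ _ [P2 b2]] := gC'.
have c1 : fbnd (P1 + P2) C by apply: fbnd_le b1; lia.
have c2 : fbnd (P1 + P2) C' by apply: fbnd_le b2; lia.
have ga := goodD (good_scale a gC) gC'.
have ha := bidegD (bideg_scale a hC) hC'.
have ba : fbnd (P1 + P2) (a *: C + C').
  by apply: fbndD => // i l hi hl; rewrite -[LHS]/(a *: C l) (c1 i) // scaler0.
have [g1 h1 e1] := coboundary_facts gC hC; have [g2 h2 e2] := coboundary_facts gC' hC'.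
have [g3 h3 e3] := coboundary_facts ga ha.
have [s1 _ _] := good_scale a gC; have [s2 _ _] := gC'.
have et : vert (a *: C + C') = sc (lift (cst a)) (vert C) + vert C'.
  by rewrite (vertD s1 s2) (vert_scale a gC).
apply: esym; apply: (form12_ext (goodD (good_scale a g1) g2) g3 (bidegD (bideg_scale a h1) h2) h3).
  by rewrite (vert_lin a cx g1 g2) e1 e2 e3 et arrX_lin.
rewrite (vert_lin a ct g1 g2) (vert_dH_t gC c1 hC) (vert_dH_t gC' c2 hC') (vert_dH_t ga ba ha) et.
by rewrite arrT_lin.
Qed.

Lemma omega_cocycle r : ham_ops r -> Z (omega n Kf r).
Proof.
move=> [dr sk [P0 hP0]]; have [go ho ex et] := omega_facts dr.
have [_ _ he] := eps_facts dr.
have [_ _ [Q bo]] := go.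
have bo' : fbnd (Q + P0).+1 (omega n Kf r) by apply: fbnd_le bo; lia.
apply/(cocycleP go ho bo'); rewrite ex et (X_dtpart (P := (Q + P0).+1) (@aXM R) aTM DK) //.
have -> := bracket_dbl he (hP0 (Q + P0).+1 _); first by rewrite subr0.
by lia.
Qed.

Lemma coset_refl w : coset_mod B w w.
Proof.
have [b0 _] := coboundaries_lin.
by exists 0 => //; rewrite addr0.
Qed.

Lemma coset_eq w w' : B (w - w') -> coset_mod B w = coset_mod B w'.
Proof.
have [b0 bl] := coboundaries_lin => h.
have hN : B (w' - w) by have := bl (-1) _ _ h b0; rewrite addr0 scaleN1r opprB.
apply/seteqP; split => _ [b hb <-].
  exists ((w - w') + b); first by have := bl 1 _ _ h hb; rewrite scale1r.
  by rewrite addrA [w' + _]addrC subrK.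
exists ((w' - w) + b); first by have := bl 1 _ _ hN hb; rewrite scale1r.
by rewrite addrA [w + _]addrC subrK.
Qed.

(** Applying E to theta^0 /\ (e - e') = X C gives 2 (e - e') = 0. *)
Lemma omega_inj r r' : ham_ops r -> ham_ops r' ->
  coset_mod B (omega n Kf r) = coset_mod B (omega n Kf r') -> r = r'.
Proof.
move=> [dr sk _] [dr' sk' _] hc.
have := coset_refl (omega n Kf r); rewrite hc => -[_ [C OC <-] eC].
have [gC hC] := Omega_good OC; have [g1 h1 e1] := coboundary_facts gC hC.
have [go ho ex _] := omega_facts dr; have [go' ho' ex' _] := omega_facts dr'.
have [_ _ he] := eps_facts dr; have [_ _ he'] := eps_facts dr'.
have E : wtheta 0 (vert (epsilon r')) + AX (vert C) = wtheta 0 (vert (epsilon r)).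
  have [s1 _ _] := good_contract cx go'; have [s2 _ _] := good_contract cx g1.
  by rewrite -ex -eC contractD (vertD s1 s2) ex' e1.
have [N [N0 hN hN']] := diffop_bound2 dr dr'.
have [_ _ [Q bC]] := gC.
pose m := (Q + N)%N; have m0 : (0 < m.+1)%N by [].
have hM i : (m.+1 <= i)%N -> r i = 0 by move=> hi; apply: hN; rewrite /m in hi; lia.
have hM' i : (m.+1 <= i)%N -> r' i = 0 by move=> hi; apply: hN'; rewrite /m in hi; lia.
have bm : fbnd m C by apply: fbnd_le bC; rewrite /m; lia.
set y := AX (vert C) in E.
have E2 := exact_dbl he he' E.
have ey : eulerop X m.+1 y = 0 by apply: eulerop_X; exact: supp_vert.
have hd : adjarr X m.+1 (oparr r' - oparr r) = - (oparr r' - oparr r).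
  rewrite (raddfB (adjarr X m.+1)) /= (proj1 (skew_adjointP dr hM) sk).
  by rewrite (proj1 (skew_adjointP dr' hM') sk') -opprD.
have eyy : eulerop X m.+1 (y + y) = 0 by rewrite (raddfD (eulerop X m.+1)) /= ey addr0.
have := adjarr_fix m0 hd; rewrite E2 => /(_ eyy) /eqP; rewrite subr_eq0 => /eqP es.
apply/funext => i; have [sr _] := dr; have [sr' _] := dr'.
have e : lift (r i) = lift (r' i) by rewrite -(oparr1 dr) -(oparr1 dr') es.
exact: etrans (esym (liftK (sr i))) (etrans (congr1 (@fval R) e) (liftK (sr' i))).
Qed.

(** The operator of a cocycle dx /\ A + dt /\ B is - E(A): with epsilon = E(A)
   / 2, w and omega have the same dx-part up to X C, and then [cocycle_x0]
   identifies the dt-parts as well. *)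
Lemma omega_surj w : Z w -> exists2 r, ham_ops r & coset_mod B (omega n Kf r) = coset_mod B w.
Proof.
move=> Zw; have [Ow _] := Zw; have [gw hw] := Omega_good Ow.
have [_ _ [N0 bw0]] := gw; pose N := N0.+1.
have bw : fbnd N w by apply: fbnd_le bw0.
set cw := contract cx w; pose a := vert cw.
have gc : good cw by exact: good_contract.
have bc : fbnd N cw by exact: fbnd_contract.
have hc : bideg 0 0 0 2 cw by apply: bideg_shift; exact: (bideg_contract (c := cx) hw).
have sa : supp N a by exact: supp_vert.
have la : arity 2 a by exact: bideg_arity.
pose ea := eulerop X N a.
have sea : supp (N + N) ea by exact: supp_eulerop.
have lea : arity 1 ea.
  by apply: arity_sum => i; apply: arity_oppX; exact: arity_ctr.
pose r : nat -> fn R := fun i => fval (- ea [:: i]).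
have hr i : (N + N <= i)%N -> r i = 0.
  by move=> hi; rewrite /r (sea i) ?oppr0 // inE.
have dr : diffop r.
  by split; [move=> i; exact: sfunP|exists (N + N)%N].
have es : oparr r = - ea.
  apply/funext => s; rewrite arrN; have [e|ne] := eqVneq (size s) 1%N; last first.
    by rewrite (oparr_arity dr) // lea // oppr0.
  by case: s e => [//|i [|//]] _; rewrite (oparr1 dr) /r val_lift.
(* 2 A is theta^0 /\ E(A) plus an X-exact term *)
have nf : a + a = wtheta 0 ea + AX (homotopy X N a).
  rewrite -(normal_form (@aXM R)); apply/funext => s; have [sw aw _] := gc.
  rewrite euler_identity //; last exact: alt_vert.
  by rewrite arrD; have [->|ns] := eqVneq (size s) 2%N; [rewrite mulr2n|rewrite la // mul0rn addr0].
have shom : supp (N + N) (homotopy X N a) by exact: supp_homotopy.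
(* E applied to the normal form gives 2 e = e - (adjoint of e) *)
have hadj : adjarr X (N + N).+1 ea = - ea.
  have NN : (N <= (N + N).+1)%N by lia.
  have := congr1 (eulerop X (N + N).+1) nf.
  rewrite !(raddfD (eulerop X _)) /= (eulerop_widen X sa NN) (eulerop_X X shom) eulerop_wtheta0 // addr0 -/ea => h.
  by apply: oppr_inj; rewrite opprK; apply: (addrI ea); rewrite -h.
have sk : skew_adjoint r.
  have hr' i : ((N + N).+1 <= i)%N -> r i = 0 by move=> hi; apply: hr; exact: ltnW.
  by apply/(skew_adjointP dr hr'); rewrite es (raddfN (adjarr X _)) /= hadj.
have ham P : (N + N <= P)%N -> wtheta 0 (AT P (oparr r) + LS (oparr r)) = 0.
  move=> hP; have bP : fbnd P w by apply: fbnd_le bw; lia.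
  have e := proj1 (cocycleP gw hw bP) Zw.
  have bt : supp N (vert (contract ct w)) by apply: supp_vert; exact: fbnd_contract.
  have h := cocycle_eulerop (@aXM R) (@aDX R) aXT DK sa bt hP e.
  rewrite es (raddfN (AT P)) (raddfN LS) -opprD /= h oppr0.
  exact: raddf0.
have hamr : ham_ops r by split => //; exists (N + N)%N.
exists r => //.
(* a form whose array is the homotopy, term by term *)
pose tm i k := wedge (gen (cu (i - k.+1))) (iter k (@oppDx R) (contract (cu i) cw)).
have tmP i k : [/\ good (tm i k), bideg 0 0 0 2 (tm i k) &
    vert (tm i k) = wtheta (i - k.+1)%N (iter k (oppX X) (ctr i a))].
  have gi := good_contract (cu i) gc; have gk := good_iter k gi.
  have hk : bideg 0 1 0 2 (iter k (@oppDx R) (contract (cu i) cw)).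
    by apply: bideg_iter => //; exact: (bideg_contract (c := cu i) hc).
  have hk' : bideg 0 0 0 1 (iter k (@oppDx R) (contract (cu i) cw)).
    by move=> l hl; apply: hk; move: hl; rewrite !add0n add1n.
  split; first exact: good_gen_wedge _ gk.
    exact: bideg_gen_u hk'.
  by rewrite /tm vert_gen_wedge ?vert_iter //; case: gk.
pose H := \sum_(i < N) \sum_(k < i) tm i k.
have gH : good H by apply: good_sum => i; apply: good_sum => k; case: (tmP i k).
have hH : bideg 0 0 0 2 H by apply: bideg_sum => i; apply: bideg_sum => k; case: (tmP i k).
have tH : vert H = homotopy X N a.
  rewrite /H vert_sum => [|i]; last by apply: good_sum => k; case: (tmP i k).
  apply: eq_bigr => i _; rewrite vert_sum => [|k]; last by case: (tmP i k).
  by apply: eq_bigr => k _; case: (tmP i k).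
pose C := (2^-1 : R) *: H.
have gC : good C by exact: good_scale.
have hC : bideg 0 0 0 2 C by exact: bideg_scale.
have tC : vert C + vert C = homotopy X N a.
  have [s1 _ _] := gC; rewrite -(vertD s1 s1) -tH; congr vert.
  by rewrite /C -scalerDl -[2^-1]mul1r -splitr scale1r.
have [g1 h1 e1] := coboundary_facts gC hC.
have [go ho ex _] := omega_facts dr; have [_ _ he] := eps_facts dr.
have BC : B (dH Kf C) by exists C => //; exact: good_Omega.
have [z0 zl] := cocycles_lin.
have zN v : Z v -> Z (- v) by move=> zv; have := zl (-1) _ _ zv z0; rewrite addr0 scaleN1r.
have zD v v' : Z v -> Z v' -> Z (v + v') by move=> zv zv'; have := zl 1 _ _ zv zv'; rewrite scale1r.
have E : w - omega n Kf r - dH Kf C = 0.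
  apply: cocycle_x0.
    exact: (zD _ _ (zD _ _ Zw (zN _ (omega_cocycle hamr))) (zN _ (coboundary_cocycle BC))).
  have [s1 _ _] := gc; have [s2 _ _] := good_contract cx go; have [s3 _ _] := good_contract cx g1.
  have [s4 _ _] := goodN (good_contract cx go); have [s5 _ _] := goodN (good_contract cx g1).
  have [s6 _ _] := goodD gc (goodN (good_contract cx go)).
  rewrite !contractB -/cw (vertD s6 s5) (vertN s3) (vertD s1 s4) (vertN s2) ex e1 -/a.
  by apply: normal_dbl nf _ tC; rewrite he es opprK.
apply: coset_eq; have [b0 bl] := coboundaries_lin.
have -> : omega n Kf r - w = - dH Kf C.
  by rewrite -opprB; congr (- _); apply/eqP; rewrite -subr_eq0 E.
by have := bl (-1) _ _ BC b0; rewrite addr0 scaleN1r.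
Qed.

Theorem phi_isomorphism : linear_isomorphism (hamiltonian_operators Kf) Z B
  (fun r => coset_mod B (omega n Kf r)).
Proof.
have [b0 bl] := coboundaries_lin; have [z0 zl] := cocycles_lin.
split.
- split; first by apply/hamiltonian_operatorsP; exact: ham_ops0.
  move=> a u v /hamiltonian_operatorsP hu /hamiltonian_operatorsP hv.
  by apply/hamiltonian_operatorsP; exact: ham_ops_lin.
- by split; [exact: cocycles_lin|exact: coboundaries_lin|exact: coboundary_cocycle].
- split.
  + move=> r /hamiltonian_operatorsP hr; exists (omega n Kf r) => //.
    exact: omega_cocycle.
  + move=> r r' /set_mem /hamiltonian_operatorsP hr /set_mem /hamiltonian_operatorsP hr'.
    exact: omega_inj.
  + move=> _ [w Zw <-]; have [r hr e] := omega_surj Zw.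
    by exists r => //; apply/hamiltonian_operatorsP.
move=> a u v /hamiltonian_operatorsP hu /hamiltonian_operatorsP hv w w'.
move=> [b hb <-] [b' hb' <-]; apply: coset_eq.
have zlin := omega_cocycle (ham_ops_lin a hu hv).
have zN x : Z x -> Z (- x) by move=> zx; have := zl (-1) _ _ zx z0; rewrite addr0 scaleN1r.
have zu := omega_cocycle hu; have zv := omega_cocycle hv.
have E : omega n Kf (a *: u + v) - (a *: omega n Kf u + omega n Kf v) = 0.
  apply: cocycle_x0.
    by have := zl 1 _ _ zlin (zN _ (zl a _ _ zu zv)); rewrite scale1r.
  have [du _ _] := hu; have [dv_ _ _] := hv; have duv := diffop_lin a du dv_.
  have [gu hu2 xu _] := omega_facts du; have [gv hv2 xv _] := omega_facts dv_.
  have [gw _ xw _] := omega_facts duv.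
  have [_ _ eu] := eps_facts du; have [_ _ ev_] := eps_facts dv_; have [_ _ ew] := eps_facts duv.
  have ga := goodD (good_scale a gu) gv.
  have [s1 _ _] := good_contract cx gw; have [s2 _ _] := goodN (good_contract cx ga).
  have [s3 _ _] := good_contract cx ga.
  rewrite contractB (vertD s1 s2) (vertN s3) (vert_lin a cx gu gv) xw xu xv.
  by rewrite (wtheta_lin (oparr_lin du dv_ duv) eu ev_ ew) subrr.
have -> : omega n Kf (a *: u + v) - (a *: (omega n Kf u + b) + (omega n Kf v + b')) = - (a *: b + b').
  rewrite scalerDr addrACA opprD addrA.
  by move/eqP: E => /eqP ->; rewrite sub0r.
by have := bl (-1) _ _ (bl a _ _ hb hb') b0; rewrite addr0 scaleN1r.
Qed.
End Main.

Theorem theorem1p3 (R : realType) (n : nat) (K : fn R)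
  (hn : (2 <= n)%N)
  (hKsmooth : smooth K)
  (hKorder : depends_upto n K)
  (hKn : forall p : jet R, partial (cu n) K p != 0) :
  linear_isomorphism
    (hamiltonian_operators K) (cocycles K 1 2) (coboundaries K 1 2)
    (fun r => coset_mod (coboundaries K 1 2) (omega n K r)).
Proof.
have eK : fval (lift K) = K := liftK hKsmooth.
have DK i : (n < i)%N -> aD R i (lift K) = 0.
  move=> hi; apply: sfun_inj; rewrite [LHS]val_sd eK.
  exact: partial_depends_upto hKorder hi.
have Kn_reg f : aD R n (lift K) * f = 0 -> f = 0.
  by apply: sfun_reg => p; rewrite [fval _]val_sd eK; exact: hKn.
by have := phi_isomorphism hn DK Kn_reg; rewrite eK.
Qed.
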